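(* Let $m,m'\ge 1$ be integers, let $R=\prod_{i=1}^m R_i$ and $R'=\prod_{j=1}^{m'}R'_j$ with $R_i=\mathrm{End}_{K_i}(U_i)$ and $R'_j=\mathrm{End}_{K'_j}(U'_j)$, where $U_i$ is a left vector space over a (not necessarily commutative) field $K_i$, $U'_j$ is a left vector space over a (not necessarily commutative) field $K'_j$, and $1\le \dim U_i<\infty$, $1\le\dim U'_j<\infty$ for all $i,j$. For a mapping $\varphi:\mathbb P(R)\to\mathbb P(R')$ the following statements are equivalent: (a) $\varphi$ is a $\triangle$-isomorphism. (b) $m=m'$, and there are a permutation $\sigma$ of $\{1,\dots,m\}$ and $\triangle$-isomorphisms $\varphi_k:\mathbb P(R_k)\to\mathbb P(R'_{k^\sigma})$, $k\in\{1,\dots,m\}$, such that $(p^\varphi)_{k^\sigma}=(p_k)^{\varphi_k}$ for each $p\in\mathbb P(R)$ and each $k\in\{1,\dots,m\}$. In this case, if $\dim U_i>1$ for all $i\in\{1,\dots,m\}$, then $\varphi=\widetilde\alpha\,\widetilde\gamma$ (first $\widetilde\alpha$, then $\widetilde\gamma$), where $\gamma\in\mathrm{GL}_2(R')$ and $\alpha:R\to R'$ is a Jordan isomorphism such that for each $x\in R$ and each $k\in\{1,\dots,m\}$ we have $(x^\alpha)_{k^\sigma}=(x_k)^{\alpha_k}$, with each $\alpha_k:R_k\to R'_{k^\sigma}$ an isomorphism or an anti-isomorphism of rings.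
   Context: Rings are associative with unit $1\ne0$ (preserved by homomorphisms and anti-homomorphisms). Fields need not be commutative. Mappings are written on the right as exponents, and products of mappings (including products in endomorphism rings) are read from left to right: $x^{fg}=(x^f)^g$. Projective line: $\mathbb P(R)$ is the set of all submodules $R(a,b)$ of the left module $R^2$ such that $(a,b)$ is the first row of a matrix in $\mathrm{GL}_2(R)$. Points $p,q\in\mathbb P(R)$ are distant, $p\,\triangle\,q$, if $p=R(a,b)$, $q=R(c,d)$ for some matrix $\begin{pmatrix}a&b\\c&d\end{pmatrix}\in\mathrm{GL}_2(R)$. A $\triangle$-isomorphism $\varphi:\mathbb P(R)\to\mathbb P(R')$ is a bijection with $p\,\triangle\,q\Leftrightarrow p^\varphi\,\triangle\,q^\varphi$ for all $p,q$. For $R=\prod_i R_i$, elements $x\in R$ are written $x=(x_i)_i$, and $\mathbb P(R)$ is identified with $\prod_i\mathbb P(R_i)$ by letting $R\big((a_i)_i,(b_i)_i\big)$ correspond to $\big(R_i(a_i,b_i)\big)_i$; $p_i$ denotes the $i$-th component of $p\in\mathbb P(R)$. For $\gamma\in\mathrm{GL}_2(R')$, the projectivity $\widetilde\gamma:\mathbb P(R')\to\mathbb P(R')$ is $R'(a,b)\mapsto R'\big((a,b)\gamma\big)$. A Jordan homomorphism $\alpha:R\to R'$ is an additive mapping with $1^\alpha=1$ and $(aba)^\alpha=a^\alpha b^\alpha a^\alpha$ for all $a,b\in R$; a Jordan isomorphism is a bijective Jordan homomorphism. For the rings $R$ considered here (which have stable rank 2) it is known that $\mathbb P(R)=\{R(ab-1,a)\mid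 a,b\in R\}$ and that a Jordan homomorphism $\alpha:R\to R'$ gives a well-defined mapping $\widetilde\alpha:\mathbb P(R)\to\mathbb P(R')$, $R(ab-1,a)\mapsto R'(a^\alpha b^\alpha-1,a^\alpha)$. *)

(* Defs.v *)
From HB Require Import structures.
From mathcomp Require Import all_boot all_order all_algebra all_fingroup.
From mathcomp Require Import boolp classical_sets.

Set Implicit Arguments.
Unset Strict Implicit.
Unset Printing Implicit Defensive.

Import GRing.Theory.
Local Open Scope ring_scope.
Local Open Scope classical_set_scope.

(* The library's ring structure on 'End(U) is only stated over commutative
   base rings; here K is any ring.  Products are read from left to right:
   (f * g) u = g (f u).  The ring is trivial when dim U = 0, hence pzRingType. *)
Section EndomorphismRing.
Variables (K : nzRingType) (U : vectType K).

Definition endo : Type := 'End(U).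
HB.instance Definition _ := GRing.Zmodule.on endo.

Definition endo_mul (f g : endo) : endo := comp_lfun g f.

Fact endo_mulA : associative endo_mul.
Proof. by move=> f g h; rewrite /endo_mul comp_lfunA. Qed.
Fact endo_mul1l : left_id (\1%VF : endo) endo_mul.
Proof. by move=> f; apply: comp_lfun1r. Qed.
Fact endo_mul1r : right_id (\1%VF : endo) endo_mul.
Proof. by move=> f; apply: comp_lfun1l. Qed.
Fact endo_mulDl : left_distributive endo_mul +%R.
Proof. by move=> f g h; apply: comp_lfunDr. Qed.
Fact endo_mulDr : right_distributive endo_mul +%R.
Proof. by move=> f g h; apply: comp_lfunDl. Qed.

HB.instance Definition _ := GRing.Zmodule_isPzRing.Build endo
  endo_mulA endo_mul1l endo_mul1r endo_mulDl endo_mulDr.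
End EndomorphismRing.

Section ProductRing.
Variables (I : finType) (R : I -> pzRingType).

Definition prod_ring : Type := {dffun forall i, R i}.
HB.instance Definition _ := Choice.on prod_ring.

Implicit Types x y z : prod_ring.
Definition prod_ring0 : prod_ring := [ffun i => 0 : R i].
Definition prod_ring1 : prod_ring := [ffun i => 1 : R i].
Definition prod_ring_opp x : prod_ring := [ffun i => - x i : R i].
Definition prod_ring_add x y : prod_ring := [ffun i => x i + y i : R i].
Definition prod_ring_mul x y : prod_ring := [ffun i => x i * y i : R i].

Fact prod_ring_addA : associative prod_ring_add.
Proof. by move=> x y z; apply/ffunP=> i; rewrite !ffunE addrA. Qed.
Fact prod_ring_addC : commutative prod_ring_add.
Proof. by move=> x y; apply/ffunP=> i; rewrite !ffunE addrC. Qed.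
Fact prod_ring_add0 : left_id prod_ring0 prod_ring_add.
Proof. by move=> x; apply/ffunP=> i; rewrite !ffunE add0r. Qed.
Fact prod_ring_addN : left_inverse prod_ring0 prod_ring_opp prod_ring_add.
Proof. by move=> x; apply/ffunP=> i; rewrite !ffunE addNr. Qed.
HB.instance Definition _ := GRing.isZmodule.Build prod_ring
  prod_ring_addA prod_ring_addC prod_ring_add0 prod_ring_addN.

Fact prod_ring_mulA : associative prod_ring_mul.
Proof. by move=> x y z; apply/ffunP=> i; rewrite !ffunE mulrA. Qed.
Fact prod_ring_mul1l : left_id prod_ring1 prod_ring_mul.
Proof. by move=> x; apply/ffunP=> i; rewrite !ffunE mul1r. Qed.
Fact prod_ring_mul1r : right_id prod_ring1 prod_ring_mul.
Proof. by move=> x; apply/ffunP=> i; rewrite !ffunE mulr1. Qed.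
Fact prod_ring_mulDl : left_distributive prod_ring_mul +%R.
Proof. by move=> x y z; apply/ffunP=> i; rewrite !ffunE mulrDl. Qed.
Fact prod_ring_mulDr : right_distributive prod_ring_mul +%R.
Proof. by move=> x y z; apply/ffunP=> i; rewrite !ffunE mulrDr. Qed.
HB.instance Definition _ := GRing.Zmodule_isPzRing.Build prod_ring
  prod_ring_mulA prod_ring_mul1l prod_ring_mul1r
  prod_ring_mulDl prod_ring_mulDr.

Definition coord_at (i : I) (x : prod_ring) : R i := x i.

Fact coord_at_zmod i : zmod_morphism (coord_at i).
Proof. by move=> x y; rewrite /coord_at !ffunE. Qed.
Fact coord_at_monoid i : monoid_morphism (coord_at i).
Proof. by split=> [|x y]; rewrite /coord_at !ffunE. Qed.
HB.instance Definition _ i :=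
  GRing.isZmodMorphism.Build prod_ring (R i) (coord_at i) (coord_at_zmod i).
HB.instance Definition _ i :=
  GRing.isMonoidMorphism.Build prod_ring (R i) (coord_at i) (coord_at_monoid i).

Lemma coord_at_surj i (y : R i) : exists x, coord_at i x = y.
Proof.
by exists [ffun j => dfwith (fun j => 0 : R j) y j]; rewrite /coord_at ffunE dfwith_in.
Qed.
End ProductRing.

Section ProjectiveLine.
Variable R : pzRingType.

Definition invertible_mx (A : 'M[R]_2) : Prop :=
  exists B : 'M[R]_2, A *m B = 1%:M /\ B *m A = 1%:M.

Record GL2 := MkGL2 { GL2_mx :> 'M[R]_2; GL2P : invertible_mx GL2_mx }.

Definition cyclic_submod (v : 'rV[R]_2) : set 'rV[R]_2 :=
  [set x *: v | x in [set: R]].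

Record projline := MkPoint {
  point_set :> set 'rV[R]_2;
  point_setP : exists A : GL2, point_set = cyclic_submod (row 0 A) }.

Definition distant (p q : projline) : Prop :=
  exists A : GL2, p = cyclic_submod (row 0 A) :> set _ /\
                  q = cyclic_submod (row 1 A) :> set _.

Definition row2 (a b : R) : 'rV[R]_2 := \row_j (if j == 0 then a else b).

Definition mx2 (a b c d : R) : 'M[R]_2 :=
  \matrix_(i, j) (if i == 0 then row2 a b 0 j else row2 c d 0 j).

Lemma mx2M a b c d a' b' c' d' :
  mx2 a b c d *m mx2 a' b' c' d' =
  mx2 (a * a' + b * c') (a * b' + b * d') (c * a' + d * c') (c * b' + d * d').
Proof.
apply/matrixP=> i j; rewrite !mxE big_ord_recl big_ord1 !mxE /=.
by case: (i == 0); case: (j == 0).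
Qed.

Lemma mx2_1 : mx2 1 0 0 1 = 1%:M.
Proof.
by apply/matrixP=> -[[|[|i]] // Hi] [[|[|j]] // Hj]; rewrite !mxE.
Qed.

Lemma row0_mx2 a b c d : row 0 (mx2 a b c d) = row2 a b.
Proof. by apply/rowP=> j; rewrite !mxE. Qed.

Lemma jordan_mx_inv (a b : R) : invertible_mx (mx2 (a * b - 1) a b 1).
Proof.
exists (mx2 (- 1) a b (1 - b * a)); rewrite !mx2M -mx2_1; split; congr mx2.
- by rewrite mulrN1 opprB subrK.
- by rewrite mulrBl mulrBr mulr1 mul1r mulrA addrA subrK subrr.
- by rewrite mulrN1 mul1r addNr.
- by rewrite mul1r addrC subrK.
- by rewrite mulN1r opprB subrK.
- by rewrite mulN1r mulr1 addNr.
- by rewrite mulrBr mulrBl mulr1 mul1r mulrA addrA subrK subrr.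
- by rewrite mulr1 addrC subrK.
Qed.

Lemma jordan_pointP (a b : R) :
  exists A : GL2, cyclic_submod (row2 (a * b - 1) a) = cyclic_submod (row 0 A).
Proof. by exists (MkGL2 (jordan_mx_inv a b)); rewrite row0_mx2. Qed.

(* The point R(ab - 1, a). *)
Definition jordan_point (a b : R) : projline := MkPoint (jordan_pointP a b).

Lemma invertible_mxM (A B : 'M[R]_2) :
  invertible_mx A -> invertible_mx B -> invertible_mx (A *m B).
Proof.
move=> [A' [AA' A'A]] [B' [BB' B'B]]; exists (B' *m A'); split.
  by rewrite -mulmxA [B *m _]mulmxA BB' mul1mx.
by rewrite -mulmxA [A' *m _]mulmxA A'A mul1mx.
Qed.

Lemma projectivity_subproof (g : GL2) (p : projline) :
  exists A : GL2, [set v *m g | v in (p : set _)] = cyclic_submod (row 0 A).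
Proof.
have [A ->] := point_setP p.
exists (MkGL2 (invertible_mxM (GL2P A) (GL2P g))) => /=; rewrite row_mul.
apply/seteqP; split=> [_ [_ [x _ <-] <-]|_ [x _ <-]].
  by exists x => //; rewrite scalemxAl.
by exists (x *: row 0 A); [exists x | rewrite scalemxAl].
Qed.

(* As a set of vectors, R((a,b)g) is the image of R(a,b) under v |-> v g. *)
Definition projectivity (g : GL2) (p : projline) : projline :=
  MkPoint (projectivity_subproof g p).

End ProjectiveLine.

Section Component.
Variables (I : finType) (R : I -> pzRingType).

Lemma component_subproof (i : I) (p : projline (prod_ring R)) :
  exists A : GL2 (R i),
    [set map_mx (coord_at i) v | v in (p : set _)] = cyclic_submod (row 0 A).
Proof.
have [A ->] := point_setP p; have [B [AB BA]] := GL2P A.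
have invA : invertible_mx (map_mx (coord_at i) A).
  by exists (map_mx (coord_at i) B); rewrite -!map_mxM AB BA map_mx1.
exists (MkGL2 invA) => /=; rewrite -map_row.
apply/seteqP; split=> [_ [_ [x _ <-] <-]|_ [y _ <-]].
  by exists (coord_at i x) => //; rewrite map_mxZ.
have [x <-] := coord_at_surj y.
by exists (x *: row 0 A); [exists x | rewrite map_mxZ].
Qed.

(* The point R(a,b) has components R_i(a_i,b_i): applying x |-> x_i entrywise
   maps the set R(a,b) onto R_i(a_i,b_i). *)
Definition component (i : I) (p : projline (prod_ring R)) : projline (R i) :=
  MkPoint (component_subproof i p).
End Component.

Section Morphisms.
Variables R S : pzRingType.

Definition distant_iso (phi : projline R -> projline S) : Prop :=
  bijective phi /\ forall p q, distant p q <-> distant (phi p) (phi q).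

Definition jordan_hom (f : R -> S) : Prop :=
  [/\ {morph f : x y / x + y}, f 1 = 1 &
      forall a b, f (a * b * a) = f a * f b * f a].

Definition jordan_iso (f : R -> S) : Prop := jordan_hom f /\ bijective f.

Definition ring_iso (f : R -> S) : Prop :=
  [/\ zmod_morphism f, monoid_morphism f & bijective f].

Definition ring_anti_iso (f : R -> S) : Prop :=
  [/\ zmod_morphism f, f 1 = 1, {morph f : x y / x * y >-> y * x}
    & bijective f].

(* [jordan_induced f h] says that h is the mapping induced by f, that is, that
   R(ab - 1, a) |-> S(f(a) f(b) - 1, f(a)) is well defined on all of projline R
   and is equal to h. *)
Definition jordan_induced (f : R -> S) (h : projline R -> projline S) : Prop :=
  forall p q, h p = q <->
    exists a b, p = jordan_point a b /\ q = jordan_point (f a) (f b).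

End Morphisms.

Section Componentwise.
Variables (m m' : nat) (R : 'I_m -> pzRingType) (R' : 'I_m' -> pzRingType).

Definition componentwise (phi : projline (prod_ring R) -> projline (prod_ring R'))
    (e : m = m') (s : 'S_m)
    (phi_ : forall k, projline (R k) -> projline (R' (cast_ord e (s k)))) : Prop :=
  (forall k, distant_iso (phi_ k)) /\
  (forall p k, component (cast_ord e (s k)) (phi p) = phi_ k (component k p)).
End Componentwise.

(* Main.v *)
(* Splitting into factors.  For p, q, r on P(End U) with r different from p and
   q, some point is distant from p and q but not from r.  Hence in the product
   the set of all r such that every z distant from p and q is distant from r is
   the box prod_i {p_i, q_i}, so a distance preserving bijection preserves the
   relation "differ in exactly one coordinate", i.e. it is an isomorphism of
   Hamming graphs.  Chasing squares shows that it permutes the coordinate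
   directions uniformly.

   One factor with dim U > 1.  Identify End U with n x n matrices over a
   division ring D and normalize phi so that it fixes R(1,0), R(0,1) and R(1,1);
   it then acts on the affine points R(x,1) through a bijection f.  For p <> q
   the set of all r such that z distant from r implies z distant from p or q is
   {p, q}, unless p and q are adjacent, when it is the pencil through p and q.
   So f preserves adjacency (rank one differences) and maps each line
   {x + u t v : t in D} to a line, and two such lines are parallel (share their
   point at infinity) as soon as they differ by an element of
   u D^n + D^n v.  Directions of lines form a rook's graph, with rows and columns
   either preserved or exchanged; together with parallelism this shows that the
   direction of the image of a line does not depend on its base point, which
   forces f to be additive.  Rank one idempotents are recognized by units, and
   computing with them gives multiplicativity, or antimultiplicativity after a
   transposition.  Finally every point is determined by the affine points
   distant from it, so phi is induced by f everywhere. *)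
Require Import Defs.
From mathcomp Require Import all_boot all_order all_algebra all_fingroup.
From mathcomp Require Import boolp classical_sets.

Set Implicit Arguments.
Unset Strict Implicit.
Unset Printing Implicit Defensive.

Import GRing.Theory.
Local Open Scope ring_scope.

(** * Points of the projective line over a ring *)

Section Line.
Variable R : pzRingType.
Implicit Types (a b c d x y : R) (p q r : projline R).

Definition isunit x := exists y, x * y = 1 /\ y * x = 1.

Lemma isunit1 : isunit 1.
Proof. by exists 1; rewrite mulr1. Qed.

Lemma isunitM x y : isunit x -> isunit y -> isunit (x * y).
Proof.
move=> [x' [h1 h2]] [y' [h3 h4]]; exists (y' * x'); split.
  by rewrite mulrA -(mulrA x) h3 mulr1.
by rewrite mulrA -(mulrA y') h2 mulr1.
Qed.

Lemma isunitN x : isunit x -> isunit (- x).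
Proof. by move=> [y [h1 h2]]; exists (- y); rewrite !mulrNN. Qed.

(** Jacobson's trick: with [w] inverse to [x * y - 1], the formal geometric series suggests
    [y * w * x - 1] as the inverse. This makes anti-isomorphisms compatible with the points R(ab -
    1, a). *)
Lemma isunit_sub1 x y : isunit (x * y - 1) -> isunit (y * x - 1).
Proof.
move=> [w [h1 h2]]; exists (y * w * x - 1).
have e1 : x * y * w = 1 + w by rewrite -h1 mulrBl mul1r subrK.
have e2 : w * (x * y) = 1 + w by rewrite -h2 mulrBr mulr1 subrK.
split.
  rewrite mulrBl mul1r mulrBr mulr1.
  have -> : y * x * (y * w * x) = y * x + y * w * x.
    by rewrite -!mulrA (mulrA x) (mulrA (x * y)) e1 mulrDl mul1r mulrDr.
  by rewrite [y * x + _]addrC addrK opprB addrC subrK.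
rewrite mulrBr mulr1 mulrBl mul1r.
have -> : y * w * x * (y * x) = y * x + y * w * x.
  by rewrite -!mulrA (mulrA x) (mulrA w) e2 mulrDl mul1r mulrDr.
by rewrite [y * x + _]addrC addrK opprB addrC subrK.
Qed.

Lemma mx2_eta (A : 'M[R]_2) : A = mx2 (A 0 0) (A 0 1) (A 1 0) (A 1 1).
Proof.
apply/matrixP=> -[[|[|i]] // Hi] [[|[|j]] // Hj]; rewrite !mxE /=;
  by congr (A _ _); apply: val_inj.
Qed.

Lemma mx2_inj a b c d a' b' c' d' : mx2 a b c d = mx2 a' b' c' d' ->
  [/\ a = a', b = b', c = c' & d = d'].
Proof.
move=> /matrixP e.
by move: (e 0 0) (e 0 1) (e 1 0) (e 1 1); rewrite !mxE.
Qed.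

Lemma row1_mx2 a b c d : row 1 (mx2 a b c d) = row2 c d.
Proof. by apply/rowP=> j; rewrite !mxE. Qed.

Lemma row2_mul a b (A : 'M[R]_2) :
  row2 a b *m A = row2 (a * A 0 0 + b * A 1 0) (a * A 0 1 + b * A 1 1).
Proof.
apply/rowP=> -[[|[|j]] // Hj]; rewrite !mxE big_ord_recl big_ord1 !mxE /=;
  by congr (_ * A _ _ + _ * A _ _); apply: val_inj.
Qed.

Lemma row2Z x a b : x *: row2 a b = row2 (x * a) (x * b).
Proof. by apply/rowP=> j; rewrite !mxE; case: (j == 0). Qed.

Lemma row2_inj a b c d : row2 a b = row2 c d -> a = c /\ b = d.
Proof. by move=> /rowP e; move: (e 0) (e 1); rewrite !mxE. Qed.

Lemma mx2_invP a b c d : invertible_mx (mx2 a b c d) <->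
  exists p q r t : R, [/\ a * p + b * r = 1, a * q + b * t = 0,
                      c * p + d * r = 0 & c * q + d * t = 1] /\
                  [/\ p * a + q * c = 1, p * b + q * d = 0,
                      r * a + t * c = 0 & r * b + t * d = 1].
Proof.
split=> [[B []]|[p [q [r [t [[e1 e2 e3 e4] [e5 e6 e7 e8]]]]]]].
  rewrite (mx2_eta B) !mx2M -mx2_1 => /mx2_inj[e1 e2 e3 e4] /mx2_inj[*].
  by exists (B 0 0), (B 0 1), (B 1 0), (B 1 1).
exists (mx2 p q r t); rewrite !mx2M -mx2_1; split; congr mx2 => //.
Qed.

Lemma invertible_mul_iff (A B : 'M[R]_2) : invertible_mx A ->
  (invertible_mx (A *m B) <-> invertible_mx B).
Proof.
move=> hA; split; last exact: invertible_mxM.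
have [A' [e1 e2]] := hA; move=> h.
rewrite -[B]mul1mx -e2 -mulmxA; apply: invertible_mxM => //.
by exists A.
Qed.

Lemma invertible_mulr_iff (A B : 'M[R]_2) : invertible_mx A ->
  (invertible_mx (B *m A) <-> invertible_mx B).
Proof.
move=> hA; split; last by move=> hB; apply: invertible_mxM.
have [A' [e1 e2]] := hA; move=> h.
rewrite -[B]mulmx1 -e1 mulmxA; apply: invertible_mxM => //.
by exists A.
Qed.

Lemma point_eq p q : point_set p = point_set q -> p = q.
Proof.
case: p q => [P hP] [Q hQ] /= e; subst Q.
by rewrite (Prop_irrelevance hP hQ).
Qed.

(* [prep a b p]: [(a, b)] is the first row of an invertible matrix, and
   p = R(a, b). *)
Definition prep a b p :=
  (exists c d, invertible_mx (mx2 a b c d)) /\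
  point_set p = cyclic_submod (row2 a b).

Lemma prep_ex p : exists a b, prep a b p.
Proof.
have [A e] := point_setP p; exists (A 0 0), (A 0 1); split.
  by exists (A 1 0), (A 1 1); rewrite -mx2_eta; apply: GL2P.
by rewrite e; congr cyclic_submod; apply/rowP=> -[[|[|j]] // Hj];
  rewrite !mxE /=; congr (fun_of_matrix _ _ _); apply: val_inj.
Qed.

Lemma prep_mk a b c d : invertible_mx (mx2 a b c d) -> exists p, prep a b p.
Proof.
move=> h; have hp : exists A : GL2 R, cyclic_submod (row2 a b) =
    cyclic_submod (row 0 A) by exists (MkGL2 h); rewrite row0_mx2.
by exists (MkPoint hp); split=> //; exists c, d.
Qed.

Lemma prep_eq a b p q : prep a b p -> prep a b q -> p = q.
Proof. by move=> [_ e1] [_ e2]; apply: point_eq; rewrite e1 e2. Qed.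

Lemma prep_scale x a b p : isunit x -> prep a b p -> prep (x * a) (x * b) p.
Proof.
move=> [y [xy yx]] [[c [d h]] e]; split.
  exists c, d.
  have -> : mx2 (x * a) (x * b) c d = mx2 x 0 0 1 *m mx2 a b c d.
    by rewrite mx2M !mul0r !addr0 !add0r !mul1r.
  apply/invertible_mul_iff => //; exists (mx2 y 0 0 1).
  by rewrite !mx2M !mul0r !mulr0 !addr0 !add0r !mul1r xy yx -mx2_1.
rewrite e; apply/seteqP; split=> [_ [z _ <-]|_ [z _ <-]].
  exists (z * y) => //; rewrite !row2Z !mulrA.
  by rewrite -(mulrA z) yx mulr1.
by exists (z * x) => //; rewrite !row2Z !mulrA.
Qed.

Lemma prep_unimod a b p : prep a b p -> exists s t, a * s + b * t = 1.
Proof.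
move=> [[c [d /mx2_invP[s [_ [t [_ [[e _ _ _] _]]]]]]] _].
by exists s, t.
Qed.

(** Each row is a left multiple of the other, and since both are unimodular the two multipliers are
    mutually inverse. *)
Lemma prep_uniq a b c d p : prep a b p -> prep c d p ->
  exists x, [/\ isunit x, c = x * a & d = x * b].
Proof.
move=> h1 h2.
have [s [t e1]] := prep_unimod h1; have [s' [t' e2]] := prep_unimod h2.
case: h1 h2 => _ h1 [_ h2].
have: cyclic_submod (row2 c d) (row2 c d) by exists 1 => //; rewrite scale1r.
rewrite -h2 h1 => -[x _]; rewrite row2Z => /row2_inj[ec ed].
have: cyclic_submod (row2 a b) (row2 a b) by exists 1 => //; rewrite scale1r.
rewrite -h1 h2 => -[y _]; rewrite row2Z => /row2_inj[ea eb].
exists x; split=> //; exists y; split.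
  rewrite -e2 -[x * y]mulr1 -[X in x * y * X]e2 mulrDr -!mulrA.
  by rewrite (mulrA y) ea (mulrA y) eb !mulrA ec ed.
rewrite -e1 -[y * x]mulr1 -[X in y * x * X]e1 mulrDr -!mulrA.
by rewrite (mulrA x) ec (mulrA x) ed !mulrA ea eb.
Qed.

(** [distant] supplies representatives of its own; by [prep_uniq] the given ones differ from them by
    an invertible diagonal factor on the left. *)
Lemma distantP a b c d p q : prep a b p -> prep c d q ->
  (distant p q <-> invertible_mx (mx2 a b c d)).
Proof.
move=> hp hq; split=> [[A [ep eq]]|h]; last first.
  exists (MkGL2 h); rewrite /= row0_mx2 row1_mx2.
  by split; [case: hp | case: hq].
have hA := GL2P A; rewrite (mx2_eta A) in hA ep eq.
rewrite row0_mx2 in ep; rewrite row1_mx2 in eq.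
have hp' : prep (A 0 0) (A 0 1) p by split=> //; exists (A 1 0), (A 1 1).
have hq' : prep (A 1 0) (A 1 1) q.
  split=> //; exists (A 0 0), (A 0 1).
  have -> : mx2 (A 1 0) (A 1 1) (A 0 0) (A 0 1) =
      mx2 0 1 1 0 *m mx2 (A 0 0) (A 0 1) (A 1 0) (A 1 1).
    by rewrite mx2M !mul0r !mul1r !addr0 !add0r.
  apply/invertible_mul_iff => //; exists (mx2 0 1 1 0).
  by rewrite !mx2M !mul0r !mulr0 !mul1r !addr0 !add0r mx2_1.
have [x [hx -> ->]] := prep_uniq hp' hp.
have [y [hy -> ->]] := prep_uniq hq' hq.
have -> : mx2 (x * A 0 0) (x * A 0 1) (y * A 1 0) (y * A 1 1) =
   mx2 x 0 0 y *m mx2 (A 0 0) (A 0 1) (A 1 0) (A 1 1).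
  by rewrite mx2M !mul0r !addr0 !add0r.
apply/invertible_mul_iff => //.
have [x' [xx' x'x]] := hx; have [y' [yy' y'y]] := hy; exists (mx2 x' 0 0 y').
by rewrite !mx2M !mul0r !mulr0 !addr0 !add0r xx' x'x yy' y'y mx2_1.
Qed.

Lemma distant_sym p q : distant p q -> distant q p.
Proof.
have [a [b hp]] := prep_ex p; have [c [d hq]] := prep_ex q.
move/(distantP hp hq) => h; apply/(distantP hq hp).
have -> : mx2 c d a b = mx2 0 1 1 0 *m mx2 a b c d.
  by rewrite mx2M !mul0r !mul1r !addr0 !add0r.
apply/invertible_mul_iff => //; exists (mx2 0 1 1 0).
by rewrite !mx2M !mul0r !mulr0 !mul1r !addr0 !add0r mx2_1.
Qed.

Lemma prep_projectivity (g : GL2 R) a b p : prep a b p ->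
  prep (a * g 0 0 + b * g 1 0) (a * g 0 1 + b * g 1 1) (projectivity g p).
Proof.
move=> [[c [d h]] e]; split.
  exists (c * g 0 0 + d * g 1 0), (c * g 0 1 + d * g 1 1).
  by rewrite -mx2M -mx2_eta; apply: invertible_mxM => //; apply: GL2P.
rewrite /= e -row2_mul; apply/seteqP; split=> [_ [_ [x _ <-] <-]|_ [x _ <-]].
  by exists x => //; rewrite scalemxAl.
by exists (x *: row2 a b); [exists x | rewrite scalemxAl].
Qed.

Lemma distant_projectivity (g : GL2 R) p q :
  distant (projectivity g p) (projectivity g q) <-> distant p q.
Proof.
have [a [b hp]] := prep_ex p; have [c [d hq]] := prep_ex q.
have h := distantP (prep_projectivity g hp) (prep_projectivity g hq).
apply: (iff_trans h); apply: iff_sym; apply: (iff_trans (distantP hp hq)).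
apply: iff_sym; rewrite -mx2M -mx2_eta.
by apply: invertible_mulr_iff; apply: GL2P.
Qed.

Lemma projectivityM (g h k : GL2 R) p : k = g *m h :> 'M_2 ->
  projectivity h (projectivity g p) = projectivity k p.
Proof.
move=> e; apply: point_eq => /=; apply/seteqP; split.
  by move=> _ [_ [v hv <-] <-]; exists v => //; rewrite e mulmxA.
by move=> _ [v hv <-]; exists (v *m g); [exists v | rewrite e mulmxA].
Qed.

Lemma projectivity1 (g : GL2 R) p : g = 1%:M :> 'M_2 -> projectivity g p = p.
Proof.
move=> e; apply: point_eq; apply/seteqP; split=> v /=.
  by move=> [w hw <-]; rewrite e mulmx1.
by move=> hv; exists v => //; rewrite e mulmx1.
Qed.

Lemma GL2_inv (g : GL2 R) : exists h : GL2 R,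
  cancel (projectivity g) (projectivity h) /\
  cancel (projectivity h) (projectivity g).
Proof.
have [B [e1 e2]] := GL2P g.
have hB : invertible_mx B by exists g.
have h1 : invertible_mx (1%:M : 'M[R]_2) by exists 1%:M; rewrite mulmx1.
exists (MkGL2 hB); split=> p.
  by rewrite (projectivityM (k := MkGL2 h1)) ?projectivity1.
by rewrite (projectivityM (k := MkGL2 h1)) ?projectivity1.
Qed.

Lemma projectivity_bij (g : GL2 R) : bijective (projectivity g).
Proof. by have [h [h1 h2]] := GL2_inv g; exists (projectivity h). Qed.

Lemma projectivity_iso (g : GL2 R) : distant_iso (projectivity g).
Proof.
split; first exact: projectivity_bij.
by move=> p q; apply: iff_sym; apply: distant_projectivity.
Qed.

Lemma inf_subproof : invertible_mx (mx2 1 0 0 1 : 'M[R]_2).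
Proof. by exists 1%:M; rewrite mx2_1 mulmx1. Qed.

Lemma aff_subproof x : invertible_mx (mx2 x 1 1 0).
Proof.
exists (mx2 0 1 1 (- x)); rewrite !mx2M !mul0r !mulr0 !mul1r !mulr1 !addr0 !add0r.
by rewrite subrr mx2_1.
Qed.

Lemma aff_ex x :
  exists A : GL2 R, cyclic_submod (row2 x 1) = cyclic_submod (row 0 A).
Proof. by exists (MkGL2 (aff_subproof x)); rewrite row0_mx2. Qed.

Lemma inf_ex : exists A : GL2 R, cyclic_submod (row2 1 0) = cyclic_submod (row 0 A).
Proof. by exists (MkGL2 inf_subproof); rewrite row0_mx2. Qed.

Definition inf : projline R := MkPoint inf_ex.
Definition aff x : projline R := MkPoint (aff_ex x).

Lemma prep_inf : prep 1 0 inf.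
Proof. by split=> //; exists 0, 1; apply: inf_subproof. Qed.

Lemma prep_aff x : prep x 1 (aff x).
Proof. by split=> //; exists 1, 0; apply: aff_subproof. Qed.

Lemma prep_jordan a b : prep (a * b - 1) a (jordan_point a b).
Proof. by split=> //; exists b, 1; apply: jordan_mx_inv. Qed.

(** Subtracting [b] times the second row from the first leaves a triangular matrix with diagonal
    [a - b * x], 1. *)
Lemma distant_aff a b x p :
  prep a b p -> (distant p (aff x) <-> isunit (a - b * x)).
Proof.
move=> hp; apply: (iff_trans (distantP hp (prep_aff x))).
have -> : mx2 a b x 1 = mx2 1 b 0 1 *m mx2 (a - b * x) 0 x 1.
  by rewrite mx2M !mul0r !mul1r !add0r mulr1 subrK.
apply: (iff_trans (invertible_mul_iff _ _)).
  exists (mx2 1 (- b) 0 1); rewrite !mx2M !mul0r !mul1r !mulr0 !mulr1.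
  by rewrite !addr0 !add0r addrN addNr mx2_1.
split=> [/mx2_invP[p' [q [r [t]]]]|[y [e1 e2]]].
  rewrite !mul0r !mul1r !mulr1 !addr0 !mulr0 !add0r => -[[e1 _ _ _] [e5 e6 _ _]].
  by exists p'; split=> //; rewrite -e5 e6 mul0r addr0.
apply/mx2_invP; exists y, 0, (- (x * y)), 1.
by rewrite !mul0r !mul1r !mulr0 !addr0 !add0r addrN mulNr -mulrA e1 e2 mulr1 addNr.
Qed.

Lemma distant_aff_aff x y : distant (aff x) (aff y) <-> isunit (x - y).
Proof. by rewrite -{2}[y]mul1r; apply: distant_aff; apply: prep_aff. Qed.

Lemma distant_inf_aff x : distant inf (aff x).
Proof. by apply/(distant_aff _ prep_inf); rewrite mul0r subr0; apply: isunit1. Qed.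

Lemma distant_infP p : distant inf p <-> exists x, p = aff x.
Proof.
split=> [|[x ->]]; last exact: distant_inf_aff.
have [c [d hp]] := prep_ex p.
move/(distantP prep_inf hp)/mx2_invP => [p' [q [r [t]]]].
rewrite !mul0r !mul1r !mulr1 !addr0 !mulr0 !add0r.
move=> [[_ -> _ e1] [_ _ _ e2]]; rewrite mulr0 add0r in e1.
exists (t * c); have h : isunit t by exists d.
by apply: (@prep_eq (t * c) 1); [rewrite -e2; apply: prep_scale | apply: prep_aff].
Qed.

Lemma aff_inj : injective aff.
Proof.
move=> x y e; have h : prep y 1 (aff x) by rewrite e; apply: prep_aff.
by have [z [_ -> ]] := prep_uniq (prep_aff x) h; rewrite mulr1 => <-; rewrite mul1r.
Qed.

Lemma projline_homogeneous p : exists g : GL2 R, projectivity g inf = p.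
Proof.
have [a [b [[c [d h]] e]]] := prep_ex p.
exists (MkGL2 h); apply: (@prep_eq a b); last by split=> //; exists c, d.
have := prep_projectivity (MkGL2 h) prep_inf.
by rewrite /= !mxE /= !mul1r !mul0r !addr0.
Qed.

Lemma projline_homogeneous2 p q : distant p q ->
  exists g : GL2 R, projectivity g inf = p /\ projectivity g (aff 0) = q.
Proof.
have [a [b hp]] := prep_ex p; have [c [d hq]] := prep_ex q.
move/(distantP hp hq) => h; exists (MkGL2 h).
have := prep_projectivity (MkGL2 h) prep_inf.
have := prep_projectivity (MkGL2 h) (prep_aff 0).
rewrite /= !mxE /= !mul1r !mul0r !addr0 !add0r => h1 h2.
by split; [apply: prep_eq h2 hp | apply: prep_eq h1 hq].
Qed.
End Line.

(** * Unit-regularity and matrices over a division ring *)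

Definition unit_regular (R : pzRingType) :=
  forall x : R, exists w, isunit w /\ x * w * x = x.

Definition dedekind_finite (R : pzRingType) :=
  forall x y : R, x * y = 1 -> isunit x.

(* Unit-regular rings have stable range 1: replace [d] by the idempotent
   [e = d w]; then [(1 - e) c] and [1 - e] generate the same right ideal, so
   the idempotents attached to them differ by a square-zero element. *)
Lemma stable_range (R : pzRingType) (c d p q : R) : unit_regular R ->
  c * p + d * q = 1 -> exists x, isunit (c - d * x).
Proof.
move=> ureg e1; have [w [_ dw]] := ureg d.
set e := d * w; set f := 1 - e.
have ed : e * d = d by [].
have ee : e * e = e by rewrite /e mulrA dw.
have fd : f * d = 0 by rewrite mulrBl mul1r ed subrr.
have ff : f * f = f by rewrite mulrBr mulr1 mulrBl mul1r ee subrr subr0.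
have [v [[v' [vv' v'v]] yv]] := ureg (f * c).
set y := f * c in yv; set g := y * v.
have yp : y * p = f.
  by rewrite -mulrA -[f in RHS]mulr1 -e1 mulrDr (mulrA f d) fd mul0r addr0.
have fy : f * y = y by rewrite /y mulrA ff.
have fg : f * g = g by rewrite /g mulrA fy.
have gf : g * f = f by rewrite -yp mulrA yv.
have gg : g * g = g by rewrite /g mulrA yv.
have nn : (g - f) * (g - f) = 0.
  by rewrite mulrBr (mulrBl g) (mulrBl f) gg fg gf ff !subrr.
exists (w * (c - v')).
have -> : c - d * (w * (c - v')) = (1 + (g - f)) * v'.
  have -> : 1 + (g - f) = g + e by rewrite /f opprB addrCA [1 + _]addrC subrK.
  rewrite mulrA -/e mulrBr opprB mulrDl /g -mulrA vv' mulr1.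
  by rewrite /y /f mulrBl mul1r addrCA addrC.
apply: isunitM; last by exists v.
exists (1 - (g - f)); set n := g - f in nn *.
clearbody n; split.
  by rewrite mulrBr mulr1 mulrDl mul1r nn addr0 addrK.
by rewrite mulrDr mulr1 mulrBl mul1r nn subr0 subrK.
Qed.

Lemma common_affine (R : pzRingType) (a b : R) p : unit_regular R ->
  prep a b p -> exists x, isunit (a - b * x).
Proof. by move=> ureg /prep_unimod[s [t]]; apply: stable_range. Qed.

(** Unimodularity of (ta, tb) makes [t] right invertible, hence a unit. Inclusion of points thus
    forces equality. *)
Lemma prep_sub (R : pzRingType) (a b t : R) p q : dedekind_finite R ->
  prep a b p -> prep (t * a) (t * b) q -> p = q.
Proof.
move=> fin hp hq; have [s [s' e]] := prep_unimod hq.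
rewrite -!mulrA -mulrDr in e.
by apply: prep_eq hq; apply: prep_scale => //; apply: fin e.
Qed.

Section LinearAlgebra.
Variables (D : unitRingType) (fieldD : GRing.field_axiom D).

Lemma scalar1_inv (t : 'M[D]_1) : t != 0 ->
  exists s, t *m s = 1%:M /\ s *m t = 1%:M.
Proof.
rewrite (mx11_scalar t); move: (t 0 0) => a a0; exists a^-1%:M.
have h : a \is a GRing.unit.
  by apply: fieldD; apply: contraNneq a0 => ->; rewrite raddf0.
by rewrite -!scalar_mxM divrr ?mulVr.
Qed.

Lemma row_inv n (v : 'rV[D]_n) : v != 0 -> exists k : 'cV_n, v *m k = 1%:M.
Proof.
move=> v0; have [j vj] : exists j, v 0 j != 0.
  apply/existsP; apply: contraNT v0; rewrite negb_exists => /forallP h.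
  by apply/eqP/rowP=> j; rewrite mxE; apply/eqP; rewrite -[_ == _]negbK.
exists (delta_mx j 0 *m (v 0 j)^-1%:M); rewrite mulmxA -colE.
apply/matrixP=> a b; rewrite !ord1 mxE big_ord1 !mxE /= mulr1n divrr //.
exact: fieldD.
Qed.

Lemma col_inv n (u : 'cV[D]_n) : u != 0 -> exists k : 'rV_n, k *m u = 1%:M.
Proof.
move=> u0; have [j uj] : exists j, u j 0 != 0.
  apply/existsP; apply: contraNT u0; rewrite negb_exists => /forallP h.
  by apply/eqP/colP=> j; rewrite mxE; apply/eqP; rewrite -[_ == _]negbK.
exists ((u j 0)^-1%:M *m delta_mx 0 j); rewrite -mulmxA -rowE.
apply/matrixP=> a b; rewrite !ord1 mxE big_ord1 !mxE /= mulr1n mulVr //.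
exact: fieldD.
Qed.

(** Choose [k2] with v2 k2 = 1. By independence v1 - (v1 k2) v2 is nonzero, so some [k1] takes the
    value 1 on it; subtracting a multiple of [k2] from [k1] makes it kill [v2]. *)
Lemma row_indep n (v1 v2 : 'rV[D]_n) : v2 != 0 ->
  (forall t : 'M_1, v1 != t *m v2) ->
  exists k : 'cV_n, v2 *m k = 0 /\ v1 *m k = 1%:M.
Proof.
move=> v20 ind; have [k2 e2] := row_inv v20.
have [k1 e1] : exists k1 : 'cV_n, (v1 - v1 *m k2 *m v2) *m k1 = 1%:M.
  by apply: row_inv; rewrite subr_eq0.
exists (k1 - k2 *m (v2 *m k1)); split.
  by rewrite mulmxBr (mulmxA v2 k2) e2 mul1mx subrr.
by rewrite mulmxBr -e1 mulmxBl !mulmxA.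
Qed.

Lemma col_indep n (u1 u2 : 'cV[D]_n) : u2 != 0 ->
  (forall t : 'M_1, u1 != u2 *m t) ->
  exists k : 'rV_n, k *m u2 = 0 /\ k *m u1 = 1%:M.
Proof.
move=> u20 ind; have [k2 e2] := col_inv u20.
have [k1 e1] : exists k1 : 'rV_n, k1 *m (u1 - u2 *m (k2 *m u1)) = 1%:M.
  by apply: col_inv; rewrite subr_eq0.
exists (k1 - (k1 *m u2) *m k2); split.
  by rewrite mulmxBl -(mulmxA _ k2) e2 mulmx1 subrr.
by rewrite mulmxBl -e1 mulmxBr !mulmxA.
Qed.

Lemma row_interpolation n (v1 v2 w1 w2 : 'rV[D]_n) : v2 != 0 ->
  (forall t : 'M_1, v1 != t *m v2) ->
  exists x : 'M_n, v1 *m x = w1 /\ v2 *m x = w2.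
Proof.
move=> v20 ind; have [k1 [e1 e2]] := row_indep v20 ind.
have [k2 e3] := row_inv v20.
(* [k1] kills [v2], but [k2] need not kill [v1]; the first summand compensates for this. *)
exists (k1 *m (w1 - v1 *m k2 *m w2) + k2 *m w2).
rewrite (mulmxDr v1) (mulmxDr v2) !mulmxA.
by rewrite e1 e2 e3 mul0mx add0r !mul1mx subrK.
Qed.

Lemma isunit_mxI n (x y : 'M[D]_n) :
  x *m y = 1%:M -> y *m x = 1%:M -> isunit x.
Proof. by exists y. Qed.

Lemma isunit_mxP n (x : 'M[D]_n) :
  isunit x -> exists y, x *m y = 1%:M /\ y *m x = 1%:M.
Proof. by []. Qed.

(** Gaussian elimination by induction on the size: two transpositions bring a nonzero entry to the
    corner, and the induction hypothesis is applied to its Schur complement. *)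
Lemma matrix_pid n (x : 'M[D]_n) : exists (g h : 'M[D]_n) r,
  [/\ isunit g, isunit h & x = g *m pid_mx r *m h].
Proof.
elim: n x => [|n IH] x.
  by exists 1, 1, 0%N; split; [apply: isunit1|apply: isunit1|apply/matrixP=> -[]].
have [->|x0] := eqVneq x 0.
  exists 1, 1, 0%N; split; [exact: isunit1|exact: isunit1|].
  by rewrite pid_mx_0 mulmx0 mul0mx.
have [i [j xij]] : exists i j, x i j != 0.
  apply: contrapT => h; case/negP: x0; apply/eqP/matrixP=> i j.
  by rewrite mxE; apply/eqP/negPn/negP=> xij; case: h; exists i, j.
pose P : 'M[D]_(1 + n) := tperm_mx i 0; pose Q : 'M[D]_(1 + n) := tperm_mx j 0.
have PP : P *m P = 1%:M by rewrite /P /tperm_mx -perm_mxM tperm2 perm_mx1.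
have QQ : Q *m Q = 1%:M by rewrite /Q /tperm_mx -perm_mxM tperm2 perm_mx1.
have [y [ey y00]] : exists y : 'M[D]_(1 + n), x = P *m y *m Q /\ y 0 0 = x i j.
  exists (P *m x *m Q); split.
    by rewrite !mulmxA PP mul1mx -mulmxA QQ mulmx1.
  by rewrite /P /Q -xrowE -[X in X = _]/((_ *m _) _ _) -xcolE !mxE !tpermR.
have y0 : ulsubmx y != 0.
  apply: contraNneq xij => /matrixP/(_ 0 0); rewrite !mxE => e.
  by rewrite -y00 -[X in _ == X]e; apply/eqP; congr (y _ _); apply: val_inj.
have [s [ts st]] := scalar1_inv y0.
have [g [h [r [/isunit_mxP[g' [gg' g'g]] /isunit_mxP[h' [hh' h'h]] e]]]] :=
  IH (drsubmx y - dlsubmx y *m s *m ursubmx y).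
have uG : @isunit 'M[D]_(1 + n) (block_mx (ulsubmx y) 0 (dlsubmx y) g).
  apply: (@isunit_mxI _ _ (block_mx s 0 (- (g' *m dlsubmx y *m s)) g'));
    rewrite mulmx_block !mulmx0 !mul0mx !addr0 !add0r ?ts ?st.
  - by rewrite gg' mulmxN !mulmxA gg' mul1mx addrN -scalar_mx_block.
  - by rewrite g'g mulNmx -!mulmxA st mulmx1 addNr -scalar_mx_block.
have uH : @isunit 'M[D]_(1 + n) (block_mx 1%:M (s *m ursubmx y) 0 h).
  apply: (@isunit_mxI _ _ (block_mx 1%:M (- (s *m ursubmx y *m h')) 0 h'));
    rewrite mulmx_block !mulmx0 !mul0mx !mul1mx ?mulmx1 !addr0 ?add0r.
  - by rewrite hh' addNr -scalar_mx_block.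
  - by rewrite h'h mulNmx -!mulmxA h'h !mulmx1 addrN -scalar_mx_block.
exists (P *m block_mx (ulsubmx y) 0 (dlsubmx y) g).
exists (block_mx 1%:M (s *m ursubmx y) 0 h *m Q), r.+1; split.
- by apply: isunitM uG; exists P.
- by apply: (isunitM uH); exists Q.
rewrite {1}ey -!mulmxA; congr (_ *m _); rewrite !mulmxA; congr (_ *m _).
have -> : pid_mx r.+1 = block_mx 1%:M 0 0 (pid_mx r) :> 'M[D]_(1 + n).
  apply/matrixP=> a b; rewrite !mxE.
  case: splitP => a' ->; rewrite ?ord1 !mxE; case: splitP => b' ->;
    by rewrite ?ord1 !mxE.
rewrite -[RHS]/(@mulmx D (1 + n) (1 + n) (1 + n)
  (@mulmx D (1 + n) (1 + n) (1 + n) _ _) _).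
rewrite !mulmx_block !mulmx0 !mul0mx !mulmx1 !addr0 !add0r !mulmxA ts mul1mx.
by rewrite -e addrCA subrr addr0 mul0mx addr0 submxK.
Qed.

(** If x = g e h with [g], [h] invertible and [e] idempotent, then w = h^-1 g^-1 satisfies x w x =
    x. *)
Lemma matrix_unit_regular n : unit_regular 'M[D]_n.
Proof.
move=> x; have [g [h [r [ug uh ->]]]] := matrix_pid x.
have [g' [gg' g'g]] := isunit_mxP ug; have [h' [hh' h'h]] := isunit_mxP uh.
exists (h' *m g'); split; first by apply: isunitM; [exists h | exists g].
change (g *m pid_mx r *m h *m (h' *m g') *m (g *m pid_mx r *m h) =
  g *m pid_mx r *m h).
rewrite !mulmxA -(mulmxA _ h) hh' mulmx1 -(mulmxA _ g') g'g mulmx1 -(mulmxA g).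
by rewrite mul_pid_mx minnn pid_mx_minv.
Qed.

Lemma left_kernel n (x : 'M[D]_n) :
  ~ isunit x -> exists v : 'rV_n, v != 0 /\ v *m x = 0.
Proof.
have [g [h [r [/isunit_mxP[g' [gg' g'g]] uh ->]]]] := matrix_pid x => nu.
have [ltrn|lenr] := ltnP r n; last first.
  case: nu; apply: isunitM => //; rewrite -pid_mx_minv (minn_idPl lenr) pid_mx_1.
  by rewrite mulmx1; exists g'.
exists (delta_mx 0 (Ordinal ltrn) *m g'); split.
  apply/eqP => /(congr1 (mulmx^~ g)); rewrite mul0mx -mulmxA g'g mulmx1.
  by move/rowP/(_ (Ordinal ltrn)); rewrite !mxE !eqxx => /eqP; rewrite oner_eq0.
rewrite !mulmxA -(mulmxA _ g') g'g mulmx1 -rowE.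
have -> : row (Ordinal ltrn) (pid_mx r : 'M[D]_n) = 0.
  by apply/rowP=> j; rewrite !mxE /= ltnn andbF.
by rewrite mul0mx.
Qed.

Lemma left_kernel_nonunit n (x : 'M[D]_n) (v : 'rV_n) :
  v *m x = 0 -> isunit x -> v = 0.
Proof.
move=> e [y [xy _]].
by rewrite -[v]mulmx1 -[1%:M]xy -[x * y]/(x *m y) mulmxA e mul0mx.
Qed.

Lemma matrix_dedekind_finite n : dedekind_finite 'M[D]_n.
Proof.
move=> x y e; apply: contrapT => /left_kernel[v [/eqP v0 vx]]; apply: v0.
by rewrite -[v]mulmx1 -[1%:M]e -[x * y]/(x *m y) mulmxA vx mul0mx.
Qed.
End LinearAlgebra.

(** * The projective line over a matrix ring *)

(* For adjacent [p] and [q] these points [r] form the pencil through [p] and [q];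
   otherwise there are none besides [p] and [q]. *)
Definition lset (R : pzRingType) (p q r : projline R) :=
  forall z, distant z r -> distant z p \/ distant z q.

Lemma lset_sym (R : pzRingType) (p q r : projline R) : lset p q r -> lset q p r.
Proof. by move=> h z /h[]; [right|left]. Qed.

Lemma lset_projectivity (R : pzRingType) (g : GL2 R) (p q r : projline R) :
  lset p q r -> lset (projectivity g p) (projectivity g q) (projectivity g r).
Proof.
move=> h z; have [k [gk kg]] := GL2_inv g.
rewrite -[z]kg => /distant_projectivity/h[]; [left|right];
  exact/distant_projectivity.
Qed.

Section MatrixLine.
Variables (D : unitRingType) (fieldD : GRing.field_axiom D) (n : nat).
Local Notation M := 'M[D]_n.
Implicit Types (p q r : projline M) (x : M).

(* A point of P(M_n(D)) is seen as an n-dimensional space of row vectors in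
   D^n x D^n; scalars of D are 1 x 1 matrices throughout. *)
Definition inpt p (y1 y2 : 'rV[D]_n) :=
  exists a b, prep a b p /\ exists w, y1 = w *m a /\ y2 = w *m b.

Lemma inptP (a b : M) p y1 y2 : prep a b p ->
  (inpt p y1 y2 <-> exists w, y1 = w *m a /\ y2 = w *m b).
Proof.
move=> h; split=> [[a' [b' [h' [w [-> ->]]]]]|[w [-> ->]]]; last first.
  by exists a, b; split=> //; exists w.
have [s [_ -> ->]] := prep_uniq h h'.
by exists (w *m s); rewrite -!mulmxA.
Qed.

Lemma inptD p y1 y2 z1 z2 :
  inpt p y1 y2 -> inpt p z1 z2 -> inpt p (y1 + z1) (y2 + z2).
Proof.
have [a [b h]] := prep_ex p.
move=> /(inptP _ _ h)[w [-> ->]] /(inptP _ _ h)[w' [-> ->]].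
by apply/(inptP _ _ h); exists (w + w'); rewrite !mulmxDl.
Qed.

Lemma inptZ p (t : 'M_1) y1 y2 : inpt p y1 y2 -> inpt p (t *m y1) (t *m y2).
Proof.
have [a [b h]] := prep_ex p.
move=> /(inptP _ _ h)[w [-> ->]].
by apply/(inptP _ _ h); exists (t *m w); rewrite !mulmxA.
Qed.

Lemma inptN p y1 y2 : inpt p y1 y2 -> inpt p (- y1) (- y2).
Proof. by move/(inptZ (- 1%:M)); rewrite !mulNmx !mul1mx. Qed.

Lemma inptB p y1 y2 z1 z2 :
  inpt p y1 y2 -> inpt p z1 z2 -> inpt p (y1 - z1) (y2 - z2).
Proof. by move=> h /inptN; apply: inptD. Qed.

Lemma inpt_aff x y1 y2 : inpt (aff x) y1 y2 <-> y1 = y2 *m x.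
Proof.
apply: (iff_trans (inptP _ _ (prep_aff x))); split=> [[w [-> ->]]|->].
  by rewrite mulmx1.
by exists y2; rewrite mulmx1.
Qed.

Lemma inpt_inf y1 y2 : inpt (inf M) y1 y2 <-> y2 = 0.
Proof.
apply: (iff_trans (inptP _ _ (prep_inf M))); split=> [[w [_ ->]]|->].
  by rewrite mulmx0.
by exists y1; rewrite mulmx1 mulmx0.
Qed.

Lemma row_mxP (a b : M) : (forall w : 'rV_n, w *m a = w *m b) -> a = b.
Proof. by move=> h; apply/row_matrixP=> i; rewrite !rowE. Qed.

Lemma row_neq0 (a : M) : a != 0 -> exists w : 'rV_n, w *m a != 0.
Proof.
move=> a0; apply: contrapT => h; case/negP: a0; apply/eqP/row_mxP=> w.
by rewrite mulmx0; apply/eqP/negPn/negP=> h'; case: h; exists w.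
Qed.

(** Expressing the rows of (a, b) through (c, d) gives a coefficient matrix [t] with a = tc, b = td;
    [prep_sub] then applies. *)
Lemma inpt_sub p q : (forall y1 y2, inpt p y1 y2 -> inpt q y1 y2) -> p = q.
Proof.
move=> sub; have [a [b hp]] := prep_ex p; have [c [d hq]] := prep_ex q.
have h i : exists w : 'rV_n, row i a = w *m c /\ row i b = w *m d.
  by apply/(inptP _ _ hq)/sub/(inptP _ _ hp); exists (delta_mx 0 i); rewrite -!rowE.
have [w hw] := choice h.
have ea : a = (\matrix_i w i : M) * c.
  by apply/row_matrixP=> i; rewrite row_mul rowK; case: (hw i).
have eb : b = (\matrix_i w i : M) * d.
  by apply/row_matrixP=> i; rewrite row_mul rowK; case: (hw i).
apply: esym; apply: (prep_sub (t := \matrix_i w i) _ hq).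
  exact: matrix_dedekind_finite.
by move: hp; rewrite {1}ea {1}eb.
Qed.

Lemma distant_meet0 p q y1 y2 : distant p q -> inpt p y1 y2 -> inpt q y1 y2 ->
  y1 = 0 /\ y2 = 0.
Proof.
have [a [b hp]] := prep_ex p; have [c [d hq]] := prep_ex q.
move/(distantP hp hq)/mx2_invP => [s [_ [t [_ [[e1 _ e2 _] _]]]]].
move=> /(inptP _ _ hp)[w [-> ->]] /(inptP _ _ hq)[w' [e3 e4]].
suff -> : w = 0 by rewrite !mul0mx.
rewrite -[w]mulmx1 -[1%:M]e1 mulmxDr.
have -> : w *m (a * s) = w' *m (c * s) by rewrite !mulmxA e3.
have -> : w *m (b * t) = w' *m (d * t) by rewrite !mulmxA e4.
by rewrite -mulmxDr e2 mulmx0.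
Qed.

(** A row [w] killed by a - bx gives the common vector (wa, wb), which is nonzero because (a, b) is
    unimodular. *)
Lemma meet_aff p x : ~ distant p (aff x) ->
  exists y : 'rV[D]_n, y != 0 /\ inpt p (y *m x) y.
Proof.
have [a [b hp]] := prep_ex p => h.
have /(left_kernel fieldD)[w [w0 e]] : ~ isunit (a - b * x).
  by move/(distant_aff _ hp).
have ea : w *m a = w *m b *m x.
  by apply/eqP; rewrite -subr_eq0 -mulmxA -mulmxBr; apply/eqP.
exists (w *m b); split; last by apply/(inptP _ _ hp); exists w; rewrite -ea.
apply: contraNneq w0 => eb; rewrite eb mul0mx in ea.
have [s [t e1]] := prep_unimod hp.
rewrite -[w]mulmx1 -[1%:M]e1 mulmxDr.
have -> : w *m (a * s) = 0 by rewrite mulmxA ea mul0mx.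
have -> : w *m (b * t) = 0 by rewrite mulmxA eb mul0mx.
by rewrite addr0.
Qed.

Lemma inpt_projectivity (g : GL2 M) p y1 y2 : inpt p y1 y2 ->
  inpt (projectivity g p) (y1 *m g 0 0 + y2 *m g 1 0) (y1 *m g 0 1 + y2 *m g 1 1).
Proof.
have [a [b hp]] := prep_ex p; move=> /(inptP _ _ hp)[w [-> ->]].
by apply/(inptP _ _ (prep_projectivity g hp)); exists w; rewrite !mulmxDr !mulmxA.
Qed.

Lemma projectivity_coords (g : GL2 M) (y1 y2 : 'rV[D]_n) : exists v1 v2,
  y1 = v1 *m g 0 0 + v2 *m g 1 0 /\ y2 = v1 *m g 0 1 + v2 *m g 1 1.
Proof.
have [B [gB Bg]] := GL2P g.
rewrite (mx2_eta g) (mx2_eta B) mx2M -mx2_1 in Bg.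
have {Bg}[e1 e2 e3 e4] := mx2_inj Bg.
exists (y1 *m B 0 0 + y2 *m B 1 0), (y1 *m B 0 1 + y2 *m B 1 1).
rewrite !mulmxDl -!mulmxA; split; rewrite addrACA -!mulmxDr.
  by rewrite [X in y1 *m X]e1 [X in y2 *m X]e3 mulmx1 mulmx0 addr0.
by rewrite [X in y1 *m X]e2 [X in y2 *m X]e4 mulmx1 mulmx0 add0r.
Qed.

(* In coordinates where [r] is the point at infinity, the sought point is the
   graph of a matrix with prescribed values. *)
Lemma distant_through2 r (y1 y2 z1 z2 : 'rV[D]_n) : ~ inpt r z1 z2 ->
  (forall t, ~ inpt r (y1 - t *m z1) (y2 - t *m z2)) ->
  exists z, [/\ distant z r, inpt z y1 y2 & inpt z z1 z2].
Proof.
have [g er] := projline_homogeneous r; subst r.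
have [v1 [v2 [-> ->]]] := projectivity_coords g y1 y2.
have [w1 [w2 [-> ->]]] := projectivity_coords g z1 z2.
move=> nz ny.
have w20 : w2 != 0.
  by apply/eqP=> w0; apply: nz; apply: inpt_projectivity; apply/inpt_inf.
have ind t : v2 != t *m w2.
  apply/eqP=> e; apply: (ny t).
  rewrite !mulmxDr !mulmxA opprD addrACA -!mulmxBl opprD addrACA -!mulmxBl.
  by apply: inpt_projectivity; apply/inpt_inf; rewrite e subrr.
have [x [ex ey]] := row_interpolation fieldD v1 w1 w20 ind.
exists (projectivity g (aff x)); split.
- by apply/distant_projectivity/distant_sym/distant_inf_aff.
- by apply: inpt_projectivity; apply/inpt_aff.
- by apply: inpt_projectivity; apply/inpt_aff.
Qed.

Lemma distant_through r (y1 y2 : 'rV[D]_n) : ~ inpt r y1 y2 ->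
  exists z, distant z r /\ inpt z y1 y2.
Proof.
have [g er] := projline_homogeneous r; subst r.
have [v1 [v2 [-> ->]]] := projectivity_coords g y1 y2.
move=> ny; have v20 : v2 != 0.
  by apply/eqP=> w0; apply: ny; apply: inpt_projectivity; apply/inpt_inf.
have [k hk] := row_inv fieldD v20.
exists (projectivity g (aff (k *m v1))); split.
  by apply/distant_projectivity/distant_sym/distant_inf_aff.
by apply: inpt_projectivity; apply/inpt_aff; rewrite mulmxA hk mul1mx.
Qed.

(** If no such [t] existed, a point distant from [r] would pass through both vectors and so, apart
    from trivial cases with a zero vector, meet both [p] and [q]. *)
Lemma lset_dep p q r (y1 y2 z1 z2 : 'rV[D]_n) : lset p q r ->
  inpt p y1 y2 -> inpt q z1 z2 -> ~ inpt r z1 z2 ->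
  exists t : 'M_1, inpt r (y1 - t *m z1) (y2 - t *m z2).
Proof.
move=> hr hp hq nz; apply: contrapT => h.
have [|z [zr zy zz]] := @distant_through2 r y1 y2 z1 z2 nz.
  by move=> t ht; apply: h; exists t.
have inpt0 p' : inpt p' (0 : 'rV[D]_n) 0.
  have [a [b h']] := prep_ex p'; apply/(inptP _ _ h').
  by exists 0; rewrite !mul0mx.
have [zp|zq] := hr _ zr.
  have [e1 e2] := distant_meet0 zp zy hp.
  by apply: h; exists 0; rewrite !mul0mx !subr0 e1 e2.
have [e1 e2] := distant_meet0 zq zz hq.
by apply: nz; rewrite e1 e2.
Qed.

Lemma lset_meet p q r (y1 y2 : 'rV[D]_n) : lset p q r ->
  inpt p y1 y2 -> inpt q y1 y2 -> inpt r y1 y2.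
Proof.
move=> hr hp hq; apply: contrapT => h.
have [z [zr zy]] := distant_through h.
have e : y1 = 0 /\ y2 = 0.
  have [zp|zq] := hr _ zr; first exact: distant_meet0 zp zy hp.
  exact: distant_meet0 zq zy hq.
apply: h; case: e => -> ->; have [a [b h']] := prep_ex r; apply/(inptP _ _ h').
by exists 0; rewrite !mul0mx.
Qed.

Lemma prep_neq_inf (a b : M) p : prep a b p -> p <> inf M -> b != 0.
Proof.
move=> hp np; apply/eqP=> b0; apply: np; apply: esym.
apply: (prep_sub (t := a) _ (prep_inf _)); first exact: matrix_dedekind_finite.
by rewrite mulr1 mulr0 -b0.
Qed.

(** By [lset_dep] at infinity, the row space of [d] consists of multiples of one row v = w' d'. By
    symmetry that of [d'] consists of multiples of some w d, hence of the same [v]. *)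
Lemma lset_inf_rank1 p q (c d c' d' : M) : lset p q (inf M) ->
  prep c d p -> prep c' d' q -> p <> inf M -> q <> inf M ->
  exists (u u' : 'cV_n) (v : 'rV_n), d = u *m v /\ d' = u' *m v.
Proof.
move=> h hp hq /(prep_neq_inf hp) d0 /(prep_neq_inf hq) d'0.
have [w' w'd'] := row_neq0 d'0; have [w wd] := row_neq0 d0.
set v := w' *m d'.
have dep (y : 'rV_n) : exists t : 'M_1, y *m d = t *m v.
  have hy : inpt p (y *m c) (y *m d) by apply/(inptP _ _ hp); exists y.
  have hy' : inpt q (w' *m c') v by apply/(inptP _ _ hq); exists w'.
  have [|t] := lset_dep h hy hy'.
    by move/inpt_inf=> e; case/negP: w'd'; apply/eqP.
  by move/inpt_inf/eqP; rewrite subr_eq0 => /eqP e; exists t.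
have dep' (y : 'rV_n) : exists t : 'M_1, y *m d' = t *m v.
  have hy : inpt q (y *m c') (y *m d') by apply/(inptP _ _ hq); exists y.
  have hy' : inpt p (w *m c) (w *m d) by apply/(inptP _ _ hp); exists w.
  have [|t] := lset_dep (lset_sym h) hy hy'.
    by move/inpt_inf=> e; case/negP: wd; apply/eqP.
  move/inpt_inf/eqP; rewrite subr_eq0 => /eqP e.
  by have [s es] := dep w; exists (t *m s); rewrite e es mulmxA.
have v0 : v != 0 := w'd'; clearbody v.
have [k vk] := row_inv fieldD v0.
exists (d *m k), (d' *m k), v; split; apply: row_mxP => y.
  by have [t e] := dep y; rewrite !mulmxA e -(mulmxA t) vk mulmx1.
by have [t e] := dep' y; rewrite !mulmxA e -(mulmxA t) vk mulmx1.
Qed.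

(** With [r] moved to infinity, [lset_inf_rank1] makes the second coordinates [d] and [d'] factor
    through a common row [v]; expressing x' - x by the new coordinates shows that it factors through
    [v] as well. *)
Lemma lset_rank1 x x' r : lset (aff x) (aff x') r -> r <> aff x -> r <> aff x' ->
  exists (u : 'cV_n) (v : 'rV_n), x' - x = u *m v.
Proof.
have [g er] := projline_homogeneous r; subst r.
have [k [gk kg]] := GL2_inv g.
move=> /(lset_projectivity (g := k)); rewrite gk => h n1 n2.
have {}n1 : projectivity k (aff x) <> inf _ by move=> e; apply: n1; rewrite -e kg.
have {}n2 : projectivity k (aff x') <> inf _ by move=> e; apply: n2; rewrite -e kg.
have h1 := prep_projectivity k (prep_aff x).
have h2 := prep_projectivity k (prep_aff x').
have [A [kA Ak]] := GL2P k.
move: h1 h2 h; set c := x * _ + _; set d := x * _ + _.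
set c' := x' * _ + _; set d' := x' * _ + _ => h1 h2 h.
have [u [u' [v [ed ed']]]] := lset_inf_rank1 h h1 h2 n1 n2.
(* The column (p0, q0) is the image under the inverse of [k] of the column (1, -x), whose products
   with (x, 1) and (x', 1) are 0 and x' - x. *)
have [p0 [q0 [e1 e2]]] : exists p0 q0 : M,
    c * p0 + d * q0 = 0 /\ c' * p0 + d' * q0 = x' - x.
  have : mx2 x 1 x' 1 *m k *m (A *m mx2 1 0 (- x) 0) = mx2 0 0 (x' - x) 0.
    rewrite -mulmxA (mulmxA (GL2_mx k)) kA mul1mx mx2M.
    by rewrite !mulr1 !mul1r !mulr0 !addr0 addrN.
  rewrite (mx2_eta k) mx2M (mx2_eta (A *m _)) mx2M => /mx2_inj[e1 _ e2 _].
  by exists ((A *m mx2 1 0 (- x) 0) 0 0), ((A *m mx2 1 0 (- x) 0) 1 0).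
have [x0 [s [us su]]] := common_affine (matrix_unit_regular fieldD (n:=n)) h1.
(* Since [s] inverts c - d x0, the relation c p0 + d q0 = 0 brings the factor [d], and with it [v],
   into [p0]. *)
have e3 : p0 = - (s * d * (q0 + x0 * p0)).
  rewrite -[LHS]mul1r -su -!mulrA mulrBl -mulrN; congr (s * _).
  by rewrite mulrDr mulrA opprD -[c * p0](addrK (d * q0)) e1 add0r.
exists (- (c' - d' * x0) *m s *m u + u'), (v *m (q0 + x0 * p0)).
rewrite -e2 mulmxA mulmxDl -ed' mulmxDl -!mulmxA (mulmxA u) -ed.
change (c' * p0 + d' * q0 =
  - (c' - d' * x0) * (s * (d * (q0 + x0 * p0))) + d' * (q0 + x0 * p0)).
rewrite mulNr -mulrN !mulrA -e3 mulrBl mulrDr !mulrA.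
by rewrite addrA addrAC subrK.
Qed.
End MatrixLine.

(** * Pencils, directions of affine lines, and separation of points *)

Section Pencil.
Variables (D : unitRingType) (fieldD : GRing.field_axiom D) (n : nat).
Local Notation M := 'M[D]_n.
Implicit Types (p q r : projline M) (x : M) (u : 'cV[D]_n) (v w : 'rV[D]_n).

(** A row [w] killed by 1 - uv equals (wu)v, so wu(1 - vu) = 0 with 1 - vu an invertible scalar. *)
Lemma isunit_1_sub_rank1 u v : v *m u != 1%:M -> isunit (1%:M - u *m v : M).
Proof.
move=> n1; apply: contrapT => /(left_kernel fieldD)[w [w0 e]].
have ew : w = w *m u *m v.
  by apply/eqP; rewrite -subr_eq0 -{1}[w]mulmx1 -mulmxA -mulmxBr; apply/eqP.
have n1' : 1%:M - v *m u != 0 by rewrite subr_eq0 eq_sym.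
have [s [ss _]] := scalar1_inv fieldD n1'.
case/eqP: w0; rewrite ew -[w *m u]mulmx1 -ss mulmxA mulmxBr mulmx1 (mulmxA _ v).
by rewrite -ew subrr !mul0mx.
Qed.

(* [p] is the point at infinity of the line of all [aff (x + u *m t *m v)]. *)
Definition dirpt x u v p := forall y1 y2 : 'rV[D]_n,
  inpt p y1 y2 <-> y2 *m u = 0 /\ exists t : 'M_1, y1 = t *m v + y2 *m x.

Lemma dirpt_ex x u v : u != 0 -> v != 0 -> exists p, dirpt x u v p.
Proof.
move=> /(col_inv fieldD)[w0 w0u] /(row_inv fieldD)[k0 vk0].
(* For x = 0 the point is R(a, b): the row space of [a] is spanned by [v], and [b] projects onto the
   rows killed by [u]. The rows (c, d) form a complement. The general case follows by the
   translation (y1, y2) -> (y1 + y2 x, y2). *)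
pose a : M := u *m v; pose b : M := 1%:M - u *m w0.
pose c : M := 1%:M - k0 *m v; pose d : M := k0 *m w0.
have bu : b *m u = 0 by rewrite mulmxBl mul1mx -mulmxA w0u mulmx1 subrr.
have wb : w0 *m b = 0 by rewrite mulmxBr mulmx1 mulmxA w0u mul1mx subrr.
have vc : v *m c = 0 by rewrite mulmxBr mulmx1 mulmxA vk0 mul1mx subrr.
have ck : c *m k0 = 0 by rewrite mulmxBl mul1mx -mulmxA vk0 mulmx1 subrr.
have ad : a *m d + b *m b = 1%:M.
  rewrite [b *m b]mulmxBr mulmx1 [b *m (_ *m _)]mulmxA bu mul0mx subr0.
  by rewrite /a /d mulmxA -(mulmxA u) vk0 mulmx1 addrC subrK.
have da : d *m a + c *m c = 1%:M.
  rewrite [c *m c]mulmxBr mulmx1 [c *m (_ *m _)]mulmxA ck mul0mx subr0.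
  by rewrite /a /d mulmxA -(mulmxA k0) w0u mulmx1 addrC subrK.
have ac : a *m c = 0 by rewrite -mulmxA vc mulmx0.
have ba : b *m a = 0 by rewrite mulmxA bu mul0mx.
have cd : c *m d = 0 by rewrite mulmxA ck mul0mx.
have db : d *m b = 0 by rewrite -mulmxA wb mulmx0.
have inv1 : invertible_mx (mx2 a b c d).
  apply/mx2_invP; exists d, c, b, a.
  change ([/\ a *m d + b *m b = 1%:M, a *m c + b *m a = 0,
    c *m d + d *m b = 0 & c *m c + d *m a = 1%:M] /\
    [/\ d *m a + c *m c = 1%:M, d *m b + c *m d = 0,
    b *m a + a *m c = 0 & b *m b + a *m d = 1%:M]).
  by rewrite ac ba cd db ad da !addr0 [c *m c + _]addrC [b *m b + _]addrC ad da.
have inv2 : invertible_mx (mx2 (1 : M) 0 x 1).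
  exists (mx2 1 0 (- x) 1); rewrite !mx2M !mul0r !mulr0 !mul1r !mulr1 !addr0.
  by rewrite !add0r addrN addNr mx2_1.
have [p0 hp0] := prep_mk inv1.
have := prep_projectivity (MkGL2 inv2) hp0.
rewrite /= !mxE /= !mulr1 mulr0 add0r => hp.
exists (projectivity (MkGL2 inv2) p0) => y1 y2.
apply: (iff_trans (inptP _ _ hp)); split=> [[y [-> ->]]|[y2u [t ->]]].
  split; first by rewrite -mulmxA bu mulmx0.
  by exists (y *m u); rewrite mulmxDr /a !mulmxA.
exists (t *m w0 + y2).
have eb : (t *m w0 + y2) *m b = y2.
  by rewrite mulmxDl -mulmxA wb mulmx0 add0r mulmxBr mulmx1 mulmxA y2u mul0mx subr0.
rewrite mulmxDr eb; split=> //.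
rewrite -[b * x]/(b *m x) [_ *m (b *m x)]mulmxA eb.
by rewrite /a mulmxA mulmxDl -(mulmxA t) w0u mulmx1 y2u addr0.
Qed.

Lemma aff_not_sub x w u p : w *m u = 1%:M -> inpt p (w *m x) w ->
  (forall w' : 'rV[D]_n, w' *m u = 0 -> inpt p (w' *m x) w') -> p = aff x.
Proof.
move=> wu hw h; apply: esym; apply: (inpt_sub fieldD) => y1 y2 /inpt_aff ->.
have -> : y2 = y2 *m u *m w + (y2 - y2 *m u *m w) by rewrite addrC subrK.
rewrite mulmxDl; apply: inptD.
  by rewrite -(mulmxA _ w); apply: inptZ.
by apply: h; rewrite mulmxBl -(mulmxA _ w) wu mulmx1 subrr.
Qed.

(** [r] contains the intersection of the two affine points, whose second coordinates fill the
    hyperplane killed by [u]. By [lset_dep] it contains one more vector, which decides which point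
    of the pencil it is. *)
Lemma lset_pencil x u v r : u != 0 -> v != 0 ->
  lset (aff x) (aff (x + u *m v)) r ->
  (exists s : 'M_1, r = aff (x + u *m s *m v)) \/ dirpt x u v r.
Proof.
move=> u0 v0 hr; have [w0 w0u] := col_inv fieldD u0.
have [->|n1] := pselect (r = aff x).
  by left; exists 0; rewrite mulmx0 mul0mx addr0.
have [->|n2] := pselect (r = aff (x + u *m v)).
  by left; exists 1%:M; rewrite mulmx1.
have ker w : w *m u = 0 -> inpt r (w *m x) w.
  move=> wu; apply: lset_meet hr _ _ => //; apply/inpt_aff => //.
  by rewrite mulmxDr mulmxA wu mul0mx addr0.
have m1 : ~ inpt r (w0 *m x) w0.
  by move=> h; apply: n1; apply: aff_not_sub w0u h ker.
have m2 : ~ inpt r (w0 *m (x + u *m v)) w0.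
  move=> h; apply: n2; apply: aff_not_sub w0u h _ => w wu.
  by rewrite mulmxDr mulmxA wu mul0mx addr0; apply: ker.
have h1 : inpt (aff x) (w0 *m x) w0 by apply/inpt_aff.
have h2 : inpt (aff (x + u *m v)) (w0 *m (x + u *m v)) w0 by apply/inpt_aff.
have [t] := lset_dep fieldD hr h1 h2 m2.
have -> : w0 *m x - t *m (w0 *m (x + u *m v)) = (1%:M - t) *m (w0 *m x) - t *m v.
  by rewrite !mulmxDr mulmxBl mul1mx opprD addrA (mulmxA w0) w0u mul1mx.
have -> : w0 - t *m w0 = (1%:M - t) *m w0 by rewrite mulmxBl mul1mx.
(* For t = 1 the extra vector is (v, 0) up to sign and [r] is the direction point; otherwise
   dividing by 1 - t shows that [r] is affine. *)
have [et|nt] := eqVneq (1%:M - t) 0.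
  rewrite et !mul0mx add0r => h; right.
  have hv : inpt r v 0.
    have et' : t = 1%:M by apply/esym/eqP; rewrite -subr_eq0 et.
    by move/inptN: h; rewrite opprK oppr0 et' mul1mx.
  have [p hp] := dirpt_ex x u0 v0.
  suff <- : p = r by [].
  apply: (inpt_sub fieldD) => y1 y2 /hp[y2u [s ->]].
  rewrite -[X in inpt _ _ X]add0r; apply: inptD; last exact: ker.
  by rewrite -(mulmx0 _ s); apply: inptZ.
have [s [_ st]] := scalar1_inv fieldD nt.
move=> /(inptZ s); rewrite mulmxBr !mulmxA st !mul1mx => h; left.
exists (- (s *m t)); apply: (aff_not_sub w0u).
  rewrite mulmxDr !mulmxA w0u mul1mx !mulNmx; exact: h.
by move=> w wu; rewrite mulmxDr !mulmxA wu !mul0mx addr0; apply: ker.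
Qed.

(** A point distant from [p] can meet the two affine points only in vectors whose second coordinates
    are not killed by [u]. Normalized to have product 1 with [u], their difference lies in [p] and
    so vanishes, which forces v = 0. *)
Lemma dirpt_lset x u v p : u != 0 -> v != 0 -> dirpt x u v p ->
  lset (aff x) (aff (x + u *m v)) p.
Proof.
move=> u0 v0 hp z zp; apply: contrapT => /not_orP[].
move=> /(meet_aff fieldD)[y [y0 hy]] /(meet_aff fieldD)[y' [y'0 hy']].
have ny w : inpt z (w *m x) w -> w *m u = 0 -> w = 0.
  move=> hw wu; case: (distant_meet0 zp hw) => //.
  by apply/hp; split=> //; exists 0; rewrite mul0mx add0r.
have yu : y *m u != 0 by apply: contraNneq y0 => /(ny _ hy) ->.
have y'u : y' *m u != 0.
  apply: contraNneq y'0 => e; rewrite (ny _ _ e) //.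
  by move: hy'; rewrite mulmxDr mulmxA e mul0mx addr0.
have [s [_ sy]] := scalar1_inv fieldD yu.
have [s' [_ sy']] := scalar1_inv fieldD y'u.
have hz := inptB (inptZ s' hy') (inptZ s hy).
case: (distant_meet0 zp hz) => [|e1 e2].
  apply/hp; split; first by rewrite mulmxBl -!mulmxA sy sy' subrr.
  exists 1%:M; rewrite mul1mx mulmxDr mulmxDr !mulmxA -(mulmxA s' y' u) sy' mul1mx.
  by rewrite mulmxBl -addrA addrCA.
case/eqP: v0; move: e1; rewrite mulmxDr mulmxDr !mulmxA -(mulmxA s' y' u) sy' mul1mx.
by rewrite addrAC -mulmxBl e2 mul0mx add0r.
Qed.

(** As in [dirpt_lset], with the affine combination of weights [t] and 1 - t in place of the
    difference. *)
Lemma aff_lset x u v (t : 'M_1) : u != 0 ->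
  lset (aff x) (aff (x + u *m v)) (aff (x + u *m t *m v)).
Proof.
move=> u0 z zp; apply: contrapT => /not_orP[].
move=> /(meet_aff fieldD)[y [y0 hy]] /(meet_aff fieldD)[y' [y'0 hy']].
have ny w : inpt z (w *m x) w -> w *m u = 0 -> w = 0.
  move=> hw wu; case: (distant_meet0 zp hw) => //.
  by apply/inpt_aff; rewrite mulmxDr !mulmxA wu !mul0mx addr0.
have yu : y *m u != 0 by apply: contraNneq y0 => /(ny _ hy) ->.
have y'u : y' *m u != 0.
  apply: contraNneq y'0 => e; rewrite (ny _ _ e) //.
  by move: hy'; rewrite mulmxDr mulmxA e mul0mx addr0.
have [s [_ sy]] := scalar1_inv fieldD yu.
have [s' [_ sy']] := scalar1_inv fieldD y'u.
have hz := inptD (inptZ (t *m s') hy') (inptZ ((1%:M - t) *m s) hy).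
set w := _ *m y' + _ *m y in hz.
have wu : w *m u = 1%:M.
  by rewrite /w mulmxDl -!mulmxA sy sy' !mulmx1 addrC subrK.
have [|_ w0] := distant_meet0 zp hz.
  have ty : t *m s' *m y' *m u = t by rewrite -!mulmxA sy' mulmx1.
  apply/inpt_aff; rewrite (mulmxDr w) !mulmxA wu mul1mx /w mulmxDl !mulmxDr !mulmxA.
  by rewrite ty addrAC [in RHS]mulmxDl.
move: wu; rewrite w0 mul0mx => /matrixP/(_ 0 0); rewrite !mxE /= => /esym/eqP.
by rewrite oner_eq0.
Qed.

Lemma dirpt_not_aff x u v p y : u != 0 -> v != 0 -> dirpt x u v p -> p <> aff y.
Proof.
move=> u0 v0 hp e; have : inpt p v 0.
  by apply/hp; rewrite mul0mx; split=> //; exists 1%:M; rewrite mul1mx mul0mx addr0.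
by rewrite e => /inpt_aff; rewrite mul0mx; apply/eqP.
Qed.

(** The vectors of [p] with second coordinate 0 span the line of [v], and the second coordinates in
    [p] fill the hyperplane killed by [u]. *)
Lemma dirpt_parallel x u v x' u' v' p : u != 0 -> u' != 0 -> v' != 0 ->
  dirpt x u v p -> dirpt x' u' v' p ->
  (exists s : 'M_1, u' = u *m s) /\ (exists t : 'M_1, v' = t *m v).
Proof.
move=> u0 u'0 v'0 h h'; split; last first.
  have /h[_ [t e]] : inpt p v' 0.
    apply/h'; rewrite mul0mx; split=> //.
    by exists 1%:M; rewrite mul1mx mul0mx addr0.
  by exists t; rewrite e mul0mx addr0.
apply: contrapT => hu.
have [|k [ku ku']] := col_indep fieldD u0 (u1 := u').
  by move=> t; apply/eqP => e; apply: hu; exists t.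
have /h'[e _] : inpt p (k *m x) k.
  by apply/h; split=> //; exists 0; rewrite mul0mx add0r.
move: ku'; rewrite e => /matrixP/(_ 0 0); rewrite !mxE /= => /esym/eqP.
by rewrite oner_eq0.
Qed.

(** When y2 u = 0 the added terms change y2 x only by a multiple of [v], which [t] absorbs. *)
Lemma dirpt_shift x u v u' v' p :
  dirpt x u v p -> dirpt (x + u *m v' + u' *m v) u v p.
Proof.
move=> h y1 y2; apply: (iff_trans (h y1 y2)).
split=> -[yu [t e]]; split=> //.
  exists (t - y2 *m u'); rewrite e mulmxBl !mulmxDr !mulmxA yu mul0mx addr0.
  by rewrite [X in _ = _ + X]addrC addrA subrK.
exists (t + y2 *m u'); rewrite e mulmxDl !mulmxDr !mulmxA yu mul0mx addr0.
by rewrite addrA addrAC.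
Qed.

(** With [q] at infinity, an affine point distant from [p] is perturbed by a rank one matrix so that
    it meets [r] while staying distant from [p]. *)
Lemma separation p q r : r <> p -> r <> q ->
  exists z, [/\ distant z p, distant z q & ~ distant z r].
Proof.
have [g eq] := projline_homogeneous q; have [k [gk kg]] := GL2_inv g.
move=> n1 n2.
suff [z [h1 h2 h3]] : exists z, [/\ distant z (projectivity k p), distant z (inf M)
    & ~ distant z (projectivity k r)].
  exists (projectivity g z); rewrite -eq -[p]kg -[r]kg.
  by split; [exact/distant_projectivity..|move/distant_projectivity].
have {}n1 : projectivity k r <> projectivity k p.
  by move/(congr1 (projectivity g)); rewrite !kg.
have {}n2 : projectivity k r <> inf M.
  by move/(congr1 (projectivity g)); rewrite !kg eq.
move: (projectivity k p) (projectivity k r) n1 n2 => {gk kg eq k g q}{}p {}r n1 n2.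
have [c [d hp]] := prep_ex p; have [c' [d' hr]] := prep_ex r.
have [x0 [s [us su]]] := common_affine (matrix_unit_regular fieldD (n := n)) hp.
have d'0 := prep_neq_inf fieldD hr n2.
(* [m] measures how far (c', d') is from being a left multiple of (c, d); it is nonzero because [r]
   differs from [p]. *)
set m := d' - (c' - d' *m x0) *m s *m d.
have m0 : m != 0.
  rewrite subr_eq0; apply/eqP => e; apply: n1; apply: esym.
  apply: (prep_sub (t := (c' - d' *m x0) *m s) _ hp).
    exact: matrix_dedekind_finite.
  suff ec' : c' = (c' - d' *m x0) *m s *m c.
    by move: hr; rewrite [X in prep X _ _]ec' [X in prep _ X _]e.
  have ec : s *m c = 1%:M + s *m d *m x0.
    apply/eqP; rewrite -subr_eq; apply/eqP.
    by rewrite -mulmxA -mulmxBr.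
  by rewrite -mulmxA ec mulmxDr mulmx1 !mulmxA -e subrK.
have [w [wd wm]] : exists w : 'rV_n, w *m d' != 0 /\ w *m m != 0.
  have [w1 h1] := row_neq0 d'0; have [w2 h2] := row_neq0 m0.
  have [e1|] := eqVneq (w1 *m m) 0; last by exists w1.
  have [e2|] := eqVneq (w2 *m d') 0; last by exists w2.
  by exists (w1 + w2); rewrite !mulmxDl e1 e2 add0r addr0.
set y1 := w *m (c' - d' *m x0); set y2 := w *m d'.
(* The first condition makes the perturbed point meet [r], the second keeps it distant from [p]. If
   [k0] violates the second, it is corrected by a column killed by [y2] but not by w m = y2 - y1 s
   d. *)
have [k [yk ky]] : exists k : 'cV_n, y2 *m k = 1%:M /\ y1 *m s *m d *m k != 1%:M.
  have [k0 h0] := row_inv fieldD wd.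
  have [e0|] := eqVneq (y1 *m s *m d *m k0) 1%:M; last by exists k0.
  have [k1 h1] := row_inv fieldD wm.
  exists (k0 + (k1 - k0 *m (y2 *m k1))).
  have e1 : y2 *m (k0 + (k1 - k0 *m (y2 *m k1))) = 1%:M.
    by rewrite mulmxDr mulmxBr (mulmxA y2 k0) [y2 *m k0]h0 mul1mx subrr addr0.
  split=> //; apply/eqP => e2.
  have : w *m m *m (k0 + (k1 - k0 *m (y2 *m k1))) = 0.
    have -> : w *m m = y2 - y1 *m s *m d by rewrite mulmxBr !mulmxA.
    by rewrite mulmxBl e1 e2 subrr.
  rewrite (mulmxDr (w *m m)) (mulmxBr (w *m m)) h1 (mulmxA _ k0).
  have -> : w *m m *m k0 = 0.
    by rewrite /m mulmxBr !mulmxA mulmxBl e0 [w *m d' *m k0]h0 subrr.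
  rewrite mul0mx subr0 add0r => /matrixP/(_ 0 0); rewrite !mxE /= => /eqP.
  by rewrite oner_eq0.
exists (aff (x0 + k *m y1)); split.
- apply/distant_sym/(distant_aff _ hp).
  have -> : c - d * (x0 + k *m y1) = (c - d * x0) * (1%:M - s *m d *m k *m y1).
    change (c - d *m (x0 + k *m y1) = (c - d *m x0) *m (1%:M - s *m d *m k *m y1)).
    rewrite mulmxBr mulmx1 !mulmxA [(c - d *m x0) *m s]us mul1mx mulmxDr opprD.
    by rewrite addrA !mulmxA.
  apply: isunitM; first by exists s.
  by apply: isunit_1_sub_rank1; rewrite !mulmxA.
- exact/distant_sym/distant_inf_aff.
- move/distant_sym/(distant_aff _ hr) => h.
  case/eqP: wd; rewrite (left_kernel_nonunit (v := w) _ h) ?mul0mx //.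
  change (w *m (c' - d' *m (x0 + k *m y1)) = 0).
  rewrite (mulmxDr d') opprD addrA mulmxBr -/y1 !mulmxA [w *m d' *m k]yk.
  by rewrite mul1mx subrr.
Qed.
End Pencil.

(** * Rank one matrices *)

Section Rook.
Variables (X Y : Type) (h : X -> Y).

Definition rook_local (E1 E2 : X -> X -> Prop) (F1 F2 : Y -> Y -> Prop) r :=
  forall t, (E1 r t -> F1 (h r) (h t)) /\ (E2 r t -> F2 (h r) (h t)).

Definition equivalence (Z : Type) (E : Z -> Z -> Prop) :=
  (forall r s, E r s -> E s r) /\ (forall r s t, E r s -> E s t -> E r t).

Section Local.
Variables (E1 E2 : X -> X -> Prop) (F1 F2 : Y -> Y -> Prop).
Hypotheses (eqE1 : equivalence E1) (eqE2 : equivalence E2).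
Hypotheses (eqF1 : equivalence F1) (eqF2 : equivalence F2).
Hypothesis share : forall r s,
  E1 r s \/ E2 r s <-> F1 (h r) (h s) \/ F2 (h r) (h s).
Hypothesis both : forall r s,
  E1 r s /\ E2 r s <-> F1 (h r) (h s) /\ F2 (h r) (h s).

(** A single witness [s] fixes the behaviour at [r]: if an [E1]-neighbour [t] had only an
    [F2]-related image, comparing [t] with [s] would either give [F1] by transitivity or relate [r]
    and [s] in both ways. *)
Lemma rook_localP r s :
  E1 r s -> ~ E2 r s -> F1 (h r) (h s) -> rook_local E1 E2 F1 F2 r.
Proof.
case: eqE1 eqE2 eqF1 eqF2 => E1s E1t [E2s E2t] [F1s F1t] [F2s F2t].
move=> rs nrs Frs t; split=> [rt|rt].
  have [//|Frt] : F1 (h r) (h t) \/ F2 (h r) (h t) by apply/share; left.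
  have [Fst|Fst] : F1 (h s) (h t) \/ F2 (h s) (h t).
    by apply/share; left; apply: E1t (E1s _ _ rs) rt.
    by apply: F1t Frs Fst.
  by case: nrs; case/both: (conj Frs (F2t _ _ _ Frt (F2s _ _ Fst))).
have [Frt|//] : F1 (h r) (h t) \/ F2 (h r) (h t) by apply/share; right.
have : F1 (h t) (h s) \/ F2 (h t) (h s) by left; apply: F1t (F1s _ _ Frt) Frs.
case/share => ts; last by case: nrs; apply: E2t rt ts.
by case/both: (conj (E1t _ _ _ rs (E1s _ _ ts)) rt).
Qed.
End Local.

(** The behaviour is carried along the path [r0], [q], [r]: the witness needed at [q] lies in the
    [E1]-class of [r0], where the images are known. The second leg exchanges the two relations. *)
Lemma rook_global E1 E2 F1 F2 r0 :
  equivalence E1 -> equivalence E2 -> equivalence F1 -> equivalence F2 ->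
  (forall r s, E1 r s \/ E2 r s <-> F1 (h r) (h s) \/ F2 (h r) (h s)) ->
  (forall r s, E1 r s /\ E2 r s <-> F1 (h r) (h s) /\ F2 (h r) (h s)) ->
  (forall r s, exists q, E1 r q /\ E2 q s) ->
  (forall r, exists s, E1 r s /\ ~ E2 r s) ->
  (forall r, exists s, E2 r s /\ ~ E1 r s) ->
  rook_local E1 E2 F1 F2 r0 -> forall r, rook_local E1 E2 F1 F2 r.
Proof.
move=> eE1 eE2 eF1 eF2 share both conn nd1 nd2 loc r.
have [q [rq qr]] := conn r0 r.
have locq : rook_local E1 E2 F1 F2 q.
  have [s [qs nqs]] := nd1 q.
  apply: (rook_localP eE1 eE2 eF1 eF2 share both qs nqs).
  by apply: eF1.2 (eF1.1 _ _ ((loc q).1 rq)) ((loc s).1 (eE1.2 _ _ _ rq qs)).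
have [s [rs nrs]] := nd2 r.
suff : rook_local E2 E1 F2 F1 r by move=> l t; case: (l t).
apply: (rook_localP eE2 eE1 eF2 eF1 _ _ rs nrs).
- by move=> a b; rewrite or_comm share or_comm.
- by move=> a b; rewrite and_comm both and_comm.
by apply: eF2.2 (eF2.1 _ _ ((locq r).2 qr)) ((locq s).2 (eE2.2 _ _ _ qr rs)).
Qed.

(* [E1] and [E2] are "same row" and "same column" in a rook's graph. *)
Lemma rook_map E1 E2 F1 F2 :
  equivalence E1 -> equivalence E2 -> equivalence F1 -> equivalence F2 ->
  (forall r s, E1 r s \/ E2 r s <-> F1 (h r) (h s) \/ F2 (h r) (h s)) ->
  (forall r s, E1 r s /\ E2 r s <-> F1 (h r) (h s) /\ F2 (h r) (h s)) ->
  (forall r s, exists q, E1 r q /\ E2 q s) ->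
  (forall r, exists s, E1 r s /\ ~ E2 r s) ->
  (forall r, exists s, E2 r s /\ ~ E1 r s) ->
  (forall r, rook_local E1 E2 F1 F2 r) \/ (forall r, rook_local E1 E2 F2 F1 r).
Proof.
move=> eE1 eE2 eF1 eF2 share both conn nd1 nd2.
have [[r0]|nX] := pselect (inhabited X); last by left=> r; case: nX.
have share' r s : E1 r s \/ E2 r s <-> F2 (h r) (h s) \/ F1 (h r) (h s).
  by rewrite share or_comm.
have both' r s : E1 r s /\ E2 r s <-> F2 (h r) (h s) /\ F1 (h r) (h s).
  by rewrite both and_comm.
have [s [rs nrs]] := nd1 r0.
have /share[Frs|Frs] : E1 r0 s \/ E2 r0 s by left.
  left; apply: (@rook_global _ _ _ _ r0) => //.
  exact: (rook_localP eE1 eE2 eF1 eF2 share both rs nrs Frs).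
right; apply: (@rook_global _ _ _ _ r0) => //.
exact: (rook_localP eE1 eE2 eF2 eF1 share' both' rs nrs Frs).
Qed.
End Rook.

Section RankOne.
Variables (D : unitRingType) (fieldD : GRing.field_axiom D) (n : nat).
Local Notation M := 'M[D]_n.
Implicit Types (r s q x : M) (u : 'cV[D]_n) (v : 'rV[D]_n).

Definition hascol r u := u != 0 /\ exists v, v != 0 /\ r = u *m v.
Definition hasrow r v := v != 0 /\ exists u, u != 0 /\ r = u *m v.
Definition rk1 r := exists u, hascol r u.
Definition samecol r s := exists u, hascol r u /\ hascol s u.
Definition samerow r s := exists v, hasrow r v /\ hasrow s v.
(** The direction of the line of all x + u t v: rank one matrices are parallel when they have the
    form uv and u t v with a scalar [t]. *)
Definition par r s := samecol r s /\ samerow r s.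

Lemma rk1I u v : u != 0 -> v != 0 -> rk1 (u *m v).
Proof. by move=> u0 v0; exists u; split=> //; exists v. Qed.

Lemma rk1P r : rk1 r -> exists u v, [/\ u != 0, v != 0 & r = u *m v].
Proof. by move=> [u [u0 [v [v0 ->]]]]; exists u, v. Qed.

Lemma mulcr_neq0 u v : u != 0 -> v != 0 -> u *m v != 0.
Proof.
move=> /(col_inv fieldD)[k ku] v0; apply/eqP=> /(congr1 (mulmx k)).
by rewrite mulmxA ku mul1mx mulmx0; apply/eqP.
Qed.

Lemma rk1_neq0 r : rk1 r -> r != 0.
Proof. by move=> /rk1P[u [v [u0 v0 ->]]]; apply: mulcr_neq0. Qed.

Lemma rk1_neq0I u v : u *m v != 0 -> rk1 (u *m v).
Proof.
move=> h; apply: rk1I; apply: contraNneq h => ->; by rewrite ?mul0mx ?mulmx0.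
Qed.

Lemma samecolI u v v' : u *m v != 0 -> u *m v' != 0 -> samecol (u *m v) (u *m v').
Proof.
move=> h h'; have u0 : u != 0 by apply: contraNneq h => ->; rewrite mul0mx.
exists u; split; split=> //.
  by exists v; split=> //; apply: contraNneq h => ->; rewrite mulmx0.
by exists v'; split=> //; apply: contraNneq h' => ->; rewrite mulmx0.
Qed.

Lemma samerowI u u' v : u *m v != 0 -> u' *m v != 0 -> samerow (u *m v) (u' *m v).
Proof.
move=> h h'; have v0 : v != 0 by apply: contraNneq h => ->; rewrite mulmx0.
exists v; split; split=> //.
  by exists u; split=> //; apply: contraNneq h => ->; rewrite mul0mx.
by exists u'; split=> //; apply: contraNneq h' => ->; rewrite mul0mx.
Qed.

Lemma samecol_rk1 r s : samecol r s -> rk1 r /\ rk1 s.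
Proof. by move=> [u [h1 h2]]; split; exists u. Qed.

Lemma samerow_rk1 r s : samerow r s -> rk1 r /\ rk1 s.
Proof.
by move=> [v [[v0 [u [u0 ->]]] [_ [u' [u'0 ->]]]]]; split; apply: rk1I.
Qed.

Lemma samecolP u v s : samecol (u *m v) s -> exists v', s = u *m v'.
Proof.
move=> [u1 [[u10 [v1 [v10 e]]] [_ [v2 [v20 ->]]]]].
have [k vk] := row_inv fieldD v10.
have -> : u1 = u *m (v *m k) by rewrite mulmxA e -mulmxA vk mulmx1.
by exists (v *m k *m v2); rewrite !mulmxA.
Qed.

Lemma samerowP u v s : samerow (u *m v) s -> exists u', s = u' *m v.
Proof.
move=> [v1 [[v10 [u1 [u10 e]]] [_ [u2 [u20 ->]]]]].
have [k ku] := col_inv fieldD u10.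
have -> : v1 = (k *m u) *m v by rewrite -mulmxA e mulmxA ku mul1mx.
by exists (u2 *m (k *m u)); rewrite !mulmxA.
Qed.

Lemma samecol_equiv : equivalence samecol.
Proof.
split=> [r s [u [h1 h2]]|r s t rs st]; first by exists u.
have [/rk1P[u [v [u0 v0 er]]] _] := samecol_rk1 rs; subst r.
have [s0 t0] := samecol_rk1 st.
have [v' es] := samecolP rs; subst s.
have [v2 et] := samecolP st; subst t.
by apply: samecolI; [apply: mulcr_neq0 | apply: rk1_neq0].
Qed.

Lemma samerow_equiv : equivalence samerow.
Proof.
split=> [r s [u [h1 h2]]|r s t rs st]; first by exists u.
have [/rk1P[u [v [u0 v0 er]]] _] := samerow_rk1 rs; subst r.
have [s0 t0] := samerow_rk1 st.
have [v' es] := samerowP rs; subst s.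
have [v2 et] := samerowP st; subst t.
by apply: samerowI; [apply: mulcr_neq0 | apply: rk1_neq0].
Qed.

Lemma par_equiv : equivalence par.
Proof.
have [sc tc] := samecol_equiv; have [sr tr] := samerow_equiv.
split=> [r s [h1 h2]|r s t [h1 h2] [h3 h4]]; first by split; [apply: sc|apply: sr].
by split; [apply: tc h1 h3|apply: tr h2 h4].
Qed.

Lemma par_refl r : rk1 r -> par r r.
Proof.
move=> /rk1P[u [v [u0 v0 ->]]]; have h := mulcr_neq0 u0 v0.
by split; [apply: samecolI|apply: samerowI].
Qed.

Lemma parP u v s : par (u *m v) s -> exists t : 'M_1, s = u *m t *m v.
Proof.
move=> [hc hr]; have [u0 s0] := samecol_rk1 hc.
have {}u0 : u != 0 by apply: contraNneq (rk1_neq0 u0) => ->; rewrite mul0mx.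
have [v' e1] := samecolP hc; have [u' e2] := samerowP hr.
have [k ku] := col_inv fieldD u0; exists (k *m u').
have : v' = k *m s by rewrite e1 mulmxA ku mul1mx.
by rewrite {1}e2 mulmxA => ev; rewrite e1 ev !mulmxA.
Qed.

Lemma parI u v (t : 'M_1) : u *m v != 0 -> u *m t *m v != 0 ->
  par (u *m v) (u *m t *m v).
Proof.
move=> h h'; split; last exact: samerowI.
by rewrite -mulmxA; apply: samecolI => //; rewrite mulmxA.
Qed.

(** For the converse, if the columns [u] and [u1] are independent, functionals dual to them applied
    to uv - u1 v1 = u2 v2 show that [v] and [v1] are both multiples of [v2]. *)
Lemma share_sub r s : rk1 r -> rk1 s ->
  (samecol r s \/ samerow r s) <-> (r = s \/ rk1 (r - s)).
Proof.
move=> /rk1P[u [v [u0 v0 ->]]] /rk1P[u1 [v1 [u10 v10 ->]]].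
have h := mulcr_neq0 u0 v0; have h1 := mulcr_neq0 u10 v10; split.
  have [->|ne] := pselect (u *m v = u1 *m v1); first by left.
  case=> [/samecolP|/samerowP] [w e]; right; have /eqP := ne; rewrite -subr_eq0 e.
    by rewrite -mulmxBr; apply: rk1_neq0I.
  by rewrite -mulmxBl; apply: rk1_neq0I.
case=> [<-|/rk1P[u2 [v2 [u20 v20 e]]]]; first by left; apply: samecolI.
have [[t et]|nt] := pselect (exists t : 'M_1, u1 = u *m t).
  by left; move: h1; rewrite et -mulmxA => h1; apply: samecolI.
have [|k [ku ku1]] := col_indep fieldD u0 (u1 := u1).
  by move=> t; apply/eqP=> et; apply: nt; exists t.
have e1 : v1 = - (k *m u2) *m v2.
  have := congr1 (mulmx k) e.
  by rewrite mulmxBr !mulmxA ku ku1 mul0mx mul1mx sub0r mulNmx => <-; rewrite opprK.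
have [l lu] : exists l : 'rV_n, l *m u = 1%:M /\ l *m u1 = 0.
  have [|l [lu1 lu]] := col_indep fieldD u10 (u1 := u); last by exists l.
  move=> t; apply/eqP=> et; apply: nt.
  have t0 : t != 0 by apply: contraNneq u0 => t0; rewrite et t0 mulmx0.
  have [t' [ts _]] := scalar1_inv fieldD t0.
  by exists t'; rewrite et -mulmxA ts mulmx1.
have e2 : v = (l *m u2) *m v2.
  have := congr1 (mulmx l) e; case: lu => lu lu1.
  by rewrite mulmxBr !mulmxA lu lu1 mul0mx mul1mx subr0.
right; move: h h1; rewrite e1 e2 !mulmxA => h h1; exact: samerowI.
Qed.

Lemma rank1_neq1 u v : (1 < n)%N -> u *m v != 1%:M.
Proof.
move=> n1; apply/eqP=> /matrixP e.
pose i0 := Ordinal (ltnW n1); pose i1 := Ordinal n1.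
have e01 := e i0 i1; have e11 := e i1 i1; have e00 := e i0 i0.
move: e01 e11 e00; rewrite !mxE !big_ord1 /= => e01 e11 e00.
have h : u i0 0 \is a GRing.unit.
  apply: fieldD; apply/eqP=> h; move: e00; rewrite h mul0r => /esym/eqP.
  by rewrite oner_eq0.
move: e11; have -> : v 0 i1 = 0.
  by rewrite -[v 0 i1](mulKr h) e01 mulr0.
by rewrite mulr0 => /esym/eqP; rewrite oner_eq0.
Qed.

Lemma row_other v : (1 < n)%N -> v != 0 ->
  exists v1, forall t : 'M_1, v1 != t *m v.
Proof.
move=> n1 v0; have [k vk] := row_inv fieldD v0.
have /(row_neq0)[y hy] : 1%:M - k *m v != 0 :> M.
  by rewrite subr_eq0 eq_sym rank1_neq1.
exists (y *m (1%:M - k *m v)) => t; apply: contraNneq hy => e.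
have : t *m v *m k = 0.
  by rewrite -e -mulmxA mulmxBl mul1mx -mulmxA vk mulmx1 subrr mulmx0.
by rewrite e -mulmxA vk mulmx1 => ->; rewrite mul0mx.
Qed.

Lemma col_other u : (1 < n)%N -> u != 0 ->
  exists u1, forall t : 'M_1, u1 != u *m t.
Proof.
move=> n1 u0; have [k ku] := col_inv fieldD u0.
have h0 : 1%:M - u *m k != 0 :> M by rewrite subr_eq0 eq_sym rank1_neq1.
have [y hy] : exists y : 'cV_n, (1%:M - u *m k) *m y != 0.
  apply: contrapT => h; case/eqP: h0; apply/matrixP=> i j.
  have /matrixP/(_ i 0) : (1%:M - u *m k) *m delta_mx j 0 = 0 :> 'cV_n.
    by apply/eqP/negPn/negP=> h'; apply: h; exists (delta_mx j 0).
  by rewrite -colE !mxE.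
exists ((1%:M - u *m k) *m y) => t; apply: contraNneq hy => e.
have : k *m (u *m t) = 0.
  by rewrite -e mulmxA mulmxBr mulmx1 mulmxA ku mul1mx subrr mul0mx.
by rewrite e mulmxA ku mul1mx => ->; rewrite mulmx0.
Qed.

Lemma mx_rk1_ind (Q : M -> Prop) :
  Q 0 -> (forall x r, Q x -> rk1 r -> Q (x + r)) -> forall x, Q x.
Proof.
move=> Q0 QD x.
have -> : x = \sum_i delta_mx i 0 *m row i x.
  apply/row_matrixP=> i; rewrite raddf_sum (bigD1 i) //= big1 ?addr0.
    rewrite row_mul; have -> : row i (delta_mx i 0 : 'cV[D]_n) = 1%:M.
      by apply/matrixP=> a b; rewrite !ord1 !mxE !eqxx.
    by rewrite mul1mx.
  move=> j ji; rewrite row_mul.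
  have -> : row i (delta_mx j 0 : 'cV[D]_n) = 0.
    by apply/matrixP=> a b; rewrite !ord1 !mxE eq_sym (negPf ji).
  by rewrite mul0mx.
elim: (index_enum _) => [|i l IH]; first by rewrite big_nil.
rewrite big_cons addrC.
have [->|ne] := eqVneq (delta_mx i 0 *m row i x) 0; first by rewrite addr0.
by apply: QD => //; apply: rk1_neq0I.
Qed.
End RankOne.

(** * Additivity *)

Definition chart (R R' : pzRingType) (phi : projline R -> projline R')
    (f : R -> R') :=
  [/\ distant_iso phi, phi (inf R) = inf R' & forall x, phi (aff x) = aff (f x)].

Lemma chart_inv (R R' : pzRingType) (phi : projline R -> projline R') f :
  chart phi f -> exists psi g,
  [/\ chart psi g, cancel phi psi, cancel psi phi, cancel f g & cancel g f].
Proof.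
move=> [[[psi phiK psiK] dphi] phi0 phif].
have dpsi p q : distant p q <-> distant (psi p) (psi q) by rewrite dphi !psiK.
have psi0 : psi (inf R') = inf R by rewrite -phi0 phiK.
have /choice[g hg] (y : R') : exists x, psi (aff y) = aff x.
  by apply/distant_infP; rewrite -psi0; apply/dpsi/distant_inf_aff.
exists psi, g; split=> //.
- by split=> //; split=> //; exists phi.
- by move=> x; apply: (@aff_inj R); rewrite -hg -phif phiK.
- by move=> y; apply: (@aff_inj R'); rewrite -phif -hg psiK.
Qed.

Lemma chart_isunit (R R' : pzRingType) (phi : projline R -> projline R') f x y :
  chart phi f -> (isunit (x - y) <-> isunit (f x - f y)).
Proof.
move=> [[_ dphi] _ phif]; rewrite -!distant_aff_aff -!phif; exact: dphi.
Qed.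

Lemma chart_lset (R R' : pzRingType) (phi : projline R -> projline R') f p q r :
  chart phi f -> lset p q r -> lset (phi p) (phi q) (phi r).
Proof.
move=> [[[psi phiK psiK] dphi] _ _] h z; rewrite -[z]psiK => /dphi/h.
by case=> /dphi; [left|right].
Qed.

Section Chart.
Variables (D D' : unitRingType).
Variables (fieldD : GRing.field_axiom D) (fieldD' : GRing.field_axiom D').
Variables (n n' : nat).
Local Notation M := 'M[D]_n.
Local Notation M' := 'M[D']_n'.

Section Directions.
Variables (phi : projline M -> projline M') (f : M -> M') (chart_f : chart phi f).

(** Once f 0 = 0, additivity of [f] amounts to independence of this value from the base point
    [x]. *)
Definition increment x r := f (x + r) - f x.
Local Notation diff := increment.

Lemma diffK x r : f (x + r) = f x + diff x r.
Proof. by rewrite /increment addrCA subrr addr0. Qed.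

Lemma chart_injective : injective f.
Proof. by have [psi [g [_ _ _ fK _]]] := chart_inv chart_f; apply: can_inj fK. Qed.

(** [phi] preserves [lset] and affineness, so [phi p] is a non-affine member of the image pencil.
    Its existence makes the increment rank one, and by [lset_pencil] it is the direction point of
    the image line. The other affine points of the line go to affine members of the pencil. *)
Lemma chart_pencil x (u : 'cV_n) (v : 'rV_n) : u != 0 -> v != 0 ->
  exists (u' : 'cV_n') (v' : 'rV_n') p, [/\ u' != 0, v' != 0,
    diff x (u *m v) = u' *m v', dirpt x u v p & dirpt (f x) u' v' (phi p)] /\
    forall t : 'M_1, exists t' : 'M_1, diff x (u *m t *m v) = u' *m t' *m v'.
Proof.
move=> u0 v0; have [p hp] := dirpt_ex fieldD x u0 v0.
have [psi [g [chart_g phiK psiK fK gK]]] := chart_inv chart_f.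
have [_ _ phif] := chart_f.
have naff p' y : (forall z, p' <> aff z) -> phi p' <> aff y.
  by move=> np e; apply: (np (g y)); rewrite -[p']phiK e; case: chart_g.
have np y : phi p <> aff y by apply: naff => z; apply: dirpt_not_aff hp.
have := chart_lset chart_f (dirpt_lset fieldD u0 v0 hp); rewrite !phif => h.
have [u' [v' e]] := lset_rank1 fieldD' h (np _) (np _).
have ne : u' *m v' != 0.
  rewrite -e subr_eq0; apply/eqP=> /chart_injective /eqP.
  by rewrite -subr_eq0 addrC addKr (negPf (mulcr_neq0 fieldD u0 v0)).
have u'0 : u' != 0 by apply: contraNneq ne => ->; rewrite mul0mx.
have v'0 : v' != 0 by apply: contraNneq ne => ->; rewrite mulmx0.
have ef : f (x + u *m v) = f x + u' *m v' by rewrite -e addrCA subrr addr0.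
exists u', v', p; rewrite ef in h; split.
  by split=> //; case: (lset_pencil fieldD' u'0 v'0 h) => // -[t /np].
move=> t.
have := chart_lset chart_f (aff_lset fieldD (x := x) (v := v) (t := t) u0).
rewrite !phif ef => /(lset_pencil fieldD' u'0 v'0)[[t' /(@aff_inj M')e']|hd].
  by exists t'; rewrite /increment e' addrC addKr.
by case: (dirpt_not_aff (y := f (x + u *m t *m v)) u'0 v'0 hd).
Qed.

Lemma diff_rk1 x r : rk1 r -> rk1 (diff x r).
Proof.
move=> /rk1P[u [v [u0 v0 ->]]].
have [u' [v' [p [[u'0 v'0 -> _ _] _]]]] := chart_pencil x u0 v0.
exact: rk1I.
Qed.

Lemma diff_par x r s : par r s -> par (diff x r) (diff x s).
Proof.
move=> rs; have [/rk1P[u [v [u0 v0 er]]] s0] := samecol_rk1 rs.1; subst r.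
have [t es] := parP fieldD rs; subst s.
have := rk1_neq0 fieldD' (diff_rk1 x s0).
have [u' [v' [p [[u'0 v'0 -> _ _] h]]]] := chart_pencil x u0 v0.
have [t' ->] := h t; apply: parI; exact: mulcr_neq0.
Qed.

Lemma diff_share x r s : rk1 r -> rk1 s ->
  samecol r s \/ samerow r s ->
  samecol (diff x r) (diff x s) \/ samerow (diff x r) (diff x s).
Proof.
move=> hr hs /(share_sub fieldD hr hs) h.
apply/(share_sub fieldD'); [exact: diff_rk1|exact: diff_rk1|].
case: h => [->|h]; [by left|right].
have -> : diff x r - diff x s = diff (x + s) (r - s).
  by rewrite /increment opprB addrA subrK -addrA (addrCA s) subrr addr0.
exact: diff_rk1.
Qed.

(** Parallel lines have the same point at infinity by [dirpt_shift]; so do their images, which are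
    therefore parallel by [dirpt_parallel]. *)
Lemma diff_par_shift x (u u' : 'cV_n) (v v' : 'rV_n) : u != 0 -> v != 0 ->
  par (diff x (u *m v)) (diff (x + u *m v' + u' *m v) (u *m v)).
Proof.
move=> u0 v0; set y := x + _ + _.
have [u1 [v1 [p [[u10 v10 -> hp hp'] _]]]] := chart_pencil x u0 v0.
have [u2 [v2 [q [[u20 v20 -> hq hq'] _]]]] := chart_pencil y u0 v0.
have ep : p = q.
  apply: (inpt_sub fieldD) => y1 y2 h; apply/hq.
  exact/(dirpt_shift _ _ hp).
rewrite -ep in hq'.
have [[s es] [t et]] := dirpt_parallel fieldD' u10 u20 v20 hp' hq'.
have h := mulcr_neq0 fieldD' u20 v20.
rewrite es et; rewrite es et in h.
have -> : u1 *m s *m (t *m v1) = u1 *m (s *m t) *m v1 by rewrite !mulmxA.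
apply: parI; first exact: mulcr_neq0.
by rewrite !mulmxA; rewrite !mulmxA in h.
Qed.
End Directions.

End Chart.

Section Additivity.
Variables (D D' : unitRingType).
Variables (fieldD : GRing.field_axiom D) (fieldD' : GRing.field_axiom D').
Variables (n n' : nat).
Local Notation M := 'M[D]_n.
Local Notation M' := 'M[D']_n'.
Variables (phi : projline M -> projline M') (f : M -> M') (chart_f : chart phi f).
Hypothesis n_gt1 : (1 < n)%N.
Local Notation diff := (increment f).

(** Indexing by a boolean turns the exchange of rows and columns into an exclusive or. *)
Definition same (b : bool) (E : unitRingType) (m : nat) :
    'M[E]_m -> 'M[E]_m -> Prop :=
  if b then @samerow E m else @samecol E m.

Lemma same_equiv b (E : unitRingType) m :
  GRing.field_axiom E -> equivalence (@same b E m).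
Proof. by case: b => h; [apply: samerow_equiv|apply: samecol_equiv]. Qed.

Lemma same_rk1 b (E : unitRingType) m (r s : 'M[E]_m) :
  same b r s -> rk1 r /\ rk1 s.
Proof. by case: b; [apply: samerow_rk1|apply: samecol_rk1]. Qed.

Lemma par_same b (E : unitRingType) m (r s : 'M[E]_m) : par r s -> same b r s.
Proof. by case: b => -[]. Qed.

Lemma same_par b (E : unitRingType) m (r s : 'M[E]_m) :
  same b r s -> same (~~ b) r s -> par r s.
Proof. by case: b. Qed.

(* [swap] is true when [f] exchanges row spaces and column spaces. *)
Definition dirtype x (swap : bool) := forall b r s,
  same b r s -> same (b (+) swap) (diff x r) (diff x s).

(** The increments of the inverse chart at [f x] undo those of [f] at [x]. *)
Lemma diff_parE x r s : rk1 r -> rk1 s ->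
  par (diff x r) (diff x s) -> par r s.
Proof.
have [psi [g [chart_g _ _ fK _]]] := chart_inv chart_f.
have inv t : increment g (f x) (diff x t) = t.
  by rewrite {1}/increment -diffK !fK addrC addKr.
move=> hr hs h; rewrite -[r]inv -[s]inv.
exact: (diff_par fieldD' fieldD chart_g).
Qed.

Lemma diff_shareE x r s : rk1 r -> rk1 s ->
  (samecol r s \/ samerow r s <->
  samecol (diff x r) (diff x s) \/ samerow (diff x r) (diff x s)).
Proof.
have [psi [g [chart_g _ _ fK _]]] := chart_inv chart_f.
have inv t : increment g (f x) (diff x t) = t.
  by rewrite {1}/increment -diffK !fK addrC addKr.
move=> hr hs; split; first exact: (diff_share fieldD fieldD' chart_f).
move=> h; rewrite -[r]inv -[s]inv; apply: (diff_share fieldD' fieldD chart_g) => //.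
  exact: (diff_rk1 fieldD fieldD' chart_f).
exact: (diff_rk1 fieldD fieldD' chart_f).
Qed.

Lemma same_connect (r s : M) : rk1 r -> rk1 s ->
  exists q, [/\ rk1 q, samecol r q & samerow q s].
Proof.
move=> /rk1P[u [v [u0 v0 ->]]] /rk1P[u' [v' [u'0 v'0 ->]]].
exists (u *m v'); split; first exact: rk1I.
  by apply: samecolI; apply: mulcr_neq0.
by apply: samerowI; apply: mulcr_neq0.
Qed.

Lemma samecol_not_row (r : M) :
  rk1 r -> exists s, [/\ rk1 s, samecol r s & ~ samerow r s].
Proof.
move=> /rk1P[u [v [u0 v0 ->]]].
have [v1 hv1] := row_other fieldD n_gt1 v0.
have v10 : v1 != 0 by have := hv1 0; rewrite mul0mx.
exists (u *m v1); split; first exact: rk1I.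
  by apply: samecolI; apply: mulcr_neq0.
move=> /(samerowP fieldD)[u' e]; have [k ku] := col_inv fieldD u0.
have := hv1 (k *m u'); rewrite -mulmxA -e mulmxA ku mul1mx eqxx.
by [].
Qed.

Lemma samerow_not_col (r : M) :
  rk1 r -> exists s, [/\ rk1 s, samerow r s & ~ samecol r s].
Proof.
move=> /rk1P[u [v [u0 v0 ->]]].
have [u1 hu1] := col_other fieldD n_gt1 u0.
have u10 : u1 != 0 by have := hu1 0; rewrite mulmx0.
exists (u1 *m v); split; first exact: rk1I.
  by apply: samerowI; apply: mulcr_neq0.
move=> /(samecolP fieldD)[v' e]; have [k vk] := row_inv fieldD v0.
have := hu1 (v' *m k); rewrite mulmxA -e -mulmxA vk mulmx1 eqxx.
by [].
Qed.

Lemma dirtype_ex x : exists b, dirtype x b.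
Proof.
pose X := {r : M | rk1 r}; pose h (r : X) := diff x (sval r).
pose E1 (r s : X) := samecol (sval r) (sval s).
pose E2 (r s : X) := samerow (sval r) (sval s).
have eqE b (E := fun r s : X => same b (sval r) (sval s)) : equivalence E.
  have [h1 h2] := @same_equiv b D n fieldD.
  by split=> [r s|r s t]; [apply: h1|apply: h2].
have conn (r s : X) : exists q, E1 r q /\ E2 q s.
  have [q [hq h1 h2]] := same_connect (svalP r) (svalP s).
  by exists (exist _ q hq).
have nd1 (r : X) : exists s, E1 r s /\ ~ E2 r s.
  by have [s [hs h1 h2]] := samecol_not_row (svalP r); exists (exist _ s hs).
have nd2 (r : X) : exists s, E2 r s /\ ~ E1 r s.
  by have [s [hs h1 h2]] := samerow_not_col (svalP r); exists (exist _ s hs).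
have share (r s : X) := diff_shareE x (svalP r) (svalP s).
have both (r s : X) : E1 r s /\ E2 r s <->
    samecol (h r) (h s) /\ samerow (h r) (h s).
  split; first exact: (diff_par fieldD fieldD' chart_f).
  exact: (diff_parE (svalP r) (svalP s)).
have [H|H] := rook_map (eqE false) (eqE true) (samecol_equiv fieldD' n')
  (samerow_equiv fieldD' n') share both conn nd1 nd2.
  exists false => b r s rs; have [hr hs] := same_rk1 rs.
  have [h1 h2] := H (exist _ r hr) (exist _ s hs); rewrite addbF.
  by case: b rs => rs; [apply: h2|apply: h1].
exists true => b r s rs; have [hr hs] := same_rk1 rs.
have [h1 h2] := H (exist _ r hr) (exist _ s hs); rewrite addbT.
by case: b rs => rs; [apply: h2|apply: h1].
Qed.

Lemma par_shift x r (u : 'cV_n) (v : 'rV_n) : u != 0 -> v != 0 ->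
  (exists w, r = u *m w) \/ (exists w, r = w *m v) ->
  par (diff x (u *m v)) (diff (x + r) (u *m v)).
Proof.
move=> u0 v0 [] [w ->].
  have := diff_par_shift fieldD fieldD' chart_f x 0 w u0 v0.
  by rewrite mul0mx addr0.
have := diff_par_shift fieldD fieldD' chart_f x w 0 u0 v0.
by rewrite mulmx0 addr0.
Qed.

(** If the types at [x] and x + q differ, take [s] with the column of [q] but another row. Moving
    the base point by [q] keeps the increments of [q] and [s] in their parallel classes, so at [x]
    these share both row and column, contradicting [diff_parE]. *)
Lemma dirtype_shift b x q : dirtype x b -> rk1 q -> dirtype (x + q) b.
Proof.
move=> tb rq; have [b' tb'] := dirtype_ex (x + q).
have [<-//|nb] := eqVneq b' b.
have [s [rs qs nqs]] := samecol_not_row rq; exfalso; apply: nqs.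
suff h : par (diff x q) (diff x s) by case: (diff_parE rq rs h).
have eb : b' = ~~ b by move: nb; case: (b) (b') => -[].
apply: (@same_par (false (+) b)); first exact: tb.
have := tb' false _ _ qs; rewrite eb /= => h'.
move: rq rs qs h' => /rk1P[u [v [u0 v0 ->]]] rs /(samecolP fieldD)[v' es] h'; subst s.
have v'0 : v' != 0 by apply: contraNneq (rk1_neq0 fieldD rs) => ->; rewrite mulmx0.
have [sy tr] := @same_equiv (~~ b) D' n' fieldD'.
have hq : (exists w, u *m v = u *m w) \/ (exists w, u *m v = w *m v').
  by left; exists v.
have hs : (exists w, u *m v = u *m w) \/ (exists w, u *m v = w *m v).
  by left; exists v.
apply: (tr _ _ _ (par_same _ (par_shift x u0 v0 hs))).
apply: (tr _ _ _ h'); apply: sy; exact: par_same (par_shift x u0 v'0 hq).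
Qed.

(** If q = uv and r = u2 v2, the mixed matrices u2 v and u v2 share a factor with [q], so
    [par_shift] applies to them. They have a column, respectively a row, in common with [r], and
    both base points treat these links by the same type. *)
Lemma diff_par_shift1 x r q : rk1 r -> rk1 q -> par (diff x r) (diff (x + q) r).
Proof.
move=> rr rq; have [b tb] := dirtype_ex x; have tb' := dirtype_shift tb rq.
move: rq rr tb' => /rk1P[u [v [u0 v0 ->]]] /rk1P[u2 [v2 [u20 v20 ->]]] tb'.
have hc : samecol (u2 *m v2) (u2 *m v) by apply: samecolI; apply: mulcr_neq0.
have hr : samerow (u2 *m v2) (u *m v2) by apply: samerowI; apply: mulcr_neq0.
have [sy1 tr1] := @same_equiv (false (+) b) D' n' fieldD'.
have [sy2 tr2] := @same_equiv (true (+) b) D' n' fieldD'.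
apply: (@same_par (false (+) b)).
  apply: (tr1 _ _ _ (tb false _ _ hc)).
  apply: (tr1 _ _ _ _ (sy1 _ _ (tb' false _ _ hc))).
  by apply: par_same; apply: par_shift => //; right; exists u.
apply: (tr2 _ _ _ (tb true _ _ hr)).
apply: (tr2 _ _ _ _ (sy2 _ _ (tb' true _ _ hr))).
by apply: par_same; apply: par_shift => //; left; exists v.
Qed.

(** The second difference is symmetric in [r] and [s]. If nonzero, it would have the direction of
    the increment along [r] and also that of the increment along [s], but these are not parallel. *)
Lemma diff_shift_npar x r s : rk1 r -> rk1 s -> ~ par r s ->
  diff (x + s) r = diff x r.
Proof.
move=> hr hs nrs.
have ndiff : ~ par (diff x r) (diff x s) by move/(diff_parE hr hs).
have h1 := diff_par_shift1 x hr hs; have h2 := diff_par_shift1 x hs hr.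
have e : diff x r - diff (x + s) r = diff x s - diff (x + r) s.
  rewrite /increment !opprB (addrAC x s r) addrACA [RHS]addrACA.
  by rewrite (addrC (f (x + r))).
have := diff_rk1 fieldD fieldD' chart_f x hs.
have := diff_rk1 fieldD fieldD' chart_f x hr.
move=> /rk1P[u1 [v1 [u10 v10 e1]]] /rk1P[u2 [v2 [u20 v20 e2]]].
rewrite {}e1 in h1 e ndiff *; rewrite {}e2 in h2 e ndiff *.
have [a ea'] := parP fieldD' h1; have [b eb'] := parP fieldD' h2.
rewrite {}ea' in e *; rewrite {}eb' in e *.
have ea : u1 *m v1 - u1 *m a *m v1 = u1 *m (1%:M - a) *m v1.
  by rewrite mulmxBr mulmx1 mulmxBl.
have eb : u2 *m v2 - u2 *m b *m v2 = u2 *m (1%:M - b) *m v2.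
  by rewrite mulmxBr mulmx1 mulmxBl.
have [e0|ne] := eqVneq (u1 *m v1 - u1 *m a *m v1) 0.
  by apply: esym; apply/eqP; rewrite -subr_eq0 e0.
case: ndiff; have [sy tr] := par_equiv fieldD' n'.
apply: (tr _ (u1 *m (1%:M - a) *m v1)).
  by rewrite ea in ne; apply: parI ne; apply: mulcr_neq0.
by rewrite -ea e eb in ne *; apply: sy; apply: parI ne; apply: mulcr_neq0.
Qed.

(** In the parallel case s = u1 v with the row [v] of [r]. A row [v1] independent of [v] splits [s]
    into u1 v1 + u1 (v - v1), and neither summand is parallel to [r]. *)
Lemma diff_shift x r s : rk1 r -> rk1 s -> diff (x + s) r = diff x r.
Proof.
move=> hr hs.
have [[_ rs]|] := pselect (par r s); last exact: diff_shift_npar.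
move: hr rs => /rk1P[u [v [u0 v0 ->]]] /(samerowP fieldD)[u1 es].
have hr : rk1 (u *m v) by apply: rk1I.
have [v1 hv1] := row_other fieldD n_gt1 v0.
have u10 : u1 != 0.
  by apply: contraNneq (rk1_neq0 fieldD hs) => e0; rewrite es e0 mul0mx.
have v10 : v1 != 0 by have := hv1 0; rewrite mul0mx.
have [k ku] := col_inv fieldD u10.
have nrow w : (forall t : 'M_1, w != t *m v) ->
    rk1 (u1 *m w) /\ ~ par (u *m v) (u1 *m w).
  move=> hw; split.
    by apply: rk1I => //; have := hw 0; rewrite mul0mx.
  move=> [_ /(samerowP fieldD)[u' e]]; have := hw (k *m u').
  by rewrite -mulmxA -e mulmxA ku mul1mx eqxx.
have [rz nz] := nrow _ hv1.
have [ry ny] : rk1 (u1 *m (v - v1)) /\ ~ par (u *m v) (u1 *m (v - v1)).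
  apply: nrow => t; apply: contra_neqN (hv1 (1%:M - t)) => /eqP e.
  by rewrite mulmxBl mul1mx -e opprB addrC subrK.
have -> : s = u1 *m v1 + u1 *m (v - v1) by rewrite -mulmxDr addrC subrK.
by rewrite addrA diff_shift_npar // diff_shift_npar.
Qed.

Lemma chart_additive : f 0 = 0 -> forall x y, f (x + y) = f x + f y.
Proof.
move=> f0.
have h x : forall r, rk1 r -> f (x + r) = f x + f r.
  move=> r hr; rewrite diffK; congr (_ + _).
  have -> : f r = diff 0 r by rewrite /increment add0r f0 subr0.
  elim/mx_rk1_ind: x => // x q <- hq; exact: diff_shift.
move=> x; elim/mx_rk1_ind => [|y r IH hr]; first by rewrite addr0 f0 addr0.
by rewrite addrA (h (x + y) _ hr) (h y _ hr) IH addrA.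
Qed.
End Additivity.

(** * Multiplicativity *)

Section Multiplicative.
Variables (D D' : unitRingType).
Variables (fieldD : GRing.field_axiom D) (fieldD' : GRing.field_axiom D').
Variables (n n' : nat).
Local Notation M := 'M[D]_n.
Local Notation M' := 'M[D']_n'.
Variable f : M -> M'.
Hypothesis n_gt1 : (1 < n)%N.
Hypothesis fD : forall x y : M, f (x + y) = f x + f y.
Hypothesis f1 : f 1%:M = 1%:M.
Hypothesis f_col : forall r s, samecol r s -> samecol (f r) (f s).
Hypothesis f_row : forall r s, samerow r s -> samerow (f r) (f s).
Hypothesis f_unit : forall x : M, isunit x <-> isunit (f x).
Hypothesis f_line : forall r s', rk1 r -> par (f r) s' ->
  exists s, par r s /\ f s = s'.
Implicit Types (u : 'cV[D]_n) (v : 'rV[D]_n).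

Let f0 : f 0 = 0.
Proof. by apply: (@addrI _ (f 0)); rewrite -fD !addr0. Qed.

Let fB (x y : M) : f (x - y) = f x - f y.
Proof. by apply/eqP; rewrite eq_sym subr_eq -fD subrK. Qed.

Let f_rk1 r : rk1 r -> rk1 (f r).
Proof. by move/(par_refl fieldD) => [/f_col/samecol_rk1[]]. Qed.

Lemma unit_row_fix (E : unitRingType) m (a : 'cV[E]_m) (b : 'rV[E]_m) :
  b *m a = 1%:M -> isunit (1%:M - a *m b : 'M_m) -> b = 0.
Proof.
move=> ba; apply: left_kernel_nonunit.
by rewrite mulmxBr mulmx1 mulmxA ba mul1mx subrr.
Qed.

Lemma scalar11_neq0 (E : unitRingType) : (1%:M : 'M[E]_1) != 0.
Proof.
apply/eqP=> /matrixP/(_ 0 0); rewrite !mxE /= => /eqP.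
by rewrite oner_eq0.
Qed.

(** For a rank one matrix uv, 1 - uv is a unit unless vu = 1, so [f_unit] recognizes rank one
    idempotents. *)
Lemma image_idem u v : v *m u = 1%:M ->
  exists (u' : 'cV_n') (v' : 'rV_n'), f (u *m v) = u' *m v' /\ v' *m u' = 1%:M.
Proof.
move=> vu; have u0 : u != 0.
  by apply/eqP=> u0; have := scalar11_neq0 D; rewrite -vu u0 mulmx0 eqxx.
have v0 : v != 0.
  by apply/eqP=> v0; have := scalar11_neq0 D; rewrite -vu v0 mul0mx eqxx.
have /rk1P[u' [v' [u'0 v'0 e]]] := f_rk1 (rk1I u0 v0).
exists u', v'; split=> //; apply/eqP/negPn/negP => ne.
have /f_unit h : isunit (f (1%:M - u *m v)).
  by rewrite fB f1 e; apply: isunit_1_sub_rank1.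
by move: v0; rewrite (unit_row_fix vu h) eqxx.
Qed.

Lemma image_idem_col u v w : v *m u = 1%:M ->
  f (u *m v) *m f (u *m w) = f (u *m w).
Proof.
move=> vu; have [u' [v' [e e']]] := image_idem vu.
have [->|ne] := eqVneq (u *m w) 0; first by rewrite f0 mulmx0.
have uv0 : u *m v != 0.
  apply/eqP=> h; have := scalar11_neq0 D.
  by rewrite -vu -[v]mul1mx -vu -(mulmxA v) h mulmx0 mul0mx eqxx.
have := f_col (samecolI uv0 ne); rewrite e => /(samecolP fieldD')[w' ->].
by rewrite mulmxA -(mulmxA u') e' mulmx1.
Qed.

Lemma image_idem_row u v w : v *m u = 1%:M ->
  f (w *m v) *m f (u *m v) = f (w *m v).
Proof.
move=> vu; have [u' [v' [e e']]] := image_idem vu.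
have [->|ne] := eqVneq (w *m v) 0; first by rewrite f0 mul0mx.
have uv0 : u *m v != 0.
  apply/eqP=> h; have := scalar11_neq0 D.
  by rewrite -vu -[v]mul1mx -vu -(mulmxA v) h mulmx0 mul0mx eqxx.
have := f_row (samerowI uv0 ne); rewrite e => /(samerowP fieldD')[w' ->].
by rewrite mulmxA -(mulmxA w') e' mulmx1.
Qed.

(* If the product were nonzero, the image of the line through [u1 v] would
   contain an idempotent, although [1 - s] is invertible for [s] on that
   line. *)
Lemma image_orth u v u1 v1 : v *m u1 = 0 -> f (u *m v) *m f (u1 *m v1) = 0.
Proof.
move=> vu1.
have [->|ne] := eqVneq (u *m v) 0; first by rewrite f0 mul0mx.
have [->|ne1] := eqVneq (u1 *m v1) 0; first by rewrite f0 mulmx0.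
have v0 : v != 0 by apply: contraNneq ne => ->; rewrite mulmx0.
have u10 : u1 != 0 by apply: contraNneq ne1 => ->; rewrite mul0mx.
have q0 := mulcr_neq0 fieldD u10 v0.
have /rk1P[a [b [a0 b0 e]]] := f_rk1 (rk1_neq0I ne).
have := f_row (samerowI ne q0); rewrite e => /(samerowP fieldD')[a' eq].
have := f_col (samecolI q0 ne1); rewrite eq => /(samecolP fieldD')[b' e1].
rewrite e1 mulmxA -(mulmxA a); have [->|t0] := eqVneq (b *m a') 0.
  by rewrite mulmx0 mul0mx.
have [t [ht _]] := scalar1_inv fieldD' t0.
have a'0 : a' != 0 by apply: contraNneq t0 => ->; rewrite mulmx0.
have at0 : a' *m t != 0.
  apply/eqP=> h; have := scalar11_neq0 D'.
  by rewrite -ht -mulmxA h mulmx0 eqxx.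
have hp : par (f (u1 *m v)) (a' *m t *m b).
  by rewrite eq; apply: parI; apply: (mulcr_neq0 fieldD').
have [s [/(parP fieldD)[k es] fs]] := f_line (rk1I u10 v0) hp.
have ss : s *m s = 0.
  by rewrite {1}es -mulmxA es (mulmxA v) (mulmxA v) vu1 !mul0mx mulmx0.
have : isunit (1%:M - s).
  apply: (@isunit_mxI _ _ _ (1%:M + s)).
    by rewrite mulmxDr mulmx1 mulmxBl mul1mx ss subr0 subrK.
  by rewrite mulmxBr mulmx1 mulmxDl mul1mx ss addr0 addrK.
move/f_unit; rewrite fB f1 fs => /(@unit_row_fix _ _ (a' *m t) b).
by rewrite mulmxA ht => /(_ erefl) b00; rewrite b00 eqxx in b0.
Qed.

(** [image_idem_col] applies to [u2] and also to u2 + u1; expanding the latter and cancelling the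
    orthogonal products leaves the claim. *)
Lemma image_mul_orthl u1 v1 u2 v2 : v1 *m u2 = 1%:M -> v1 *m u1 = 0 ->
  f (u1 *m v1) *m f (u2 *m v2) = f (u1 *m v2).
Proof.
move=> h1 h0.
have h : v1 *m (u2 + u1) = 1%:M by rewrite mulmxDr h1 h0 addr0.
have := image_idem_col v2 h; rewrite !mulmxDl !fD mulmxDl !mulmxDr.
rewrite image_idem_col // (image_orth u2 v2 h0) (image_orth u1 v2 h0) !addr0.
exact: addrI.
Qed.

Lemma image_mul_orthr u1 v1 u2 v2 : v1 *m u2 = 1%:M -> v2 *m u2 = 0 ->
  f (u1 *m v1) *m f (u2 *m v2) = f (u1 *m v2).
Proof.
move=> h1 h0.
have h : (v1 + v2) *m u2 = 1%:M by rewrite mulmxDl h1 h0 addr0.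
have := image_idem_row u1 h; rewrite !mulmxDr !fD mulmxDr !mulmxDl.
rewrite image_idem_row // (image_orth u1 v1 h0) (image_orth u1 v2 h0) !addr0.
exact: addrI.
Qed.

Lemma complementary_idempotent u2 v1 : v1 *m u2 = 1%:M ->
  exists u3 v3, [/\ v3 *m u3 = 1%:M, v3 *m u2 = 0 & v1 *m u3 = 0].
Proof.
move=> h; have v10 : v1 != 0.
  by apply/eqP=> v0; have := scalar11_neq0 D; rewrite -h v0 mul0mx eqxx.
have [v hv] := row_other fieldD n_gt1 v10.
have [u3 [e1 e2]] := row_indep fieldD v10 hv.
have u30 : u3 != 0.
  by apply/eqP=> v0; have := scalar11_neq0 D; rewrite -e2 v0 mulmx0 eqxx.
exists u3, (v - v *m u2 *m v1); split=> //.
  by rewrite mulmxBl e2 -(mulmxA _ v1 u3) e1 mulmx0 subr0.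
by rewrite mulmxBl -(mulmxA _ v1) h mulmx1 subrr.
Qed.

(** One factor is routed through a second rank one idempotent, orthogonal to the first and available
    since n > 1, so that only the two orthogonal cases are needed. *)
Lemma image_mul_corner u2 v1 (c d : 'M_1) : v1 *m u2 = 1%:M ->
  f (u2 *m c *m v1) *m f (u2 *m d *m v1) = f (u2 *m c *m d *m v1).
Proof.
move=> h; have [u3 [v3 [h3 h32 h13]]] := complementary_idempotent h.
have -> : f (u2 *m d *m v1) = f (u2 *m v3) *m f (u3 *m (d *m v1)).
  by rewrite image_mul_orthl // mulmxA.
rewrite mulmxA (image_mul_orthr (u2 *m c) h h32) image_mul_orthl ?mulmxA //.
by rewrite h32 mul0mx.
Qed.

(** Peirce decomposition for the idempotent u2 v1: [u1] splits into a part killed by [v1] and a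
    multiple of [u2], and [v2] into a part killing [u2] and a multiple of [v1]. *)
Lemma image_mul_norm u1 v1 u2 v2 : v1 *m u2 = 1%:M ->
  f (u1 *m v1) *m f (u2 *m v2) = f (u1 *m v2).
Proof.
move=> h; set c := v1 *m u1; set d := v2 *m u2.
have eu : u1 = (u1 - u2 *m c) + u2 *m c by rewrite subrK.
have ev : v2 = (v2 - d *m v1) + d *m v1 by rewrite subrK.
have hu : v1 *m (u1 - u2 *m c) = 0 by rewrite mulmxBr (mulmxA v1) h mul1mx subrr.
have hv : (v2 - d *m v1) *m u2 = 0 by rewrite mulmxBl -(mulmxA d) h mulmx1 subrr.
clearbody c d.
move: (u1 - _) (v2 - _) eu ev hu hv => a b -> -> hu hv.
rewrite !(mulmxDl a) !fD mulmxDl image_mul_orthl //; congr (_ + _).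
rewrite !mulmxDr !fD mulmxDr image_mul_orthr //; congr (_ + _).
by rewrite !mulmxA image_mul_corner.
Qed.

Lemma image_mul (x y : M) : f (x *m y) = f x *m f y.
Proof.
have h1 u v u1 v1 : f (u *m v *m (u1 *m v1)) = f (u *m v) *m f (u1 *m v1).
  rewrite mulmxA -(mulmxA u); have [e0|t0] := eqVneq (v *m u1) 0.
    by rewrite e0 mulmx0 mul0mx f0 image_orth.
  (* The nonzero scalar v u1 is normalized to 1 by rescaling [u1]. *)
  have [t [ht th]] := scalar1_inv fieldD t0.
  have -> : u1 *m v1 = (u1 *m t) *m (v *m u1 *m v1).
    by rewrite mulmxA -(mulmxA u1) th mulmx1.
  by rewrite image_mul_norm ?mulmxA.
elim/mx_rk1_ind: x => [|x r IH /rk1P[u [v [_ _ ->]]]].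
  by rewrite f0 !mul0mx f0.
rewrite mulmxDl !fD mulmxDl IH; congr (_ + _).
elim/mx_rk1_ind: y {IH} => [|y s IH /rk1P[u1 [v1 [_ _ ->]]]].
  by rewrite f0 !mulmx0 f0.
by rewrite mulmxDr !fD mulmxDr IH h1.
Qed.
End Multiplicative.

(** * Transposition over the converse ring *)

Section Transpose.
Variables (E : unitRingType) (m : nat).

(** Over noncommutative scalars transposition reverses products only if the entries are multiplied
    in reverse order too. *)
Definition tr (x : 'M[E]_m) : 'M[E^c]_m := x^T.
Definition untr (x : 'M[E^c]_m) : 'M[E]_m := x^T.

Lemma trK : cancel tr untr. Proof. exact: trmxK. Qed.
Lemma untrK : cancel untr tr. Proof. exact: trmxK. Qed.

Lemma field_converse : GRing.field_axiom E -> GRing.field_axiom E^c.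
Proof. by move=> h x /h. Qed.

Lemma tr_mul x y : tr (x *m y) = tr y *m tr x.
Proof. by rewrite /tr trmx_mul_rev. Qed.

Lemma tr1 : tr 1%:M = 1%:M.
Proof. exact: tr_scalar_mx. Qed.

Lemma tr_isunit x : isunit x <-> isunit (tr x).
Proof.
split=> [/isunit_mxP[y [h1 h2]]|/isunit_mxP[y [h1 h2]]].
  by apply: (@isunit_mxI _ _ _ (tr y)); rewrite -tr_mul ?h1 ?h2 tr1.
by apply: (@isunit_mxI _ _ _ (untr y)); apply: (can_inj trK);
  rewrite tr_mul untrK ?h1 ?h2 tr1.
Qed.

Lemma tr_outer (u : 'cV[E]_m) (v : 'rV[E]_m) :
  tr (u *m v) = (v^T : 'cV[E^c]_m) *m (u^T : 'rV[E^c]_m).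
Proof. by rewrite /tr trmx_mul_rev. Qed.

Lemma trmx_neq0 (F : nmodType) p q (a : 'M[F]_(p, q)) : a != 0 -> a^T != 0.
Proof. by apply: contraNneq => e; rewrite -[a]trmxK e trmx0. Qed.

Lemma tr_samecol r s : samecol r s -> samerow (tr r) (tr s).
Proof.
move=> [u [[u0 [v [v0 ->]]] [_ [v' [v'0 ->]]]]].
exists (u^T : 'rV[E^c]_m); split; (split; first exact: trmx_neq0).
  by exists (v^T : 'cV[E^c]_m); rewrite tr_outer; split=> //; apply: trmx_neq0.
by exists (v'^T : 'cV[E^c]_m); rewrite tr_outer; split=> //; apply: trmx_neq0.
Qed.

Lemma tr_samerow r s : samerow r s -> samecol (tr r) (tr s).
Proof.
move=> [v [[v0 [u [u0 ->]]] [_ [u' [u'0 ->]]]]].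
exists (v^T : 'cV[E^c]_m); split; (split; first exact: trmx_neq0).
  by exists (u^T : 'rV[E^c]_m); rewrite tr_outer; split=> //; apply: trmx_neq0.
by exists (u'^T : 'rV[E^c]_m); rewrite tr_outer; split=> //; apply: trmx_neq0.
Qed.
End Transpose.

Lemma untr_par (E : unitRingType) m (r s : 'M[E^c]_m) :
  par r s -> par (untr r) (untr s).
Proof.
move=> [hc hr]; split.
  exact: (@tr_samerow E^c m r s hr).
exact: (@tr_samecol E^c m r s hc).
Qed.

Section ChartRing.
Variables (D D' : unitRingType).
Variables (fieldD : GRing.field_axiom D) (fieldD' : GRing.field_axiom D').
Variables (n n' : nat).
Local Notation M := 'M[D]_n.
Local Notation M' := 'M[D']_n'.

(** The type of directions at 0 decides the case. If rows and columns are exchanged, [image_mul] is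
    applied to [f] followed by transposition, and multiplicativity of this composite is
    antimultiplicativity of [f]. *)
Lemma chart_ring (phi : projline M -> projline M') (f : M -> M') :
  chart phi f -> (1 < n)%N -> f 0 = 0 -> f 1 = 1 ->
  ring_iso f \/ ring_anti_iso f.
Proof.
move=> chart_f n1 f0 f1.
have fD := chart_additive fieldD fieldD' chart_f n1 f0.
have [psi [g [chart_g _ _ fK gK]]] := chart_inv chart_f.
have bij_f : bijective f by exists g.
have fB : zmod_morphism f.
  by move=> x y; apply/eqP; rewrite eq_sym subr_eq -fD subrK.
have f_unit x : isunit x <-> isunit (f x).
  by have := chart_isunit x 0 chart_f; rewrite f0 !subr0.
have d0 r : increment f 0 r = f r by rewrite /increment add0r f0 subr0.
have f_line r s' : rk1 r -> par (f r) s' -> exists s, par r s /\ f s = s'.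
  move=> _ h; exists (g s'); split; last exact: gK.
  have g0 : g 0 = 0 by rewrite -{1}f0 fK.
  have e y : increment g 0 y = g y by rewrite /increment add0r g0 subr0.
  by have := diff_par fieldD' fieldD chart_g 0 h; rewrite !e fK.
have [b hb] := dirtype_ex fieldD fieldD' chart_f n1 0.
have {}hb c r s : same c r s -> same (c (+) b) (f r) (f s) by move/hb; rewrite !d0.
case: b hb => hb; [right|left].
  split=> // x y; apply: (can_inj (@trK D' n')).
  rewrite -[tr (f y * f x)]/(tr (f y *m f x)) tr_mul.
  apply: (image_mul fieldD (@field_converse D' fieldD') (f := fun x => tr (f x)) n1).
  - by move=> x' y'; rewrite fD; apply: raddfD.
  - by rewrite [f _]f1; apply: tr1.
  - by move=> r s /(hb false) h; apply: tr_samerow h.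
  - by move=> r s /(hb true) h; apply: tr_samecol h.
  - by move=> x'; rewrite f_unit; apply: tr_isunit.
  move=> r s' hr h.
  have [s [rs fs]] : exists s, par r s /\ f s = untr s'.
    by apply: f_line => //; rewrite -[f r](@trK D' n'); apply: untr_par.
  by exists s; split=> //; rewrite fs untrK.
split=> //; split=> // x y.
apply: (image_mul fieldD fieldD' n1 fD f1 _ _ f_unit f_line) => r s h.
  exact: (hb false).
exact: (hb true).
Qed.
End ChartRing.

(** * Jordan isomorphisms inducing a bijection *)

Definition separated (R : pzRingType) := forall p q r : projline R,
  r <> p -> r <> q -> exists z, [/\ distant z p, distant z q & ~ distant z r].

(** One of two different points is not infinity. Separating it from infinity and from the other
    point yields an affine point that tells the two apart. *)
Lemma aff_distant_eq (R : pzRingType) (p q : projline R) : separated R ->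
  (forall x, distant p (aff x) <-> distant q (aff x)) -> p = q.
Proof.
move=> sep h; apply: contrapT => npq.
have [qi|qi] := pselect (q = inf R).
  have [z [zq zi nz]] : exists z,
      [/\ distant z q, distant z (inf R) & ~ distant z p].
    by apply: sep => //; rewrite -qi.
  have [x ez] := (distant_infP z).1 (distant_sym zi); subst z.
  by apply: nz; apply/distant_sym/h/distant_sym.
have [z [zq zi nz]] : exists z, [/\ distant z p, distant z (inf R) & ~ distant z q].
  by apply: sep => //; apply/nesym.
have [x ez] := (distant_infP z).1 (distant_sym zi); subst z.
by apply: nz; apply/distant_sym/h/distant_sym.
Qed.

Lemma projectivity_comp (R : pzRingType) (g h : GL2 R) : exists k : GL2 R,
  forall p, projectivity k p = projectivity h (projectivity g p).
Proof.
exists (MkGL2 (invertible_mxM (GL2P g) (GL2P h))) => p.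
by apply: esym; apply: projectivityM.
Qed.

Lemma distant_iso_comp (R S T : pzRingType) (f : projline R -> projline S)
  (g : projline S -> projline T) :
  distant_iso f -> distant_iso g -> distant_iso (fun p => g (f p)).
Proof.
move=> [bf df] [bg dg]; split; first exact: (bij_comp bg bf).
by move=> p q; rewrite df dg.
Qed.

Lemma distant_iso_inv (R S : pzRingType) (f : projline R -> projline S) g :
  distant_iso f -> cancel f g -> cancel g f -> distant_iso g.
Proof.
move=> [bf df] fK gK; split; first by exists f.
by move=> p q; rewrite df !gK.
Qed.

Lemma normalize (R R' : pzRingType) (phi : projline R -> projline R') :
  distant_iso phi -> exists (g : GL2 R') psi f,
  [/\ chart psi f, f 0 = 0, f 1 = 1 & forall p, phi p = projectivity g (psi p)].
Proof.
move=> phi_iso; have [bphi dphi] := phi_iso.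
have [g [g0 g1]] := projline_homogeneous2 ((dphi _ _).1 (distant_inf_aff 0)).
have [h [gh hg]] := GL2_inv g.
pose phi1 p := projectivity h (phi p).
have phi1_iso : distant_iso phi1 := distant_iso_comp phi_iso (projectivity_iso h).
have phi1i : phi1 (inf R) = inf R' by rewrite /phi1 -g0 gh.
have phi10 : phi1 (aff 0) = aff 0 by rewrite /phi1 -g1 gh.
have [t et] : exists t, phi1 (aff 1) = aff t.
  by apply/distant_infP; rewrite -phi1i; apply/phi1_iso.2/distant_inf_aff.
have [s [ts st]] : isunit t.
  rewrite -[t]subr0; apply/distant_aff_aff; rewrite -et -phi10; apply/phi1_iso.2.
  by apply/distant_aff_aff; rewrite subr0; apply: isunit1.
(* This matrix sends [aff x] to [aff (x * s)]: it brings the image [t] of 1 back to 1 and fixes 0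
   and infinity. *)
have invk : invertible_mx (mx2 s 0 0 1).
  exists (mx2 t 0 0 1).
  by rewrite !mx2M !mul0r !mulr0 !addr0 !add0r mulr1 ts st mx2_1.
pose k := MkGL2 invk.
have ki : projectivity k (inf R') = inf R'.
  have := prep_projectivity k (prep_inf R'); rewrite /= !mxE /=.
  rewrite !mul1r !mul0r !addr0 => hk; apply: (prep_eq hk).
  have := prep_scale (x := s) _ (prep_inf R'); rewrite mulr1 mulr0; apply.
  by exists t.
have kaff x : projectivity k (aff x) = aff (x * s).
  have := prep_projectivity k (prep_aff x); rewrite /= !mxE /=.
  rewrite !mulr0 !mul1r addr0 add0r => hk; apply: (prep_eq hk).
  exact: prep_aff.
have [k' [kk' k'k]] := GL2_inv k.
pose psi p := projectivity k (phi1 p).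
have psi_iso : distant_iso psi := distant_iso_comp phi1_iso (projectivity_iso k).
have psii : psi (inf R) = inf R' by rewrite /psi phi1i.
have /choice[f hf] (x : R) : exists y, psi (aff x) = aff y.
  by apply/distant_infP; rewrite -psii; apply/psi_iso.2/distant_inf_aff.
have [l hl] := projectivity_comp k' g.
exists l, psi, f; split.
- by split.
- by apply: (@aff_inj R'); rewrite -hf /psi phi10 kaff mul0r.
- by apply: (@aff_inj R'); rewrite -hf /psi et kaff ts.
- by move=> p; rewrite hl /psi kk' /phi1 hg.
Qed.

(** Testing both points against the affine points reduces the claim to units. For an
    anti-isomorphism the two elements have the form zw - 1 and wz - 1, and [isunit_sub1] compares
    them. *)
Lemma chart_jordan (R R' : pzRingType) (phi : projline R -> projline R') f :
  chart phi f -> separated R' -> f 0 = 0 -> ring_iso f \/ ring_anti_iso f ->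
  forall a b, phi (jordan_point a b) = jordan_point (f a) (f b).
Proof.
move=> chart_f sep f0 hf a b; apply: aff_distant_eq => // y.
have [psi [g [_ _ _ _ gK]]] := chart_inv chart_f.
rewrite -[y]gK; move: (g y) => x {y}.
have [[_ dphi] _ phif] := chart_f.
have -> : distant (phi (jordan_point a b)) (aff (f x)) <->
    isunit (a * b - 1 - a * x).
  by rewrite -phif -dphi; apply: distant_aff (prep_jordan a b).
have -> : distant (jordan_point (f a) (f b)) (aff (f x)) <->
    isunit (f a * f b - 1 - f a * f x).
  exact: distant_aff (prep_jordan (f a) (f b)).
have -> : isunit (a * b - 1 - a * x) <-> isunit (f (a * b - 1 - a * x)).
  by have := chart_isunit (a * b - 1 - a * x) 0 chart_f; rewrite f0 !subr0.
case: hf => [[fB [f1 fM] _]|[fB f1 fM _]].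
  by rewrite !fB !fM f1.
rewrite !fB !fM f1 addrAC -mulrBl [f a * f b - 1 - _]addrAC -mulrBr.
by split; apply: isunit_sub1.
Qed.

Lemma matrix_separated (D : unitRingType) n :
  GRing.field_axiom D -> separated 'M[D]_n.
Proof. by move=> fieldD p q r; apply: separation. Qed.

Definition jordan_induced_up_to (R R' : pzRingType)
    (phi : projline R -> projline R') :=
  exists (g : GL2 R') (f : R -> R'), (ring_iso f \/ ring_anti_iso f) /\
    forall a b, phi (jordan_point a b) = projectivity g (jordan_point (f a) (f b)).

Lemma matrix_jordan (D D' : unitRingType) n n' (fieldD : GRing.field_axiom D)
    (fieldD' : GRing.field_axiom D') (phi : projline 'M[D]_n -> projline 'M[D']_n') :
  (1 < n)%N -> distant_iso phi -> jordan_induced_up_to phi.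
Proof.
move=> n1 /normalize[g [psi [f [chart_f f0 f1 e]]]].
have hf := chart_ring fieldD fieldD' chart_f n1 f0 f1.
exists g, f; split=> // a b; rewrite e; congr projectivity.
by apply: chart_jordan => //; apply: matrix_separated.
Qed.

Lemma zmod_morphismD (R S : zmodType) (f : R -> S) :
  zmod_morphism f -> {morph f : x y / x + y}.
Proof.
move=> fB x y.
by have := fB (x + y) y; rewrite addrK => /eqP; rewrite eq_sym subr_eq => /eqP.
Qed.

(** * Transport of the projective line along ring isomorphisms *)

Section Transport.
Variables (R S : pzRingType).

Lemma ring_iso_inv (t : R -> S) t' : ring_iso t -> cancel t t' -> cancel t' t ->
  ring_iso t'.
Proof.
move=> [tB [t1 tM] _] tK t'K; split.
- by move=> x y; apply: (can_inj tK); rewrite tB !t'K.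
- by split=> [|x y]; apply: (can_inj tK); rewrite ?tM ?t1 !t'K.
- by exists t.
Qed.

Variables (t : R -> S) (t_iso : ring_iso t).

Let tB x y : t (x - y) = t x - t y. Proof. by case: t_iso. Qed.
Let t0 : t 0 = 0. Proof. by have := tB 0 0; rewrite !subrr. Qed.
Let tD x y : t (x + y) = t x + t y.
Proof. exact: zmod_morphismD. Qed.
Let t1 : t 1 = 1. Proof. by case: t_iso => _ []. Qed.
Let tM x y : t (x * y) = t x * t y. Proof. by case: t_iso => _ []. Qed.

Lemma iso_invertible a b c d : invertible_mx (mx2 a b c d) ->
  invertible_mx (mx2 (t a) (t b) (t c) (t d)).
Proof.
move=> /mx2_invP[p [q [r [s [[e1 e2 e3 e4] [e5 e6 e7 e8]]]]]].
by apply/mx2_invP; exists (t p), (t q), (t r), (t s);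
  rewrite -!tM -!tD e1 e2 e3 e4 e5 e6 e7 e8 t0 t1.
Qed.

Lemma iso_isunit x : isunit x -> isunit (t x).
Proof. by move=> [y [h1 h2]]; exists (t y); rewrite -!tM h1 h2 t1. Qed.

Lemma projline_map : exists T : projline R -> projline S,
  forall p a b, prep a b p -> prep (t a) (t b) (T p).
Proof.
have /choice[T hT] (p : projline R) :
    exists q, forall a b, prep a b p -> prep (t a) (t b) q.
  have [a [b hp]] := prep_ex p; have [[c [d /iso_invertible/prep_mk[q hq]]] _] := hp.
  exists q => a' b' /(prep_uniq hp)[x [ux -> ->]]; rewrite !tM.
  by apply: prep_scale => //; apply: iso_isunit.
by exists T.
Qed.
End Transport.

Lemma projline_iso (R S : pzRingType) (t : R -> S) t' :
  ring_iso t -> cancel t t' -> cancel t' t ->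
  exists (T : projline R -> projline S) (T' : projline S -> projline R),
  [/\ distant_iso T, cancel T T', cancel T' T,
      forall p a b, prep a b p -> prep (t a) (t b) (T p) &
      forall p a b, prep a b p -> prep (t' a) (t' b) (T' p)].
Proof.
move=> t_iso tK t'K; have t'_iso := ring_iso_inv t_iso tK t'K.
have [T hT] := projline_map t_iso; have [T' hT'] := projline_map t'_iso.
exists T, T'.
have TK : cancel T T'.
  move=> p; have [a [b hp]] := prep_ex p.
  by have := hT' _ _ _ (hT _ _ _ hp); rewrite !tK => /prep_eq; apply.
have T'K : cancel T' T.
  move=> p; have [a [b hp]] := prep_ex p.
  by have := hT _ _ _ (hT' _ _ _ hp); rewrite !t'K => /prep_eq; apply.
split=> //; split; first by exists T'.
move=> p q; have [a [b hp]] := prep_ex p; have [c [d hq]] := prep_ex q.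
apply: (iff_trans (distantP hp hq)); apply: iff_sym.
apply: (iff_trans (distantP (hT _ _ _ hp) (hT _ _ _ hq))).
split; last exact: iso_invertible.
by move/(iso_invertible t'_iso); rewrite !tK.
Qed.

Lemma separated_iso (R S : pzRingType) (t : R -> S) :
  ring_iso t -> separated S -> separated R.
Proof.
move=> t_iso sep p q r rp rq; have [_ _ [t' tK t'K]] := t_iso.
have [T [T' [[_ dT] TK T'K _ _]]] := projline_iso t_iso tK t'K.
have [||z [h1 h2 h3]] := sep (T p) (T q) (T r); [by move/(can_inj TK)..|].
by exists (T' z); split; [apply/dT; rewrite T'K..|move/dT; rewrite T'K].
Qed.

Lemma unit_regular_iso (R S : pzRingType) (t : R -> S) :
  ring_iso t -> unit_regular S -> unit_regular R.
Proof.
move=> t_iso ureg x; have [_ [_ tM] [t' tK t'K]] := t_iso.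
have [w [uw e]] := ureg (t x); exists (t' w); split.
  exact: iso_isunit (ring_iso_inv t_iso tK t'K) _ uw.
by apply: (can_inj tK); rewrite !tM t'K.
Qed.

Lemma ring_iso_or_anti_comp (A B C E : pzRingType)
    (s : A -> B) (f : B -> C) (t : C -> E) :
  ring_iso s -> ring_iso f \/ ring_anti_iso f -> ring_iso t ->
  ring_iso (fun x => t (f (s x))) \/ ring_anti_iso (fun x => t (f (s x))).
Proof.
move=> [sB [s1 sM] bs] hf [tB [t1 tM] bt].
case: hf => [[fB [f1 fM] bf]|[fB f1 fM bf]]; [left|right].
  split; last exact: (bij_comp bt (bij_comp bf bs)).
    by move=> x y; rewrite sB fB tB.
  by split=> [|x y]; rewrite ?s1 ?f1 ?t1 // sM fM tM.
split; last exact: (bij_comp bt (bij_comp bf bs)).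
- by move=> x y; rewrite sB fB tB.
- by rewrite s1 f1 t1.
- by move=> x y; rewrite sM fM tM.
Qed.

Lemma jordan_induced_up_to_iso (R S R' S' : pzRingType) (t : R -> S) (t' : R' -> S')
    (phi : projline R -> projline R') :
  ring_iso t -> ring_iso t' ->
  (forall psi : projline S -> projline S',
    distant_iso psi -> jordan_induced_up_to psi) ->
  distant_iso phi -> jordan_induced_up_to phi.
Proof.
move=> t_iso t'_iso H phi_iso.
have [_ _ [s tK sK]] := t_iso; have [_ _ [s' t'K s'K]] := t'_iso.
have [T [T1 [T_iso TK T1K hT hT1]]] := projline_iso t_iso tK sK.
have [T' [T'1 [T'_iso T'K T'1K hT' hT'1]]] := projline_iso t'_iso t'K s'K.
have T1_iso := distant_iso_inv T_iso TK T1K.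
have [g [f [hf e]]] :=
  H _ (distant_iso_comp T1_iso (distant_iso_comp phi_iso T'_iso)).
have s'_iso := ring_iso_inv t'_iso t'K s'K.
have invg : invertible_mx (mx2 (s' (g 0 0)) (s' (g 0 1)) (s' (g 1 0)) (s' (g 1 1))).
  by apply: (iso_invertible s'_iso); rewrite -mx2_eta; apply: GL2P.
exists (MkGL2 invg), (fun x => s' (f (t x))); split.
  exact: (ring_iso_or_anti_comp t_iso hf s'_iso).
have [tB [t1 tM] _] := t_iso; have [s'B [s'1 s'M] _] := s'_iso.
have s'0 : s' 0 = 0 by have := s'B 0 0; rewrite !subrr.
have s'D := zmod_morphismD s'B.
move=> a b; rewrite -[phi _]T'K -{1}[jordan_point a b]TK.
have -> : T (jordan_point a b) = jordan_point (t a) (t b).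
  apply: (prep_eq (hT _ _ _ (prep_jordan a b))).
  by rewrite tB tM t1; apply: prep_jordan.
rewrite [T' _]e; apply: prep_eq (hT'1 _ _ _ (prep_projectivity g (prep_jordan _ _))) _.
have := prep_projectivity (MkGL2 invg) (prep_jordan (s' (f (t a))) (s' (f (t b)))).
by rewrite /= !mxE /= !s'D !s'M s'B s'M s'1.
Qed.

(** * Endomorphism rings as matrix rings *)

Section Endo.
Import VectorInternalTheory.
Variables (K : unitRingType) (U : vectType K).

(** Matrices act on row vectors from the right, so the left to right product of [endo] becomes the
    matrix product. *)
Definition endo_mx (f : endo U) : 'M[K]_(dim U) := f2mx (f : 'End(U)).

Lemma mul_endo_mx f w : w *m endo_mx f = v2r ((f : 'End(U)) (r2v w)).
Proof. by rewrite unlock /= !r2vK. Qed.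

Lemma endo_mx_iso : ring_iso endo_mx.
Proof.
split.
- move=> f g; apply/row_matrixP=> i; rewrite !rowE mulmxBr !mul_endo_mx.
  by rewrite -raddfB; congr v2r; rewrite [LHS](@add_lfunE K U U) opp_lfunE.
- split.
    apply/row_matrixP=> i; rewrite !rowE mulmx1 mul_endo_mx.
    by rewrite [X in v2r X](@id_lfunE K U) r2vK.
  move=> f g; apply/row_matrixP=> i; rewrite !rowE mul_endo_mx.
  rewrite -[endo_mx f * endo_mx g]/(endo_mx f *m endo_mx g) mulmxA !mul_endo_mx v2rK.
  by rewrite [X in v2r X](@comp_lfunE K U U U).
exists (fun A => Hom A : endo U); [by case | by []].
Qed.

Hypotheses (fieldK : GRing.field_axiom K).

Lemma endo_separated : separated (endo U).
Proof. exact: separated_iso endo_mx_iso (matrix_separated fieldK). Qed.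

Lemma endo_unit_regular : unit_regular (endo U).
Proof. exact: unit_regular_iso endo_mx_iso (matrix_unit_regular fieldK (n := _)). Qed.
End Endo.

Lemma endo_jordan (K K' : unitRingType) (U : vectType K) (U' : vectType K')
    (phi : projline (endo U) -> projline (endo U')) :
  GRing.field_axiom K -> GRing.field_axiom K' -> (1 < dim U)%N ->
  distant_iso phi -> jordan_induced_up_to phi.
Proof.
move=> fieldK fieldK' dimU.
apply: jordan_induced_up_to_iso (endo_mx_iso U) (endo_mx_iso U') _ => psi.
exact: matrix_jordan.
Qed.

(** * Products *)

Lemma inj_surj_bijective (X Y : Type) (f : X -> Y) :
  injective f -> (forall y, exists x, f x = y) -> bijective f.
Proof.
by move=> inj /choice[g fg]; exists g => // x; apply: inj; rewrite fg.
Qed.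

Lemma jordan_point_surj (R : pzRingType) (p : projline R) :
  unit_regular R -> exists a b, p = jordan_point a b.
Proof.
move=> ureg; have [c [d hp]] := prep_ex p.
have [x [s [us su]]] := common_affine ureg hp.
(* As [s] inverts c - d x, the row (c, d) scaled by -s has the form (ab - 1, a) with a = -s d and b
   = x. *)
exists (- s * d), x; apply: prep_eq (prep_jordan _ _).
have -> : - s * d * x - 1 = - s * c.
  by rewrite -su mulrBr opprB !mulNr -mulrA addKr.
by apply: prep_scale hp; apply: isunitN; exists (c - d * x).
Qed.

Lemma common_distant (R : pzRingType) (p q : projline R) : unit_regular R ->
  exists z, distant z p /\ distant z q.
Proof.
move=> ureg; have [g <-] := projline_homogeneous q.
have [h [gh hg]] := GL2_inv g; have [c [d hp]] := prep_ex (projectivity h p).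
have [x ux] := common_affine ureg hp; exists (projectivity g (aff x)); split.
  rewrite -[p]hg; apply/distant_projectivity/distant_sym.
  exact/(distant_aff _ hp).
exact/distant_projectivity/distant_sym/distant_inf_aff.
Qed.

(** * Points, distance and projectivities of a product, componentwise *)

Section Components.
Variables (I : finType) (R : I -> pzRingType).
Local Notation PR := (projline (prod_ring R)).

Lemma coord_inj (x y : prod_ring R) : (forall i, x i = y i) -> x = y.
Proof. by move=> h; apply/ffunP. Qed.

Lemma coord_mk (g : forall i, R i) : exists x : prod_ring R, forall i, x i = g i.
Proof. by exists [ffun i => g i] => i; rewrite ffunE. Qed.

Lemma coordD (x y : prod_ring R) i : (x + y) i = x i + y i.
Proof. by rewrite ffunE. Qed.
Lemma coordN (x : prod_ring R) i : (- x) i = - x i.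
Proof. by rewrite ffunE. Qed.
Lemma coordM (x y : prod_ring R) i : (x * y) i = x i * y i.
Proof. by rewrite ffunE. Qed.
Lemma coord1 i : (1 : prod_ring R) i = 1.
Proof. by rewrite ffunE. Qed.
Lemma coord0 i : (0 : prod_ring R) i = 0.
Proof. by rewrite ffunE. Qed.

Lemma invertible_coord (a b c d : prod_ring R) :
  invertible_mx (mx2 a b c d) <->
  forall i, invertible_mx (mx2 (a i) (b i) (c i) (d i)).
Proof.
split=> [/mx2_invP[p [q [r [s [[e1 e2 e3 e4] [e5 e6 e7 e8]]]]]] i|h].
  apply/mx2_invP; exists (p i), (q i), (r i), (s i).
  by rewrite -!coordM -!coordD e1 e2 e3 e4 e5 e6 e7 e8 coord0 coord1.
have {}h i : exists w : R i * R i * R i * R i,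
    [/\ a i * w.1.1.1 + b i * w.1.2 = 1, a i * w.1.1.2 + b i * w.2 = 0,
        c i * w.1.1.1 + d i * w.1.2 = 0 & c i * w.1.1.2 + d i * w.2 = 1] /\
    [/\ w.1.1.1 * a i + w.1.1.2 * c i = 1, w.1.1.1 * b i + w.1.1.2 * d i = 0,
        w.1.2 * a i + w.2 * c i = 0 & w.1.2 * b i + w.2 * d i = 1].
  by have /mx2_invP[p [q [r [s hs]]]] := h i; exists (p, q, r, s).
pose w i := sval (cid (h i)); have hw i := svalP (cid (h i)).
have [p hp] := coord_mk (fun i => (w i).1.1.1).
have [q hq] := coord_mk (fun i => (w i).1.1.2).
have [r hr] := coord_mk (fun i => (w i).1.2).
have [s hs] := coord_mk (fun i => (w i).2).
apply/mx2_invP; exists p, q, r, s; split; split; apply: coord_inj => i;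
  rewrite coordD !coordM ?coord0 ?coord1 ?hp ?hq ?hr ?hs /w;
  by case: (hw i) => -[? ? ? ?] [].
Qed.

Lemma prep_component (a b : prod_ring R) p i :
  prep a b p -> prep (a i) (b i) (component i p).
Proof.
move=> [[c [d /invertible_coord h]] e]; split; first by exists (c i), (d i).
rewrite /= e; apply/seteqP; split=> [_ [_ [x _ <-] <-]|_ [y _ <-]].
  exists (x i) => //; apply/rowP=> j.
  by rewrite !mxE /coord_at; case: (j == 0); rewrite ffunE.
have [x hx] := coord_at_surj y; exists (x *: row2 a b); first by exists x.
rewrite -hx; apply/rowP=> j.
by rewrite !mxE /coord_at; case: (j == 0); rewrite ffunE.
Qed.

Lemma component_ext (p q : PR) : (forall i, component i p = component i q) -> p = q.
Proof.
move=> h; have [a [b hp]] := prep_ex p; have [c [d hq]] := prep_ex q.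
have {}h i : exists w : R i * R i, [/\ w.1 * w.2 = 1, w.2 * w.1 = 1,
    c i = w.1 * a i & d i = w.1 * b i].
  have hp' := prep_component i hp; have hq' := prep_component i hq.
  rewrite -h in hq'; have [x [[y [xy yx]] -> ->]] := prep_uniq hp' hq'.
  by exists (x, y).
have [x hx] := coord_mk (fun i => (sval (cid (h i))).1).
have [y hy] := coord_mk (fun i => (sval (cid (h i))).2).
have ux : isunit x.
  by exists y; split; apply: coord_inj => i; rewrite coordM coord1 hx hy;
    case: (svalP (cid (h i))).
have := prep_scale ux hp.
have -> : x * a = c.
  by apply: coord_inj => i; rewrite coordM hx; case: (svalP (cid (h i))).
have -> : x * b = d.
  by apply: coord_inj => i; rewrite coordM hx; case: (svalP (cid (h i))).
by move=> h'; apply: prep_eq h' hq.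
Qed.

Lemma component_mk (q : forall i, projline (R i)) :
  exists p : PR, forall i, component i p = q i.
Proof.
have h i : exists w : R i * R i * R i * R i,
    prep w.1.1.1 w.1.1.2 (q i) /\ invertible_mx (mx2 w.1.1.1 w.1.1.2 w.1.2 w.2).
  have [a [b hq]] := prep_ex (q i); have [[c [d hi]] _] := hq.
  by exists (a, b, c, d).
have [a ha] := coord_mk (fun i => (sval (cid (h i))).1.1.1).
have [b hb] := coord_mk (fun i => (sval (cid (h i))).1.1.2).
have [c hc] := coord_mk (fun i => (sval (cid (h i))).1.2).
have [d hd] := coord_mk (fun i => (sval (cid (h i))).2).
have /prep_mk[p hp] : invertible_mx (mx2 a b c d).
  by apply/invertible_coord => i; rewrite ha hb hc hd; case: (svalP (cid (h i))).
exists p => i; apply: (prep_eq (prep_component i hp)).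
by rewrite ha hb; case: (svalP (cid (h i))).
Qed.

Lemma component_set (p : PR) i (x : projline (R i)) :
  exists p' : PR, component i p' = x /\
    forall j, j != i -> component j p' = component j p.
Proof.
have [p' hp'] := component_mk (dfwith (fun j => component j p) x).
exists p'; split=> [|j ji]; rewrite hp'; first exact: dfwith_in.
by apply: dfwith_out; rewrite eq_sym.
Qed.

Lemma component_distant (p q : PR) :
  distant p q <-> forall i, distant (component i p) (component i q).
Proof.
have [a [b hp]] := prep_ex p; have [c [d hq]] := prep_ex q.
apply: (iff_trans (distantP hp hq)); apply: (iff_trans (invertible_coord _ _ _ _)).
by split=> h i; have := h i => hi;
  apply/(distantP (prep_component i hp) (prep_component i hq)).
Qed.

Lemma component_jordan i (a b : prod_ring R) :
  component i (jordan_point a b) = jordan_point (a i) (b i).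
Proof.
apply: (prep_eq (prep_component i (prep_jordan a b))).
by rewrite coordD coordN coordM coord1; apply: prep_jordan.
Qed.

Lemma component_projectivity (g : forall i, GL2 (R i)) :
  exists G : GL2 (prod_ring R), forall i p,
    component i (projectivity G p) = projectivity (g i) (component i p).
Proof.
have [a ha] := coord_mk (fun i => g i 0 0).
have [b hb] := coord_mk (fun i => g i 0 1).
have [c hc] := coord_mk (fun i => g i 1 0).
have [d hd] := coord_mk (fun i => g i 1 1).
have invG : invertible_mx (mx2 a b c d).
  by apply/invertible_coord => i; rewrite ha hb hc hd -mx2_eta; apply: GL2P.
exists (MkGL2 invG) => i p; have [x [y hp]] := prep_ex p.
apply: (prep_eq (prep_component i (prep_projectivity (MkGL2 invG) hp))).
have := prep_projectivity (g i) (prep_component i hp).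
by rewrite /= !mxE /= !coordD !coordM ha hb hc hd.
Qed.
End Components.

(** Stands in for the interval between two vertices of a Hamming graph, expressed through the
    distant relation alone. *)
Definition between (R : pzRingType) (p q r : projline R) :=
  forall z, distant z p -> distant z q -> distant z r.

Lemma between_iso (R S : pzRingType) (phi : projline R -> projline S) p q r :
  distant_iso phi -> between p q r <-> between (phi p) (phi q) (phi r).
Proof.
move=> [[psi phiK psiK] d]; split=> h z.
  by rewrite -[z]psiK -!d; apply: h.
by rewrite !d; apply: h.
Qed.

(** * The Hamming graph of a product *)

Section Hamming.
Variables (I : finType) (R : I -> pzRingType).
Local Notation PR := (projline (prod_ring R)).
Implicit Types (p q r : PR) (i j k : I).

Definition differ1 i p q := component i p <> component i q /\
  forall j, j != i -> component j p = component j q.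

Lemma differ1_sym i p q : differ1 i p q -> differ1 i q p.
Proof. by move=> [h1 h2]; split=> [|j ji]; [apply: nesym|rewrite h2]. Qed.

Lemma differ1_inj i j p q : differ1 i p q -> differ1 j p q -> i = j.
Proof.
move=> [h1 h2] [h3 h4]; apply/eqP/negPn/negP => ij.
by apply: h1; apply: h4.
Qed.

Lemma differ1_trans i p q r : differ1 i p q -> differ1 i p r -> q <> r ->
  differ1 i q r.
Proof.
move=> [h1 h2] [h3 h4] nqr.
have h j : j != i -> component j q = component j r by move=> ji; rewrite -h2 // h4.
split=> // e; apply: nqr; apply: component_ext => j.
by have [->|/h] := eqVneq j i.
Qed.

(** Coordinates are changed from those of [p] to those of [q] one at a time, along an enumeration of
    the index set. *)
Lemma differ1_ind (Q : PR -> PR -> Prop) (P : I -> Prop) :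
  (forall p, Q p p) -> (forall p q r, Q p q -> Q q r -> Q p r) ->
  (forall i p q, P i -> differ1 i p q -> Q p q) ->
  forall p q, (forall i, component i p <> component i q -> P i) -> Q p q.
Proof.
move=> Qr Qt Q1 p q hP.
have {hP} : forall i, component i p <> component i q -> i \in enum I /\ P i.
  by move=> i /hP; rewrite mem_enum.
elim: (enum I) p => [|i l IH] p h.
  have -> : p = q; last exact: Qr.
  by apply: component_ext => i; apply: contrapT => /h[].
have [e|ne] := pselect (component i p = component i q).
  apply: IH => j nj; have [] := h _ nj; rewrite inE => /orP[/eqP ej|//].
  by case: nj; rewrite ej.
have [p1 [e1 h1]] := component_set p (component i q).
apply: (Qt _ p1).
  apply: (Q1 i); first by case: (h _ ne).
  by split=> [|j /h1 ->]; rewrite ?e1.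
apply: IH => j nj; have [ej|ji] := eqVneq j i; first by case: nj; rewrite ej e1.
rewrite h1 // in nj; have [] := h _ nj.
by rewrite inE (negPf ji).
Qed.

Hypothesis sepR : forall i, separated (R i).
Hypothesis uregR : forall i, unit_regular (R i).
Hypothesis irrR : forall i (x : projline (R i)), ~ distant x x.

Lemma other_point i (x : projline (R i)) : exists y, y <> x /\ distant x y.
Proof.
have [z [zx _]] := common_distant x x (@uregR i); exists z.
by split; [move=> e; rewrite e in zx; apply: irrR zx | apply: distant_sym].
Qed.

Lemma differ1_ex i p : exists q, differ1 i p q.
Proof.
have [y [ny _]] := other_point (component i p).
have [q [e h]] := component_set p y; exists q; split=> [|j /h ->//].
by rewrite e; apply: nesym.
Qed.

(** If r_i differs from p_i and q_i, separation in the factor [i] gives one coordinate of a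
    counterexample; [common_distant] supplies the others. *)
Lemma betweenP p q r : between p q r <->
  forall i, component i r = component i p \/ component i r = component i q.
Proof.
split=> [h i|h z /component_distant zp /component_distant zq]; last first.
  by apply/component_distant => i; case: (h i) => ->.
apply: contrapT => /not_orP[n1 n2].
have [zi [z1 z2 z3]] := sepR n1 n2.
have hz j : exists z, distant z (component j p) /\ distant z (component j q).
  exact: common_distant.
have [z0 hz0] := component_mk (fun j => sval (cid (hz j))).
have [z [ezi ez]] := component_set z0 zi.
apply: z3; rewrite -ezi; apply: (component_distant _ _).1.
apply: h; apply/component_distant => j; have [->|ji] := eqVneq j i;
  rewrite ?ezi // ez // hz0; by case: (svalP (cid (hz j))).
Qed.

(** The box between [p] and [q] consists of just these two points exactly when one coordinate
    differs: with two differing coordinates, mixing them produces a further point. *)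
Lemma differ1P p q : (exists i, differ1 i p q) <->
  p <> q /\ forall r, between p q r -> r = p \/ r = q.
Proof.
split=> [[i [ne h]]|[ne h]].
  split=> [e|r /betweenP hr]; first by apply: ne; rewrite e.
  have hj j : j != i -> component j r = component j p.
    by move=> ji; case: (hr j) => ->; rewrite ?h.
  case: (hr i) => e; [left|right]; apply: component_ext => j;
    have [->//|ji] := eqVneq j i; by rewrite hj // h.
have [i ni] : exists i, component i p <> component i q.
  apply: contrapT => hn; apply: ne; apply: component_ext => i.
  by apply: contrapT => hi; apply: hn; exists i.
exists i; split=> // j ji; apply: contrapT => nj.
have [r [er hr]] := component_set q (component i p).
case: (h r) => [|e|e].
- apply/betweenP => k; have [->|ki] := eqVneq k i; first by left.
  by right; rewrite hr.
- by apply: nj; rewrite -e hr.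
- by apply: ni; rewrite -er e.
Qed.
End Hamming.

(** * The induced map of coordinate directions *)

Section Decomposition.
Variables (I I' : finType) (R : I -> pzRingType) (R' : I' -> pzRingType).
Hypothesis sepR : forall i, separated (R i).
Hypothesis uregR : forall i, unit_regular (R i).
Hypothesis irrR : forall i (x : projline (R i)), ~ distant x x.
Hypothesis sepR' : forall i, separated (R' i).
Hypothesis uregR' : forall i, unit_regular (R' i).
Hypothesis irrR' : forall i (x : projline (R' i)), ~ distant x x.
Variables (phi : projline (prod_ring R) -> projline (prod_ring R')).
Hypothesis phi_iso : distant_iso phi.

Let phi_inj : injective phi. Proof. by case: phi_iso => /bij_inj. Qed.

Lemma differ1_iso p q :
  (exists i, differ1 i p q) <-> (exists j, differ1 j (phi p) (phi q)).
Proof.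
apply: (iff_trans (differ1P sepR uregR p q)); apply: iff_sym.
apply: (iff_trans (differ1P sepR' uregR' _ _)).
have [[psi phiK psiK] _] := phi_iso.
split=> -[ne h]; split=> [e|r]; try by apply: ne; rewrite ?e.
- by move/(between_iso _ _ _ phi_iso)/h => [/phi_inj|/phi_inj]; [left|right].
- by apply: ne; apply: phi_inj.
- rewrite -[r]psiK => /(between_iso _ _ _ phi_iso)/h.
  by case=> ->; [left|right].
Qed.

(** Two neighbours of [p] in one direction are adjacent to each other, so with [phi p] their images
    form a triangle, and a triangle of a Hamming graph has a single direction. *)
Lemma local_direction i p :
  exists j, forall q, differ1 i p q -> differ1 j (phi p) (phi q).
Proof.
have [q0 h0] := differ1_ex uregR irrR i p.
have [j hj] := (differ1_iso p q0).1 (ex_intro _ i h0).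
exists j => q h; have [->//|nq] := pselect (q = q0).
have [j' hj'] := (differ1_iso p q).1 (ex_intro _ i h).
have [l hl] := (differ1_iso q0 q).1 (ex_intro _ i (differ1_trans h0 h (nesym nq))).
suff -> : j = j' by [].
apply/eqP/negPn/negP=> jj'.
have n1 : component j (phi q0) <> component j (phi q).
  by rewrite -(hj'.2 j jj'); apply: nesym; exact: hj.1.
have n2 : component j' (phi q0) <> component j' (phi q).
  by rewrite -(hj.2 j') 1?eq_sym //; exact: hj'.1.
have el k : component k (phi q0) <> component k (phi q) -> k = l.
  by move=> nk; apply/eqP/negPn/negP=> kl; apply: nk; apply: hl.2.
by case/negP: jj'; rewrite (el _ n1) (el _ n2).
Qed.

Lemma direction_map : exists sigma : I -> I', forall i p q,
  differ1 i p q -> differ1 (sigma i) (phi p) (phi q).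
Proof.
have /choice[sg hsg] (w : I * projline (prod_ring R)) :
    exists j, forall q, differ1 w.1 w.2 q -> differ1 j (phi w.2) (phi q).
  exact: local_direction.
pose s p i := sg (i, p).
have hs i p q : differ1 i p q -> differ1 (s p i) (phi p) (phi q).
  exact: (hsg (i, p)).
(* If two directions at [p] were merged, neighbours [q] and [r] in them would have adjacent images
   and so be adjacent, although they differ in two coordinates. *)
have sinj p i k : i != k -> s p i != s p k.
  move=> ik; apply/eqP => e.
  have [q hq] := differ1_ex uregR irrR i p.
  have [r hr] := differ1_ex uregR irrR k p.
  have nqr : q <> r.
    by move=> eqr; rewrite eqr in hq; case/eqP: ik; apply: differ1_inj hq hr.
  have hq' := hs _ _ _ hq; have hr' := hs _ _ _ hr; rewrite e in hq'.
  have [l hl] : exists l, differ1 l q r.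
    apply/differ1_iso; exists (s p k); apply: differ1_trans hq' hr' _.
    by move/phi_inj.
  have el j : component j q <> component j r -> j = l.
    by move=> nj; apply/eqP/negPn/negP=> jl; apply: nj; apply: hl.2.
  case/eqP: (ik); transitivity l; [|apply: esym]; apply: el.
    by rewrite -(hr.2 i) //; apply: nesym; exact: hq.1.
  by rewrite -(hq.2 k) 1?eq_sym //; exact: hr.1.
(* The edge from [p] to [q] is completed to a square by moving along [k]. If [k] had different image
   directions at [p] and [q], the fourth edge of the image square would change two coordinates. *)
have s_step i p q : differ1 i p q -> s p = s q.
  move=> h; apply: funext => k.
  have hpq := hs _ _ _ h; have hqp := hs _ _ _ (differ1_sym h).
  have [->|ki] := eqVneq k i; first exact: differ1_inj hpq (differ1_sym hqp).
  have [x [nx _]] := other_point uregR irrR (component k p).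
  have [p' [ep' hp']] := component_set p x; have [q' [eq' hq']] := component_set q x.
  have h1 : differ1 k p p' by split=> [|j /hp' ->//]; rewrite ep'; apply: nesym.
  have h2 : differ1 k q q'.
    by split=> [|j /hq' ->//]; rewrite eq' -h.2 //; apply: nesym.
  have h3 : differ1 i p' q'.
    split=> [|j ji]; first by rewrite hp' 1?eq_sym // hq' 1?eq_sym //; exact: h.1.
    have [->|jk] := eqVneq j k; first by rewrite ep' eq'.
    by rewrite hp' // hq' // h.2.
  have H1 := hs _ _ _ h1; have H2 := hs _ _ _ h2; have H3 := hs _ _ _ h3.
  have eqi : s q i = s p i by apply: differ1_inj (differ1_sym hqp) hpq.
  have da : s q k != s p i by rewrite -eqi; apply: sinj.
  have ab : s p i != s p k by apply: sinj; rewrite eq_sym.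
  apply/eqP/negPn/negP; rewrite eq_sym => db.
  have el j : component j (phi p') <> component j (phi q') -> j = s p' i.
    by move=> nj; apply/eqP/negPn/negP=> jl; apply: nj; apply: H3.2.
  case/eqP: (da); transitivity (s p' i); [|apply: esym]; apply: el.
    by rewrite -(H1.2 _ db) (hpq.2 _ da); exact: H2.1.
  by rewrite -(H1.2 _ ab) -(H2.2 (s p i)) 1?eq_sym //; exact: hpq.1.
have s_const p q : s p = s q.
  apply: (@differ1_ind _ _ (fun p q => s p = s q) (fun=> True)) => //.
    by move=> p1 q1 r1 ->.
  by move=> i p1 q1 _; apply: s_step.
by exists (s (inf _)) => i p q h; rewrite (s_const _ p); apply: hs.
Qed.
End Decomposition.

Section Factors.
Variables (I I' : finType) (R : I -> pzRingType) (R' : I' -> pzRingType).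
Hypothesis sepR : forall i, separated (R i).
Hypothesis uregR : forall i, unit_regular (R i).
Hypothesis irrR : forall i (x : projline (R i)), ~ distant x x.
Variable phi : projline (prod_ring R) -> projline (prod_ring R').
Variable sigma : I -> I'.
Hypothesis sigma_inj : injective sigma.
Hypothesis dir : forall i p q, differ1 i p q -> differ1 (sigma i) (phi p) (phi q).

(** Points with equal [k]-th component are joined by a path avoiding the direction [k]; as [sigma]
    is injective, its image avoids the direction [sigma k]. *)
Lemma factor_ex k : exists phi_k : projline (R k) -> projline (R' (sigma k)),
  forall p, component (sigma k) (phi p) = phi_k (component k p).
Proof.
have fact p q : component k p = component k q ->
    component (sigma k) (phi p) = component (sigma k) (phi q).
  move=> e; apply: (@differ1_ind _ _ (fun p q => component (sigma k) (phi p) =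
      component (sigma k) (phi q)) (fun i => i != k)).
  - by [].
  - by move=> p1 q1 r1 ->.
  - move=> i p1 q1 ik /dir[_ h]; apply: h.
    by apply: contraNneq ik => /sigma_inj ->.
  by move=> i ni; apply/eqP => ik; rewrite ik in ni.
have /choice[g hg] (x : projline (R k)) : exists y, forall p, component k p = x ->
    component (sigma k) (phi p) = y.
  have [p [ep _]] := component_set (inf _) x.
  by exists (component (sigma k) (phi p)) => q eq; apply: fact; rewrite ep.
by exists g => p; apply: hg.
Qed.

Lemma factor_distant k l (phi_k : projline (R k) -> projline (R' l)) :
  (forall p q, distant p q -> distant (phi p) (phi q)) ->
  (forall p, component l (phi p) = phi_k (component k p)) ->
  forall x y, distant x y -> distant (phi_k x) (phi_k y).
Proof.
move=> d h x y xy.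
have [p [ep _]] := component_set (inf _) x.
have hz j : exists z, distant (component j p) z.
  by have [z [_ h']] := other_point uregR irrR (component j p); exists z.
have [q0 hq0] := component_mk (fun j => sval (cid (hz j))).
have [q [eq hq]] := component_set q0 y.
rewrite -ep -eq -!h; apply: (component_distant _ _).1; apply: d.
apply/component_distant => j; have [->|jk] := eqVneq j k; first by rewrite ep eq.
by rewrite hq // hq0; case: (cid (hz j)).
Qed.
End Factors.

Section Decompose.
Variables (I I' : finType) (R : I -> pzRingType) (R' : I' -> pzRingType).
Hypothesis sepR : forall i, separated (R i).
Hypothesis uregR : forall i, unit_regular (R i).
Hypothesis irrR : forall i (x : projline (R i)), ~ distant x x.
Hypothesis sepR' : forall i, separated (R' i).
Hypothesis uregR' : forall i, unit_regular (R' i).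
Hypothesis irrR' : forall i (x : projline (R' i)), ~ distant x x.
Variables (phi : projline (prod_ring R) -> projline (prod_ring R')).
Hypothesis phi_iso : distant_iso phi.

Lemma decompose : exists (sigma : I -> I'), bijective sigma /\
  forall k, exists phi_k : projline (R k) -> projline (R' (sigma k)),
    distant_iso phi_k /\
    forall p, component (sigma k) (phi p) = phi_k (component k p).
Proof.
have [[psi phiK psiK] dphi] := phi_iso.
have psi_iso := distant_iso_inv phi_iso phiK psiK.
have [s hs] := direction_map sepR uregR irrR sepR' uregR' phi_iso.
have [t ht] := direction_map sepR' uregR' irrR' sepR uregR psi_iso.
have sK : cancel s t.
  move=> i; have [q hq] := differ1_ex uregR irrR i (inf _).
  have := ht _ _ _ (hs _ _ _ hq); rewrite !phiK => h; exact: differ1_inj h hq.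
have tK : cancel t s.
  move=> i; have [q hq] := differ1_ex uregR' irrR' i (inf _).
  have := hs _ _ _ (ht _ _ _ hq); rewrite !psiK => h; exact: differ1_inj h hq.
exists s; split; first by exists t.
move=> k; have [f hf] := factor_ex (can_inj sK) hs k.
have [g hg] := factor_ex (can_inj tK) ht (s k).
(* The values of [g] lie over the index t (s k), which equals [k] only propositionally; [sK] adjusts
   the type. *)
have {hg g}[g hg] : exists g : projline (R' (s k)) -> projline (R k),
    forall p, component k (psi p) = g (component (s k) p).
  by move: g hg; rewrite sK => g hg; exists g.
have fK : cancel f g.
  move=> x; have [p [<- _]] := component_set (inf _) x.
  by rewrite -hf -hg phiK.
have gK : cancel g f.
  move=> x; have [p [<- _]] := component_set (inf _) x.
  by rewrite -hg -hf psiK.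
exists f; split=> //; split; first by exists g.
move=> x y; split.
  exact: (factor_distant uregR irrR (fun p q => (dphi p q).1) hf).
move=> fxy; rewrite -[x]fK -[y]fK; move: fxy.
exact: (factor_distant uregR' irrR' (fun p q => (psi_iso.2 p q).1) hg).
Qed.
End Decompose.

(** The value at t j is transported along s (t j) = j; at j = s k the transport is trivial by proof
    irrelevance. *)
Lemma sigma_family (I I' : Type) (s : I -> I') (T : I' -> Type)
    (g : forall k, T (s k)) :
  bijective s -> exists G : forall j, T j, forall k, G (s k) = g k.
Proof.
move=> [t sK tK].
exists (fun j => eq_rect _ T (g (t j)) j (tK j)) => k.
move: (tK (s k)); rewrite sK => e.
by rewrite (Prop_irrelevance e erefl).
Qed.

Lemma compose (I I' : finType) (R : I -> pzRingType) (R' : I' -> pzRingType)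
  (phi : projline (prod_ring R) -> projline (prod_ring R')) (s : I -> I')
  (phi_ : forall k, projline (R k) -> projline (R' (s k))) : bijective s ->
  (forall k, distant_iso (phi_ k)) ->
  (forall p k, component (s k) (phi p) = phi_ k (component k p)) ->
  distant_iso phi.
Proof.
move=> bs iso h.
have all_s (Q : I' -> Prop) : (forall k, Q (s k)) -> forall j, Q j.
  by case: bs => t _ tK hQ j; rewrite -[j]tK.
split.
  apply: inj_surj_bijective => [p q e|P].
    apply: component_ext => k; have [b _] := iso k; apply: (bij_inj b).
    by rewrite -!h e.
  have hp k : exists x, phi_ k x = component (s k) P.
    by have [[g _ gK] _] := iso k; exists (g (component (s k) P)).
  have [p ep] := component_mk (fun k => sval (cid (hp k))).
  exists p; apply: component_ext; apply: all_s => k.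
  by rewrite h ep; case: (cid (hp k)).
move=> p q; split=> [/component_distant d|/component_distant d]; apply/component_distant.
  by apply: all_s => k; rewrite !h; apply/(iso k).2.
by move=> k; apply/(iso k).2; rewrite -!h.
Qed.

(** Invertibility of a matrix with two equal rows forces 1 = 0, impossible on a nonzero space. *)
Lemma endo_irreflexive (K : unitRingType) (U : vectType K) (x : projline (endo U)) :
  (0 < dim U)%N -> ~ distant x x.
Proof.
move=> dimU; have [a [b hx]] := prep_ex x.
move=> /(distantP hx hx)/mx2_invP[p [_ [r [_ [[-> _ e _] _]]]]].
have [_ [t1 _] _] := endo_mx_iso U.
have t0 : endo_mx (0 : endo U) = 0.
  by have [tB _ _] := endo_mx_iso U; have := tB 0 0; rewrite !subrr.
move: t1; rewrite e t0 => /matrixP/(_ (Ordinal dimU) (Ordinal dimU)).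
by rewrite !mxE eqxx => /esym/eqP; rewrite oner_eq0.
Qed.

Lemma iso_or_antiD (R S : pzRingType) (f : R -> S) :
  ring_iso f \/ ring_anti_iso f -> {morph f : x y / x + y}.
Proof.
by move=> hf; apply: zmod_morphismD; case: hf => -[].
Qed.

Lemma iso_or_anti_bij (R S : pzRingType) (f : R -> S) :
  ring_iso f \/ ring_anti_iso f -> bijective f.
Proof. by case=> -[]. Qed.

Lemma iso_or_anti_jordan (R S : pzRingType) (f : R -> S) :
  ring_iso f \/ ring_anti_iso f -> jordan_hom f.
Proof.
move=> hf; split; first exact: iso_or_antiD.
  by case: hf => [[_ [->]]|[_ ->]].
move=> a b; case: hf => [[_ [_ fM] _]|[_ _ fM _]]; first by rewrite !fM.
by rewrite !fM mulrA.
Qed.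

(** * Assembling the Jordan isomorphism of the product *)

Section ProductJordan.
Variables (I I' : finType) (R : I -> pzRingType) (R' : I' -> pzRingType).
Variables (phi : projline (prod_ring R) -> projline (prod_ring R')) (s : I -> I').
Variable (phi_ : forall k, projline (R k) -> projline (R' (s k))).
Hypothesis bij_s : bijective s.
Hypothesis uregR : forall i, unit_regular (R i).
Hypothesis phi_comp : forall p k, component (s k) (phi p) = phi_ (component k p).
Hypothesis phi_jordan : forall k, jordan_induced_up_to (@phi_ k).

Lemma product_jordan :
  exists (gamma : GL2 (prod_ring R')) (alpha : prod_ring R -> prod_ring R')
         (alpha_ : forall k, R k -> R' (s k))
         (alpha_t : projline (prod_ring R) -> projline (prod_ring R')),
    [/\ jordan_iso alpha,
        forall k, ring_iso (@alpha_ k) \/ ring_anti_iso (@alpha_ k),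
        forall x k, alpha x (s k) = alpha_ k (x k),
        jordan_induced alpha alpha_t
      & forall p, phi p = projectivity gamma (alpha_t p)].
Proof.
have all_s (Q : I' -> Prop) : (forall k, Q (s k)) -> forall j, Q j.
  by case: bij_s => t _ tK hQ j; rewrite -[j]tK.
have h k : exists w : GL2 (R' (s k)) * (R k -> R' (s k)),
    (ring_iso w.2 \/ ring_anti_iso w.2) /\ forall a b,
    phi_ (jordan_point a b) = projectivity w.1 (jordan_point (w.2 a) (w.2 b)).
  by have [g [f hf]] := phi_jordan k; exists (g, f).
pose al k : R k -> R' (s k) := (sval (cid (h k))).2.
have hal k : ring_iso (al k) \/ ring_anti_iso (al k).
  by rewrite /al; case: (cid (h k)) => w [].
have [ga hga] := sigma_family (T := fun j => GL2 (R' j))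
  (fun k => (sval (cid (h k))).1) bij_s.
have hphi k a b : phi_ (jordan_point a b) =
    projectivity (ga (s k)) (jordan_point (al k a) (al k b)).
  by rewrite hga /al; case: (cid (h k)) => w [_ hw] /=; apply: hw.
have /choice[alpha halpha] (x : prod_ring R) : exists y : prod_ring R',
    forall k, y (s k) = al k (x k).
  have [G hG] := sigma_family (T := fun j => R' j) (fun k => al k (x k)) bij_s.
  by have [y hy] := coord_mk G; exists y => k; rewrite hy hG.
have [gamma hgamma] := component_projectivity ga.
have [delta [gd dg]] := GL2_inv gamma.
have main a b : phi (jordan_point a b) =
    projectivity gamma (jordan_point (alpha a) (alpha b)).
  apply: component_ext; apply: all_s => k.
  by rewrite phi_comp hgamma !component_jordan hphi !halpha.
(* Taking [phi] followed by the inverse of [gamma] as induced map settles well-definedness: [main]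
   computes it at R(ab - 1, a), and by [jordan_point_surj] in each factor every point has this
   form. *)
exists gamma, alpha, al, (fun p => projectivity delta (phi p)); split=> //.
- split; last first.
    apply: inj_surj_bijective => [x y e|y].
      apply: coord_inj => k; apply: (bij_inj (iso_or_anti_bij (hal k))).
      by rewrite -!halpha e.
    have hx k : exists x, al k x = y (s k).
      by have [g _ gK] := iso_or_anti_bij (hal k); exists (g (y (s k))).
    have [x ex] := coord_mk (fun k => sval (cid (hx k))); exists x.
    by apply: coord_inj; apply: all_s => k; rewrite halpha ex; case: (cid (hx k)).
  split=> [x y||x y]; apply: coord_inj; apply: all_s => k; rewrite ?coordM ?coordD !halpha.
  + by rewrite coordD (iso_or_antiD (hal k)).
  + by rewrite !coord1; have [_ ->] := iso_or_anti_jordan (hal k).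
  + by rewrite !coordM; have [_ _ ->] := iso_or_anti_jordan (hal k).
- move=> p q; split=> [<-|[a [b [-> ->]]]]; last by rewrite main gd.
  have hp k : exists w : R k * R k, component k p = jordan_point w.1 w.2.
    by have [a [b e]] := jordan_point_surj (component k p) (@uregR k); exists (a, b).
  have [a ha] := coord_mk (fun k => (sval (cid (hp k))).1).
  have [b hb] := coord_mk (fun k => (sval (cid (hp k))).2).
  have ep : p = jordan_point a b.
    by apply: component_ext => k; rewrite component_jordan ha hb; case: (cid (hp k)).
  by exists a, b; split=> //; rewrite ep main gd.
Qed.
End ProductJordan.

Theorem theorem6p7 (m m' : nat) (m_gt0 : (0 < m)%N) (m'_gt0 : (0 < m')%N)
    (K : 'I_m -> unitRingType) (K' : 'I_m' -> unitRingType)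
    (K_field : forall i, GRing.field_axiom (K i))
    (K'_field : forall j, GRing.field_axiom (K' j))
    (U : forall i, vectType (K i)) (U' : forall j, vectType (K' j))
    (U_gt0 : forall i, (1 <= dim (U i))%N)
    (U'_gt0 : forall j, (1 <= dim (U' j))%N) :
  let R : 'I_m -> pzRingType := fun i => endo (U i) in
  let R' : 'I_m' -> pzRingType := fun j => endo (U' j) in
  forall phi : projline (prod_ring R) -> projline (prod_ring R'),
  (distant_iso phi <->
    exists (e : m = m') (s : 'S_m)
           (phi_ : forall k, projline (R k) -> projline (R' (cast_ord e (s k)))),
      componentwise phi phi_) /\
  (forall (e : m = m') (s : 'S_m)
          (phi_ : forall k, projline (R k) -> projline (R' (cast_ord e (s k)))),
    componentwise phi phi_ ->
    (forall i, (1 < dim (U i))%N) ->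
    exists (gamma : GL2 (prod_ring R')) (alpha : prod_ring R -> prod_ring R')
           (alpha_ : forall k, R k -> R' (cast_ord e (s k)))
           (alpha_t : projline (prod_ring R) -> projline (prod_ring R')),
      [/\ jordan_iso alpha,
          forall k, ring_iso (alpha_ k) \/ ring_anti_iso (alpha_ k),
          forall x k, alpha x (cast_ord e (s k)) = alpha_ k (x k),
          jordan_induced alpha alpha_t
        & forall p, phi p = projectivity gamma (alpha_t p)]).
Proof.
move=> R R' phi.
have bij_s (e : m = m') (s : 'S_m) : bijective (fun k => cast_ord e (s k)).
  exists (fun j => s^-1%g (cast_ord (esym e) j)) => j.
    by rewrite cast_ordK permK.
  by rewrite permKV cast_ordKV.
have uregR i : unit_regular (R i) by apply: endo_unit_regular.
split; first split.
- have sepR i : separated (R i) by apply: endo_separated.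
  have sepR' i : separated (R' i) by apply: endo_separated.
  have uregR' i : unit_regular (R' i) by apply: endo_unit_regular.
  have irrR i (x : projline (R i)) : ~ distant x x by apply: endo_irreflexive.
  have irrR' i (x : projline (R' i)) : ~ distant x x by apply: endo_irreflexive.
  move=> /(decompose sepR uregR irrR sepR' uregR' irrR')[sigma [bij_sigma h]].
  have e : m = m' by have := bij_eq_card bij_sigma; rewrite !card_ord.
  (* [sigma] relates two different ordinal types; casting along m = m' turns it into a permutation,
     and [es] rewrites it in the form required by [componentwise]. *)
  have inj_s : injective (fun k => cast_ord (esym e) (sigma k)).
    by move=> i j /cast_ord_inj/(bij_inj bij_sigma).
  have es : sigma = fun k => cast_ord e (perm inj_s k).
    by apply: funext => k; rewrite permE cast_ordKV.
  rewrite es in h; exists e, (perm inj_s), (fun k => sval (cid (h k))).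
  by split=> [k|p k]; case: (cid (h k)) => f [].
- move=> [e [s [phi_ [iso h]]]]; exact: compose (bij_s e s) iso h.
move=> e s phi_ [iso h] dimU.
apply: (product_jordan (bij_s e s) uregR h) => k.
exact: (endo_jordan (@K_field k) (@K'_field _) (dimU k) (iso k)).
Qed.
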